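(* Let $\rho>0$ and let $a,b:[0,\infty)\to[0,\infty)$ and $\mathfrak n$ satisfy: (i) $a,b\in\mathcal C^0([0,\infty))\cap\mathcal C^1(0,\infty)$; (ii) $a'$ and $b'$ are bounded on $(1,\infty)$; (iii) $a(x)>0$ for all $x>0$ and $1/a\in L^1(0,1)$; (iv) $\Phi:=b/a$ on $(0,\infty)$ has a limit $\Phi_0$ at $0^+$, $\Phi_0<\rho$, and $\Phi'\in L^1(0,1)$; (v) $\mathfrak n$ is nonnegative and locally Lipschitz on $[\Phi_0,\infty)$; (vi) there exists $x^*>0$ such that $\Phi$ is monotone on $(0,x^* )$. Let $f^{\rm in}\geq0$ with $f^{\rm in}\in L^1((0,\infty),(1+x)\,dx)$ and $\rho-\int_0^\infty xf^{\rm in}(x)\,dx>\Phi_0$. Then for all $T>0$ there exists at most one solution to the Lifshitz--Slyozov equation on $[0,T)$ with mass $\rho$, kinetic rates $\{a,b,\mathfrak n\}$ and initial value $f^{\rm in}$.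
   Context: For $T\in(0,\infty]$, a function $f$ is a solution to the Lifshitz--Slyozov equation on $[0,T)$ with mass $\rho$, kinetic rates $\{a,b,\mathfrak n\}$ and initial value $f^{\rm in}$ if: (1) $f\in\mathcal C([0,T),w-L^1((0,\infty),x\,dx))$ (continuity into $L^1$ endowed with its weak topology), $f\ge0$, and for each $T^*<T$, $f\in L^\infty((0,T^* ),L^1((0,\infty),dx))$; (2) for all $t\in[0,T)$, $u(t):=\rho-\int_0^\infty xf(t,x)\,dx>\Phi_0$; (3) for all $\varphi\in\mathcal C^1_c([0,T)\times[0,\infty))$, $\int_0^T\int_0^\infty(\partial_t\varphi+(a(x)u(t)-b(x))\partial_x\varphi)f\,dx\,dt+\int_0^T\varphi(t,0)\mathfrak n(u(t))\,dt+\int_0^\infty\varphi(0,x)f^{\rm in}(x)\,dx=0$. *)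

(* Defs.v *)
From HB Require Import structures.
From mathcomp Require Import all_boot all_order all_algebra.
From mathcomp Require Import all_classical all_reals all_analysis.
Set Implicit Arguments. Unset Strict Implicit. Unset Printing Implicit Defensive.
Import Order.TTheory GRing.Theory Num.Theory.
Import numFieldNormedType.Exports.
Local Open Scope classical_set_scope.
Local Open Scope ring_scope.

Section LS.
Variable R : realType.
Notation mu := (@lebesgue_measure R).

Definition halfline : set R := `]0, +oo[.
Definition timeint (T : R) : set R := `[0, T[.

Definition LS_u (rho : R) (f : R -> R -> R) (t : R) : R :=
  rho - Rintegral mu halfline (fun x => x * f t x).

(* phi is (the restriction to [0,T) x [0,oo) of) a C^1 function with compact
   support in [0,T) x [0,oo); dt, dx are its partial derivatives. *)
Definition LS_test (T : R) (phi dt dx : R -> R -> R) : Prop :=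
  [/\ (forall t x : R, is_derive t (1:R) (fun s => phi s x) (dt t x)),
      (forall t x : R, is_derive x (1:R) (phi t) (dx t x)),
      continuous (fun p : R * R => dt p.1 p.2),
      continuous (fun p : R * R => dx p.1 p.2) &
      (exists T' X : R, T' < T /\
        forall t x, (T' <= t \/ X <= x) -> phi t x = 0)].

Definition LS_solution (T rho Phi0 : R) (a b n fin : R -> R)
    (f : R -> R -> R) : Prop :=
  [/\
  (forall t, t \in timeint T ->
     mu.-integrable halfline (fun x => (x * f t x)%:E)),
  (* (1b) continuity into L^1(x dx) with its weak topology *)
  (forall g : R -> R, measurable_fun setT g ->
     (exists M : R, forall x, `|g x| <= M) ->
     {within timeint T, continuous
        (fun t => Rintegral mu halfline (fun x => g x * (x * f t x)))}),
  (forall t, t \in timeint T ->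
     {ae mu, forall x, x \in halfline -> 0 <= f t x}) &
  [/\
  (forall Ts, Ts < T -> exists M : R,
     {ae mu, forall t, t \in `]0, Ts[ -> (
        mu.-integrable halfline (fun x => (f t x)%:E) /\
        (\int[mu]_(x in halfline) (f t x)%:E <= M%:E)%E) }),
  (forall t, t \in timeint T -> Phi0 < LS_u rho f t) &
  (forall phi dt dx, LS_test T phi dt dx ->
     (\int[mu]_(t in timeint T)
         (\int[mu]_(x in halfline)
            ((dt t x + (a x * LS_u rho f t - b x) * dx t x) * f t x)%:E)
      + \int[mu]_(t in timeint T) (phi t 0 * n (LS_u rho f t))%:E
      + \int[mu]_(x in halfline) (phi 0 x * fin x)%:E = 0)%E)]
  ].

End LS.

(* Main.v *)
(** Tested against smooth approximations of the indicators of $(x,\infty)$, the weak formulation says that the smoothed tails $F(t,x)$, approximately $\int_x^\infty f(t,y)\,dy$, satisfy $\partial_t F + (a u - b)\,\partial_x F = 0$ up to a commutator of the order of the smoothing scale $h$. Let $D$ be the difference of the tails of two solutions. A weighted integral of $|D|$ obeys a Gronwall inequality. Near $0$ the weight is $w = e^{\kappa\Phi}/a$: with $\kappa = 0$ if $\Phi$ is nondecreasing there and $\kappa$ the inverse of a lower bound of $u - \Phi$ otherwise, $\partial_x(w\,(a u - b)) \le 0$, while $w\,(a u - b)$ remains bounded at $0$. Away from $0$ a constant weight suffices, since $a'$ and $b'$ are bounded. The flux through $0$ is controlled by the difference of the total masses; as the characteristics enter the domain at $0$, the mass grows exactly at the rate $\mathfrak n(u)$, so that this difference is at most a multiple of $\int_0^t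 |u_1 - u_2|$, and $u_1 - u_2$ is in turn minus the integral of $D$. As the smoothing, truncation and regularization parameters vanish, the integrals of $D$ over all intervals vanish, and $f_1 = f_2$ almost everywhere by Lebesgue differentiation. *)

(* Two obstacles shape the proof. Time continuity is available only for observables bounded by a
   multiple of $x$, so neither the total mass nor a flux at $0$ is known to depend continuously on
   time. Everything is therefore expressed by moments of functions that vanish near $0$, and the
   mass is reached as an increasing limit: its monotonicity stands in for continuity when the weak
   time derivative is removed. Moreover, the rates are $C^1$ only away from $0$ and the weight may
   blow up there, so that the smoothing scale has to be chosen after the distance to $0$ at which
   the energy stops. The weight is dictated by $w (a u - b) = e^{\kappa\Phi} (u - \Phi)$, whose
   derivative is $e^{\kappa\Phi} \Phi' (\kappa (u - \Phi) - 1)$: the derivative of $a$ has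
   disappeared, and the sign of $\Phi'$ decides. To close the Gronwall argument, $V(t) = \int_0^t
   |u_1 - u_2|$ is added to the energies: the flux at $0$ is bounded through $V$, and $V'$ through
   the energies. *)
Require Import Defs.
From HB Require Import structures.
From mathcomp Require Import all_boot all_order all_algebra.
From mathcomp Require Import all_classical all_reals all_analysis.
From mathcomp Require Import measurable_realfun.
From mathcomp Require Import ring lra.
Import Order.TTheory GRing.Theory Num.Theory.
Import numFieldNormedType.Exports.
Local Open Scope classical_set_scope.
Local Open Scope ring_scope.
Set Implicit Arguments.
Unset Strict Implicit.

(** * Smoothing kernels *)

Section Kernels.
Variable R : realType.
Implicit Types x y z b d L : R.

(* [step] is the cubic smooth step, [bump] its derivative and [ramp] its primitive,
   which differs from [Num.max 0] by at most 1. *)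
Definition clamp z : R := Num.max 0 (Num.min z 1).
Definition bump z : R := 6 * clamp z * (1 - clamp z).
Definition step z : R := clamp z ^+ 2 * (3 - 2 * clamp z).
Definition ramp z : R :=
  clamp z ^+ 3 - clamp z ^+ 4 / 2 + Num.max 0 (z - 1).

Lemma clampP z : [\/ z <= 0 /\ clamp z = 0, [/\ 0 <= z, z <= 1 & clamp z = z] |
   1 <= z /\ clamp z = 1].
Proof.
rewrite /clamp; have [z1|z1] := lerP z 1.
- by have [z0|z0] := lerP 0 z; [constructor 2|constructor 1; split => //; exact: ltW].
- by rewrite max_r //; constructor 3; rewrite ltW.
Qed.

Lemma clamp01 z : 0 <= clamp z <= 1.
Proof. by case: (clampP z) => [[? ->]|[? ? ->]|[? ->]]; lra. Qed.

Lemma clamp_lip x y : `|clamp x - clamp y| <= `|x - y|.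
Proof.
rewrite ler_norml; have := ler_norm (x - y); have := ler_norm (- (x - y)).
rewrite normrN; case: (clampP x) => [[? ->]|[? ? ->]|[? ->]];
 case: (clampP y) => [[? ->]|[? ? ->]|[? ->]] *; apply/andP; split; lra.
Qed.

Lemma bump_ge0 z : 0 <= bump z.
Proof. by rewrite /bump; have := clamp01 z; nra. Qed.

Lemma bump_le z : bump z <= 2.
Proof. by rewrite /bump; have := clamp01 z; have := sqr_ge0 (clamp z - 1/2); nra. Qed.

Lemma bump0l z : z <= 0 -> bump z = 0.
Proof.
by rewrite /bump; case: (clampP z) => [[? ->]|[? ? ->]|[? ->]] H; try lra;
 (have -> : z = 0 by lra); lra.
Qed.

Lemma bump0r z : 1 <= z -> bump z = 0.
Proof.
by rewrite /bump; case: (clampP z) => [[? ->]|[? ? ->]|[? ->]] H; try lra;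
 (have -> : z = 1 by lra); lra.
Qed.

Lemma step01 z : 0 <= step z <= 1.
Proof.
rewrite /step; have := clamp01 z; set c := clamp z => /andP[c0 c1].
have h1 : 0 <= 1 + 2 * c by lra.
have h2 : 0 <= 3 - 2 * c by lra.
have h3 : (1 - c) ^+ 2 * (1 + 2 * c) = 1 - c ^+ 2 * (3 - 2 * c) by ring.
have := mulr_ge0 (sqr_ge0 (1 - c)) h1; rewrite h3.
by have := mulr_ge0 (sqr_ge0 c) h2; lra.
Qed.

Lemma step0 z : z <= 0 -> step z = 0.
Proof.
by rewrite /step; case: (clampP z) => [[? ->]|[? ? ->]|[? ->]] H; try lra;
 (have -> : z = 0 by lra); lra.
Qed.

Lemma step1 z : 1 <= z -> step z = 1.
Proof.
by rewrite /step; case: (clampP z) => [[? ->]|[? ? ->]|[? ->]] H; try lra;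
 (have -> : z = 1 by lra); lra.
Qed.

Lemma ramp_bounds z : Num.max 0 (z - 1) <= ramp z <= Num.max 0 z.
Proof.
have -> : Num.max 0 z = clamp z + Num.max 0 (z - 1).
  have [z1|z1] := lerP 0 (z - 1); have [z0|z0] := lerP 0 z;
  by case: (clampP z) => [[? ->]|[? ? ->]|[? ->]]; lra.
rewrite /ramp; have := clamp01 z; set c := clamp z => /andP[c0 c1].
apply/andP; split; first by rewrite lerDr; nra.
by rewrite lerD2r; nra.
Qed.

Lemma bump_lip x y : `|bump x - bump y| <= 12 * `|x - y|.
Proof.
have := clamp_lip x y; rewrite /bump.
have := clamp01 x; have := clamp01 y; set c := clamp x; set d := clamp y.
move=> /andP[d0 d1] /andP[c0 c1] cd.
have -> : 6 * c * (1 - c) - 6 * d * (1 - d) = (c - d) * (6 * (1 - c - d)) by ring.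
rewrite normrM mulrC; apply: ler_pM => //.
by rewrite ler_norml; lra.
Qed.

Lemma step_lip x y : `|step x - step y| <= 12 * `|x - y|.
Proof.
have := clamp_lip x y; rewrite /step.
have := clamp01 x; have := clamp01 y; set c := clamp x; set d := clamp y.
move=> /andP[d0 d1] /andP[c0 c1] cd.
have -> : c ^+ 2 * (3 - 2 * c) - d ^+ 2 * (3 - 2 * d) =
  (c - d) * (3 * (c + d) - 2 * (c ^+ 2 + c * d + d ^+ 2)) by ring.
rewrite normrM mulrC; apply: ler_pM => //.
by rewrite ler_norml; nra.
Qed.

Lemma step_le x y : x <= y -> step x <= step y.
Proof.
move=> xy; rewrite /step.
have : clamp x <= clamp y.
  by case: (clampP x) => [[? ->]|[? ? ->]|[? ->]];
     case: (clampP y) => [[? ->]|[? ? ->]|[? ->]]; lra.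
have := clamp01 x; have := clamp01 y; set c := clamp x; set d := clamp y.
move=> /andP[d0 d1] /andP[c0 c1] cd.
rewrite -subr_ge0.
have -> : d ^+ 2 * (3 - 2 * d) - c ^+ 2 * (3 - 2 * c) =
  (d - c) * (3 * (c + d) - 2 * (c ^+ 2 + c * d + d ^+ 2)) by ring.
by apply: mulr_ge0; nra.
Qed.

(** Differentiability with an explicit quadratic remainder. Unlike a bare derivative it can be
    integrated against a density, which is how moments are differentiated below. *)
Definition quad_on (S : R -> Prop) (p p' : R -> R) L :=
  forall x y, S x -> S y -> `|p y - p x - (y - x) * p' x| <= L * (y - x) ^+ 2.

(** Across the junction [b] the remainder is the sum of the two one-sided remainders and of
    [(y - b) * (p' b - p' x)]. With the same [L] for all three, the total is at most [L] times
    $(b-x)^2 + (y-b)^2 + (b-x)(y-b)$, and this is at most $(y-x)^2$ because the last product is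
    nonnegative. This is why the kernels share the generous constant 12. *)
Lemma quad_glue (S : R -> Prop) p p' b L : S b -> 
  (forall x y, `|p' x - p' y| <= L * `|x - y|) ->
  quad_on (fun x => S x /\ x <= b) p p' L ->
  quad_on (fun x => S x /\ b <= x) p p' L ->
  quad_on S p p' L.
Proof.
move=> Sb lip lo hi x y Sx Sy.
have L0 : 0 <= L by have := lip 0 1; rewrite sub0r normrN normr1 mulr1; apply: le_trans.
have cross : forall P Q : Prop, P -> Q ->
  `|p b - p x - (b - x) * p' x| <= L * (b - x) ^+ 2 ->
  `|p y - p b - (y - b) * p' b| <= L * (y - b) ^+ 2 -> 
  0 <= (b - x) * (y - b) ->
  `|p y - p x - (y - x) * p' x| <= L * (y - x) ^+ 2.
  move=> _ _ _ _ h1 h2 sg.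
  have -> : p y - p x - (y - x) * p' x = (p b - p x - (b - x) * p' x) +
    (p y - p b - (y - b) * p' b) + (y - b) * (p' b - p' x) by ring.
  apply: (le_trans (ler_normD _ _)).
  apply: (le_trans (lerD (ler_normD _ _) (lexx _))).
  have h3 : `|(y - b) * (p' b - p' x)| <= L * ((b - x) * (y - b)).
    rewrite normrM; apply: (le_trans (ler_wpM2l (normr_ge0 _) (lip _ _))).
    by rewrite mulrCA -normrM [_ * (b - x)]mulrC ger0_norm.
  apply: (le_trans (lerD (lerD h1 h2) h3)).
  rewrite -!mulrDr; apply: ler_wpM2l => //.
  rewrite -subr_ge0 (_ : _ - _ = (b - x) * (y - b)) //; ring.
have [xb|bx] := leP x b; have [yb|yb] := leP y b.
- exact: lo.
- by apply: (cross True True) => //; [apply: lo|apply: hi; split => //; exact: ltW|nra].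
- by apply: (cross True True) => //; [apply: hi|apply: lo|nra]; split => //; exact: ltW.
- by apply: hi; split => //; exact: ltW.
Qed.

Lemma step_quad x y :
  `|step y - step x - (y - x) * bump x| <= 12 * (y - x) ^+ 2.
Proof.
apply: (@quad_glue (fun=> True) _ _ 0) => //; first exact: bump_lip.
  move=> {}x {}y [_ x0] [_ y0]; rewrite !step0 // bump0l //.
  by rewrite !subr0 mulr0 subr0 normr0 mulr_ge0 ?sqr_ge0.
apply: (@quad_glue _ _ _ 1) => //; first exact: bump_lip.
  move=> {}x {}y [[_ x0] x1] [[_ y0] y1]; rewrite /step /bump.
  have -> : clamp x = x by rewrite /clamp min_l // max_r.
  have -> : clamp y = y by rewrite /clamp min_l // max_r.
  have -> : y ^+ 2 * (3 - 2 * y) - x ^+ 2 * (3 - 2 * x) - (y - x) * (6 * x * (1 - x))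
   = (3 - 2 * y - 4 * x) * (y - x) ^+ 2 by ring.
  rewrite normrM (ger0_norm (sqr_ge0 _)); apply: ler_wpM2r; first exact: sqr_ge0.
  by rewrite ler_norml; lra.
move=> {}x {}y [[_ _] x0] [_ y0]; rewrite !step1 // bump0r //.
by rewrite subrr mulr0 subr0 normr0 mulr_ge0 ?sqr_ge0.
Qed.

Lemma ramp_quad x y :
  `|ramp y - ramp x - (y - x) * step x| <= 12 * (y - x) ^+ 2.
Proof.
apply: (@quad_glue (fun=> True) _ _ 0) => //; first exact: step_lip.
  move=> {}x {}y [_ x0] [_ y0]; rewrite step0 //.
  have r0 z : z <= 0 -> ramp z = 0.
    by move=> z0; apply/le_anti; have := ramp_bounds z; rewrite !max_l //; lra.
  by rewrite !r0 // mulr0 !subr0 normr0 mulr_ge0 ?sqr_ge0.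
apply: (@quad_glue _ _ _ 1) => //; first exact: step_lip.
  move=> {}x {}y [[_ x0] x1] [[_ y0] y1]; rewrite /ramp /step.
  have -> : clamp x = x by rewrite /clamp min_l // max_r.
  have -> : clamp y = y by rewrite /clamp min_l // max_r.
  rewrite !max_l; try lra.
  have -> : y ^+ 3 - y ^+ 4 / 2 + 0 - (x ^+ 3 - x ^+ 4 / 2 + 0) -
    (y - x) * (x ^+ 2 * (3 - 2 * x)) =
   ((y + 2 * x) - (y ^+ 2 + 2 * x * y + 3 * x ^+ 2) / 2) * (y - x) ^+ 2 by field.
  rewrite normrM (ger0_norm (sqr_ge0 _)); apply: ler_wpM2r; first exact: sqr_ge0.
  by rewrite ler_norml; nra.
move=> {}x {}y [[_ _] x0] [_ y0]; rewrite step1 // /ramp.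
have cl z : 1 <= z -> clamp z = 1.
  by case: (clampP z) => [[? ->]|[? ? ->]|[? ->]]; lra.
rewrite !cl // !max_r; try lra.
have -> : 1 ^+ 3 - 1 ^+ 4 / 2 + (y - 1) - (1 ^+ 3 - 1 ^+ 4 / 2 + (x - 1)) -
     (y - x) * 1 = 0 by ring.
by rewrite normr0 mulr_ge0 ?sqr_ge0.
Qed.

Lemma quad_is_derive (p : R -> R) x d L :
  (forall y, `|p y - p x - (y - x) * d| <= L * (y - x) ^+ 2) ->
  is_derive x (1:R) p d.
Proof.
move=> H.
have L0 : 0 <= L.
  by have := H (x + 1); rewrite (addrC x) addrK expr1n mulr1; apply: le_trans.
have cv : h^-1 *: (p (h *: 1 + x) - p x) @[h --> 0^'] --> d.
  apply/cvgrPdist_le => e e0; near=> h.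
  have h0 : h != 0 by near: h; exact: nbhs_dnbhs_neq.
  have : `|h| <= e / (L + 1).
    by near: h; apply: dnbhs0_le; apply: divr_gt0 => //; lra.
  rewrite ler_pdivlMr; last by lra.
  move=> he.
  have hx : h *: (1 : R) + x = h + x by rewrite /GRing.scale /= mulr1.
  have := H (h + x); rewrite addrK hx => Hh.
  have -> : d - h^-1 *: (p (h + x) - p x) = - h^-1 * (p (h + x) - p x - h * d).
    by rewrite /GRing.scale /=; field.
  rewrite normrM normrN normfV mulrC ler_pdivrMr ?normr_gt0 //.
  apply: (le_trans Hh); rewrite -(real_normK (num_real h)) expr2 mulrA.
  by apply: ler_wpM2r => //; apply: le_trans he; rewrite mulrDr mulr1 mulrC lerDl.
split; first by apply/cvg_ex; exists d.
exact/cvg_lim.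
Unshelve. all: by end_near. Qed.

Lemma is_derive_ramp z : is_derive z (1:R) ramp (step z).
Proof. by apply: quad_is_derive => y; exact: ramp_quad. Qed.

Lemma lip_continuous (p : R -> R) L :
  (forall x y, `|p x - p y| <= L * `|x - y|) -> continuous p.
Proof.
move=> H x; apply/cvgrPdist_le => e e0.
have L0 : 0 <= L by have := H 0 1; rewrite sub0r normrN normr1 mulr1; apply: le_trans.
have e1 : 0 < e / (L + 1) by rewrite divr_gt0 // ltr_wpDl.
have /cvgrPdist_le/(_ _ e1) : y @[y --> x] --> x by exact: cvg_id.
apply: filterS => y; rewrite ler_pdivlMr; last by lra.
move=> he; apply: (le_trans (H _ _)); apply: le_trans he.
by rewrite mulrDr mulr1 [L * _]mulrC lerDl.
Qed.

Lemma continuous_bump : continuous bump.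
Proof. exact: lip_continuous bump_lip. Qed.
Lemma continuous_step : continuous step.
Proof. exact: lip_continuous step_lip. Qed.
Lemma continuous_ramp : continuous ramp.
Proof.
by move=> z; apply: differentiable_continuous; apply/derivable1_diffP; case: (is_derive_ramp z).
Qed.

End Kernels.

(** * Moments of integrable densities *)

Section Moments.
Variable R : realType.
Notation mu := (@lebesgue_measure R).
Notation HL := (@halfline R).
Implicit Types (phi g : R -> R) (x y h C : R).

Definition mom phi g : R := Rintegral mu HL (fun x => g x * phi x).

Definition dens phi := [/\ mu.-integrable HL (EFin \o phi),
  mu.-integrable HL (fun x => (x * phi x)%:E) &
  {ae mu, forall x, x \in HL -> 0 <= phi x}].

(** Linear growth matches the finite mass and mean required by [dens]: every admissible weight has a
    finite moment against every density. The rates [a] and [b], the identity and all kernels fit. *)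
Definition adm g := measurable_fun HL g /\
  exists C, forall x, 0 < x -> `|g x| <= C * (1 + x).

Lemma measurable_HL : measurable HL.
Proof. exact: measurable_itv. Qed.
Hint Resolve measurable_HL : core.

Lemma HLE x : HL x = (0 < x).
Proof. by rewrite /halfline /= in_itv /= andbT. Qed.

Lemma adm_integrable phi g : dens phi -> adm g ->
  mu.-integrable HL (EFin \o (fun x => g x * phi x)).
Proof.
move=> [i0 i1 _] [mg [C gC]].
have m0 : measurable_fun HL phi by apply/measurable_EFinP; exact: measurable_int i0.
have iG : mu.-integrable HL
    (fun x => (`|C|%:E * (`|(phi x)%:E| + `|(x * phi x)%:E|))%E).
  by apply: integrableZl => //; apply: integrableD => //; exact: integrable_abse.
apply: le_integrable iG => //.
- by apply/measurable_EFinP; exact: measurable_funM.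
- move=> x; rewrite HLE => x0 /=.
  rewrite lee_fin normrM.
  rewrite [leRHS]ger0_norm; last by rewrite mulr_ge0 // addr_ge0.
  rewrite normrM (gtr0_norm x0) -{2}(mul1r `|phi x|) -mulrDl mulrA.
  apply: ler_wpM2r => //; apply: (le_trans (gC _ x0)).
  by apply: ler_wpM2r; [lra|exact: ler_norm].
Qed.

Lemma adm_cst (c : R) : adm (cst c).
Proof.
split; first exact: measurable_cst.
by exists `|c| => x x0; rewrite ler_peMr //; lra.
Qed.

Lemma adm_id : adm id.
Proof.
by split => //; exists 1 => x x0; rewrite mul1r gtr0_norm // lerDr.
Qed.

Lemma admD g g' : adm g -> adm g' -> adm (fun x => g x + g' x).
Proof.
move=> [m1 [C1 h1]] [m2 [C2 h2]]; split; first exact: measurable_funD.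
exists (C1 + C2) => x x0; apply: (le_trans (ler_normD _ _)); rewrite mulrDl.
by apply: lerD; [exact: h1|exact: h2].
Qed.

Lemma admM C g g' : measurable_fun HL g -> (forall x, 0 < x -> `|g x| <= C) ->
  adm g' -> adm (fun x => g x * g' x).
Proof.
move=> m1 h1 [m2 [C2 h2]]; split; first exact: measurable_funM.
exists (`|C| * C2) => x x0; rewrite normrM -mulrA; apply: ler_pM => //.
  exact: (le_trans (h1 _ x0) (ler_norm _)).
exact: h2.
Qed.

Lemma admZ (c : R) g : adm g -> adm (fun x => c * g x).
Proof. by apply: (@admM `|c|) => //; exact: measurable_cst. Qed.

Lemma admB g g' : adm g -> adm g' -> adm (fun x => g x - g' x).
Proof.
move=> a1 a2; have := admD a1 (admZ (-1) a2).
by under eq_fun do rewrite mulN1r.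
Qed.

Lemma adm_norm g : adm g -> adm (fun x => `|g x|).
Proof.
move=> [m1 [C1 h1]]; split; first exact: measurableT_comp.
by exists C1 => x x0; rewrite normr_id; exact: h1.
Qed.

Lemma continuous_measurable_HL g : continuous g -> measurable_fun HL g.
Proof. by move=> cg; apply: measurable_funS (continuous_measurable_fun cg). Qed.

Lemma momD phi g g' : dens phi -> adm g -> adm g' ->
  mom phi (fun x => g x + g' x) = mom phi g + mom phi g'.
Proof.
move=> d a1 a2; rewrite /mom -RintegralD //; [|exact: adm_integrable..].
by apply: eq_Rintegral => x _; rewrite mulrDl.
Qed.

Lemma momB phi g g' : dens phi -> adm g -> adm g' ->
  mom phi (fun x => g x - g' x) = mom phi g - mom phi g'.
Proof.
move=> d a1 a2; rewrite /mom -RintegralB //; [|exact: adm_integrable..].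
by apply: eq_Rintegral => x _; rewrite mulrBl.
Qed.

Lemma momZ phi (c : R) g : dens phi -> adm g ->
  mom phi (fun x => c * g x) = c * mom phi g.
Proof.
move=> d a1; rewrite /mom -RintegralZl //; last exact: adm_integrable.
by apply: eq_Rintegral => x _; rewrite mulrA.
Qed.

Lemma eq_mom phi g g' : (forall x, 0 < x -> g x = g' x) -> mom phi g = mom phi g'.
Proof.
by move=> gg; apply: eq_Rintegral => x; rewrite inE HLE => x0; rewrite gg.
Qed.

Lemma mom_ge0 phi g : dens phi -> adm g -> (forall x, 0 < x -> 0 <= g x) ->
  0 <= mom phi g.
Proof.
move=> d ag g0; rewrite /mom /Rintegral; apply: fine_ge0.
have ig := adm_integrable d ag.
(* A density is nonnegative only almost everywhere; the absolute value is so everywhere and has the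
   same integral. *)
rewrite (@ae_eq_integral _ _ _ mu HL (fun x => `|g x * phi x|%:E)) //.
- by apply: integral_ge0 => x _; rewrite lee_fin.
- exact: measurable_int ig.
- apply/measurable_EFinP; apply: measurableT_comp => //.
  by apply/measurable_EFinP; exact: measurable_int ig.
- case: d => _ _; apply: filterS; first exact: (ae_filter_ringOfSetsType mu).
  move=> x xp; rewrite HLE => x0.
  rewrite ger0_norm // mulr_ge0 //; first exact: g0.
  by apply: xp; rewrite inE HLE.
Qed.

Lemma mom_le phi g g' : dens phi -> adm g -> adm g' ->
  (forall x, 0 < x -> g x <= g' x) -> mom phi g <= mom phi g'.
Proof.
move=> d a1 a2 gg; rewrite -subr_ge0 -momB //.
by apply: mom_ge0 => //; [exact: admB|move=> x x0; rewrite subr_ge0; exact: gg].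
Qed.

Lemma mom_norm_le phi g g' : dens phi -> adm g -> adm g' ->
  (forall x, 0 < x -> `|g x| <= g' x) -> `|mom phi g| <= mom phi g'.
Proof.
move=> d a1 a2 gg; rewrite ler_norml; apply/andP; split.
- rewrite -mulN1r -momZ //; apply: mom_le => //; first exact: admZ.
  by move=> x x0; rewrite mulN1r; have := gg _ x0; rewrite ler_norml => /andP[].
- by apply: mom_le => // x x0; apply: le_trans (gg _ x0); exact: ler_norm.
Qed.

Lemma mom_cvg phi (gn : nat -> R -> R) g C : dens phi ->
  (forall n, measurable_fun HL (gn n)) ->
  (forall n x, 0 < x -> `|gn n x| <= C * (1 + x)) ->
  (forall x, 0 < x -> gn n x @[n --> \oo] --> g x) ->
  mom phi (gn n) @[n --> \oo] --> mom phi g.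
Proof.
move=> d mg gC cg; have [i0 i1 _] := d.
have m0 : measurable_fun HL phi by apply/measurable_EFinP; exact: measurable_int i0.
have m1 n : measurable_fun HL (EFin \o (fun x => gn n x * phi x)).
  by apply/measurable_EFinP; exact: measurable_funM.
have cv x : HL x -> (EFin \o (fun x => gn n x * phi x)) x @[n --> \oo] --> (g x * phi x)%:E.
  rewrite HLE => x0; apply/fine_cvgP; split; first exact: nearW.
  by apply: cvgM; [exact: cg|exact: cvg_cst].
have ml : measurable_fun HL (EFin \o (fun x => g x * phi x)).
  exact: emeasurable_fun_cvg m1 cv.
have ad : adm (fun x => C * (1 + x)).
  by apply: admZ; apply: admD; [exact: adm_cst|exact: adm_id].
have iG := integrable_abse (adm_integrable d ad).
have [||il _ cl] := @dominated_convergence _ _ _ mu _ measurable_HL _ _ _ m1 ml _ iG.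
- by apply: aeW => x; exact: cv.
- apply: aeW => x n; rewrite HLE => x0 /=; rewrite lee_fin !normrM; apply: ler_wpM2r => //.
  rewrite -normrM; apply: le_trans (gC n x x0) _; exact: ler_norm.
rewrite /mom /Rintegral; apply: fine_cvg.
by rewrite fineK //; exact: integrable_fin_num.
Qed.

(* In the variable [x], [- sbump h x] is the derivative of [sstep h x], and
   [- sstep h x] that of [sramp h x]; in [y] the signs are opposite. *)
Definition sbump h x y := bump ((y - x) / h) / h.
Definition sstep h x y := step ((y - x) / h).
Definition sramp h x y := h * ramp ((y - x) / h).

Lemma sbump_ge0 h x y : 0 < h -> 0 <= sbump h x y.
Proof. by move=> h0; rewrite /sbump divr_ge0 ?bump_ge0 // ltW. Qed.

Lemma sbump_le h x y : 0 < h -> sbump h x y <= 2 / h.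
Proof. by move=> h0; rewrite /sbump ler_pM2r ?invr_gt0 // bump_le. Qed.

Lemma sbump_supp h x y : 0 < h -> ~ (x < y < x + h) -> sbump h x y = 0.
Proof.
move=> h0 /negP; rewrite negb_and -!leNgt => /orP[yx|yx]; rewrite /sbump.
  by rewrite bump0l ?mul0r // pmulr_lle0 ?invr_gt0 // subr_le0.
by rewrite bump0r ?mul0r // ler_pdivlMr // mul1r lerBrDl.
Qed.

Lemma sstep01 h x y : 0 <= sstep h x y <= 1.
Proof. exact: step01. Qed.

Lemma sstep_eq0 h x y : 0 < h -> y <= x -> sstep h x y = 0.
Proof. by move=> h0 yx; rewrite /sstep step0 // pmulr_lle0 ?invr_gt0 // subr_le0. Qed.

Lemma sstep_eq1 h x y : 0 < h -> x + h <= y -> sstep h x y = 1.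
Proof. by move=> h0 yx; rewrite /sstep step1 // ler_pdivlMr // mul1r lerBrDl. Qed.

Lemma sramp_bounds h x y : 0 < h ->
  Num.max 0 (y - x - h) <= sramp h x y <= Num.max 0 (y - x).
Proof.
move=> h0; rewrite /sramp; have /andP[l u] := ramp_bounds ((y - x) / h).
have hh : h * ((y - x) / h) = y - x by rewrite mulrC divfK // gt_eqF.
apply/andP; split.
  have := ler_wpM2l (ltW h0) l; apply: le_trans.
  by rewrite maxr_pMr ?(ltW h0) // mulr0 mulrBr hh mulr1.
have := ler_wpM2l (ltW h0) u => /le_trans; apply.
by rewrite maxr_pMr ?(ltW h0) // mulr0 hh.
Qed.

(** The kernels are differentiated in their position [x], not in [y]: rescaling gives the factor
    [- 1 / h] in the derivative and [1 / h ^+ 2] in the remainder. *)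
Lemma quad_scale (p p' : R -> R) h x x' y : 0 < h ->
  (forall u v, `|p v - p u - (v - u) * p' u| <= 12 * (v - u) ^+ 2) ->
  `|p ((y - x') / h) - p ((y - x) / h) - (x' - x) * (- (p' ((y - x) / h) / h))|
   <= 12 / h ^+ 2 * (x' - x) ^+ 2.
Proof.
move=> h0 H; have h1 : h != 0 by rewrite gt_eqF.
have := H ((y - x) / h) ((y - x') / h).
have -> : (y - x') / h - (y - x) / h = - (x' - x) / h by field.
have -> : - (x' - x) / h * p' ((y - x) / h) = (x' - x) * (- (p' ((y - x) / h) / h)) by field.
by have -> : 12 * (- (x' - x) / h) ^+ 2 = 12 / h ^+ 2 * (x' - x) ^+ 2 by field.
Qed.

Lemma affine_continuous h x : continuous (fun y : R => (y - x) / h).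
Proof. by move=> y; apply: cvgM; [apply: cvgB; [exact: cvg_id|exact: cvg_cst]|exact: cvg_cst]. Qed.

Lemma scale_continuous (p : R -> R) h x : continuous p ->
  continuous (fun y : R => p ((y - x) / h)).
Proof. by move=> cp y; apply: continuous_comp; [exact: affine_continuous|exact: cp]. Qed.

Lemma sbump_continuous h x : continuous (sbump h x).
Proof.
move=> y; apply: cvgM; last exact: cvg_cst.
by apply: scale_continuous; exact: continuous_bump.
Qed.
Lemma sstep_continuous h x : continuous (sstep h x).
Proof. by apply: scale_continuous; exact: continuous_step. Qed.
Lemma sramp_continuous h x : continuous (sramp h x).
Proof.
move=> y; apply: cvgM; first exact: cvg_cst.
by apply: scale_continuous; exact: continuous_ramp.
Qed.

Lemma adm_sbump h x g : 0 < h -> adm g -> adm (fun y => sbump h x y * g y).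
Proof.
move=> h0; apply: (@admM (2 / h)).
  by apply: continuous_measurable_HL; exact: sbump_continuous.
by move=> y _; rewrite ger0_norm ?sbump_ge0 ?sbump_le.
Qed.

Lemma adm_sstep h x g : adm g -> adm (fun y => sstep h x y * g y).
Proof.
apply: (@admM 1).
  by apply: continuous_measurable_HL; exact: sstep_continuous.
by move=> y _; have /andP[a b] := sstep01 h x y; rewrite ger0_norm.
Qed.

Lemma adm_sstep1 h x : adm (sstep h x).
Proof.
have := @adm_sstep h x _ (adm_cst 1).
by under eq_fun do rewrite mulr1.
Qed.

Lemma adm_sramp h x : 0 < h -> adm (sramp h x).
Proof.
move=> h0; split; first by apply: continuous_measurable_HL; exact: sramp_continuous.
exists (1 + `|x|) => y y0; have /andP[l u] := @sramp_bounds h x y h0.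
have r0 : 0 <= sramp h x y by apply: le_trans l; rewrite le_max lexx.
rewrite ger0_norm //; apply: (le_trans u).
have := normr_ge0 x; have := ler_norm (- x); rewrite normrN.
by rewrite ge_max => *; apply/andP; split; nra.
Qed.

(** The quadratic remainder has the admissible profile [g] in [y], so it integrates to a quadratic
    remainder for the moment; no domination argument for difference quotients is required. *)
Lemma mom_quad_is_derive phi (G : R -> R -> R) (G' : R -> R) g (c : R) x :
  dens phi -> (forall x, adm (G x)) -> adm G' -> adm g ->
  (forall x' y, 0 < y -> `|G x' y - G x y - (x' - x) * G' y| <= c * (x' - x) ^+ 2 * g y) ->
  is_derive x (1:R) (fun x => mom phi (G x)) (mom phi G').
Proof.
move=> d aG aG' ag H; apply: (@quad_is_derive _ _ _ _ (c * mom phi g)) => x'.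
rewrite -momZ // -momB // -momB //; [|exact: admB|exact: admZ].
rewrite mulrAC -momZ //; apply: mom_norm_le => //.
- by apply: admB; [exact: admB|exact: admZ].
- exact: admZ.
- exact: H.
Qed.

Lemma mom_sstep_is_derive phi g h x : dens phi -> adm g -> 0 < h ->
  is_derive x (1:R) (fun x => mom phi (fun y => sstep h x y * g y))
    (- mom phi (fun y => sbump h x y * g y)).
Proof.
move=> d ag h0.
have := @mom_quad_is_derive phi (fun x y => sstep h x y * g y)
  (fun y => -1 * (sbump h x y * g y)) (fun y => `|g y|) (12 / h ^+ 2) x d.
rewrite momZ //; last exact: adm_sbump.
rewrite mulN1r; apply.
- by move=> z; exact: adm_sstep.
- by apply: admZ; exact: adm_sbump.
- exact: adm_norm.
- move=> x' y _.
  have -> : sstep h x' y * g y - sstep h x y * g y - (x' - x) * (-1 * (sbump h x y * g y))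
    = (sstep h x' y - sstep h x y - (x' - x) * (- sbump h x y)) * g y by ring.
  rewrite normrM; apply: ler_wpM2r => //.
  by apply: quad_scale => //; exact: step_quad.
Qed.

Lemma mom_sramp_is_derive phi h x : dens phi -> 0 < h ->
  is_derive x (1:R) (fun x => mom phi (sramp h x)) (- mom phi (sstep h x)).
Proof.
move=> d h0.
have := @mom_quad_is_derive phi (sramp h)
  (fun y => -1 * (sstep h x y)) (cst 1) (12 / h) x d.
rewrite momZ //; last exact: adm_sstep1.
rewrite mulN1r; apply.
- by move=> z; exact: adm_sramp.
- by apply: admZ; exact: adm_sstep1.
- exact: adm_cst.
- move=> x' y _; rewrite mulr1.
  have hn : h != 0 by rewrite gt_eqF.
  have -> : sramp h x' y - sramp h x y - (x' - x) * (-1 * sstep h x y) =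
   h * (ramp ((y - x') / h) - ramp ((y - x) / h) - (x' - x) * (- (sstep h x y / h))).
    by rewrite /sramp; field.
  have -> : 12 / h * (x' - x) ^+ 2 = h * (12 / h ^+ 2 * (x' - x) ^+ 2) by field.
  rewrite normrM (gtr0_norm h0) ler_pM2l //.
  by apply: quad_scale => //; exact: ramp_quad.
Qed.

Lemma mom_sstep_is_derive1 phi h x : dens phi -> 0 < h ->
  is_derive x (1:R) (fun x => mom phi (sstep h x)) (- mom phi (sbump h x)).
Proof.
move=> d h0; have := @mom_sstep_is_derive phi (cst 1) h x d (adm_cst 1) h0.
by under eq_fun do under eq_fun do rewrite mulr1; under [X in - mom phi X]eq_fun do rewrite mulr1.
Qed.

Lemma mom_sbump_continuous phi g h : dens phi -> adm g -> 0 < h ->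
  continuous (fun x => mom phi (fun y => sbump h x y * g y)).
Proof.
move=> d ag h0.
apply: (@lip_continuous _ _ (12 / h ^+ 2 * mom phi (fun y => `|g y|))) => x x'.
have h1 : h != 0 by rewrite gt_eqF.
rewrite -momB //; [|exact: adm_sbump..].
rewrite mulrAC -momZ //; last exact: adm_norm.
apply: mom_norm_le => //; first by apply: admB; exact: adm_sbump.
  by apply: admZ; exact: adm_norm.
move=> y _; rewrite -mulrBl normrM; apply: ler_wpM2r => //.
rewrite /sbump -mulrBl normrM normfV (gtr0_norm h0).
have := bump_lip ((y - x) / h) ((y - x') / h).
have -> : (y - x) / h - (y - x') / h = (x' - x) / h by field.
rewrite normrM normfV (gtr0_norm h0) distrC => H.
rewrite [leRHS](_ : _ = 12 * (`|x - x'| / h) / h); last by rewrite distrC; field.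
by rewrite ler_pM2r ?invr_gt0 // [`|x - x'|]distrC.
Qed.

Lemma sstep_is_derive h x y : 0 < h -> is_derive y (1:R) (sstep h x) (sbump h x y).
Proof.
move=> h0; apply: (@quad_is_derive _ _ _ _ (12 / h ^+ 2)) => z.
have h1 : h != 0 by rewrite gt_eqF.
have := step_quad ((y - x) / h) ((z - x) / h).
have -> : (z - x) / h - (y - x) / h = (z - y) / h by field.
rewrite /sstep /sbump.
have -> : (z - y) / h * bump ((y - x) / h) = (z - y) * (bump ((y - x) / h) / h) by field.
by have -> : 12 * ((z - y) / h) ^+ 2 = 12 / h ^+ 2 * (z - y) ^+ 2 by field.
Qed.

End Moments.

(** * Calculus on compact intervals *)

Section WithinContinuous.
Variable R : realType.
Implicit Types (A : set R) (f g : R -> R).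

Lemma within_continuousD A f g : {within A, continuous f} -> {within A, continuous g} ->
  {within A, continuous (fun x => f x + g x)}.
Proof. by move=> cf cg x; apply: cvgD; [exact: cf|exact: cg]. Qed.

Lemma within_continuousB A f g : {within A, continuous f} -> {within A, continuous g} ->
  {within A, continuous (fun x => f x - g x)}.
Proof. by move=> cf cg x; apply: cvgB; [exact: cf|exact: cg]. Qed.

Lemma within_continuousM A f g : {within A, continuous f} -> {within A, continuous g} ->
  {within A, continuous (fun x => f x * g x)}.
Proof. by move=> cf cg x; apply: cvgM; [exact: cf|exact: cg]. Qed.

Lemma within_continuous_comp A f (p : R -> R) : continuous p -> {within A, continuous f} ->
  {within A, continuous (fun x => p (f x))}.
Proof. by move=> cp cf x; apply: continuous_comp; [exact: cf|exact: cp]. Qed.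

Lemma within_continuousW A f : continuous f -> {within A, continuous f}.
Proof. exact: continuous_subspaceT. Qed.

Lemma within_cst A (c : R) : {within A, continuous (fun=> c)}.
Proof. by apply: within_continuousW; exact: cst_continuous. Qed.

Lemma eq_within A f g : (forall x, A x -> f x = g x) -> {within A, continuous f} ->
  {within A, continuous g}.
Proof.
move=> fg; apply: subspace_eq_continuous => x; rewrite inE; exact: fg.
Qed.

Lemma within_is_derive (a b : R) f f' : (forall x, a <= x <= b -> is_derive x (1:R) f (f' x)) ->
  {within `[a, b], continuous f}.
Proof.
move=> H; apply: derivable_within_continuous => x; rewrite in_itv /= => xab.
by case: (H _ xab).
Qed.

Lemma within_continuous_bounded (a b : R) f : {within `[a, b], continuous f} ->
  exists M, 0 <= M /\ forall x, a <= x <= b -> `|f x| <= M.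
Proof.
have [ab|ba] := leP a b; last first.
  by exists 0; split => // x xab; lra.
move=> cf; have cn : {within `[a, b], continuous (fun x => `|f x|)}.
  by apply: within_continuous_comp cf; exact: norm_continuous.
have [c cab H] := EVT_max ab cn.
by exists `|f c|; split => // x xab; apply: H; rewrite in_itv.
Qed.

End WithinContinuous.

Section Calculus.
Variable R : realType.

Lemma is_derive_sum (f g : R -> R) (x df dg : R) : is_derive x (1:R) f df ->
  is_derive x (1:R) g dg -> is_derive x (1:R) (fun x => f x + g x) (df + dg).
Proof. by move=> d1 d2; have := is_deriveD d1 d2. Qed.

Lemma is_derive_diff (f g : R -> R) (x df dg : R) : is_derive x (1:R) f df ->
  is_derive x (1:R) g dg -> is_derive x (1:R) (fun x => f x - g x) (df - dg).
Proof. by move=> d1 d2; have := is_deriveB d1 d2. Qed.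

Lemma is_derive_prod (f g : R -> R) (x df dg : R) : is_derive x (1:R) f df ->
  is_derive x (1:R) g dg ->
  is_derive x (1:R) (fun x => f x * g x) (df * g x + f x * dg).
Proof.
move=> d1 d2; have H := is_deriveM d1 d2.
by apply: (is_derive_eq H); rewrite /GRing.scale /= addrC [g x * _]mulrC.
Qed.

Lemma is_derive_scale (f : R -> R) (x c df : R) : is_derive x (1:R) f df ->
  is_derive x (1:R) (fun x => c * f x) (c * df).
Proof.
move=> d1; have H := is_derive_prod (is_derive_cst c x 1) d1.
by apply: (is_derive_eq H); rewrite mul0r add0r.
Qed.

Lemma is_derive_compose (f g : R -> R) (x df dg : R) : is_derive (g x) (1:R) f df ->
  is_derive x (1:R) g dg -> is_derive x (1:R) (fun x => f (g x)) (df * dg).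
Proof. by move=> d1 d2; have := is_derive1_comp d1 d2; rewrite mulrC. Qed.
Notation mu := (@lebesgue_measure R).
Implicit Types (f g F : R -> R) (a b x t : R).

Lemma within_integrable a b f : {within `[a, b], continuous f} ->
  mu.-integrable `[a, b] (EFin \o f).
Proof. by move=> cf; apply: continuous_compact_integrable => //; exact: segment_compact. Qed.

Lemma Rintegral_FTC F f a b : a < b -> {within `[a, b], continuous F} ->
  (forall x, a < x < b -> is_derive x (1:R) F (f x)) ->
  {within `[a, b], continuous f} ->
  Rintegral mu `[a, b] f = F b - F a.
Proof.
move=> ab cF dF cf; rewrite /Rintegral (@continuous_FTC2 _ f F) //.
- have [_ r l] := (continuous_within_itvP F ab).1 cF.
  split => // x; rewrite in_itv /= => xab; by case: (dF _ xab).
- move=> x; rewrite in_itv /= => xab; rewrite derive1E.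
  by case: (dF _ xab).
Qed.

Lemma Rintegral_le a b f g : {within `[a, b], continuous f} -> {within `[a, b], continuous g} ->
  (forall x, a <= x <= b -> f x <= g x) ->
  Rintegral mu `[a, b] f <= Rintegral mu `[a, b] g.
Proof.
move=> cf cg fg; apply: le_Rintegral.
- exact: measurable_itv.
- exact: (within_integrable cf).
- exact: (within_integrable cg).
by move=> x /=; rewrite in_itv /=; exact: fg.
Qed.

Lemma primitive_derive a b f : {within `[a, b], continuous f} ->
  let F t := Rintegral mu `[a, t] f in
  {within `[a, b], continuous F} /\
  forall t, a < t < b -> is_derive t (1:R) F (f t).
Proof.
move=> cf F; have [ab|ba] := leP a b; last first.
  split; last by move=> t tab; lra.
  have -> : `[a, b]%classic = set0 :> set R by apply: set_itv_ge; rewrite bnd_simp -ltNge.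
  exact: continuous_subspace0.
have fi := within_integrable cf.
split; first exact: parameterized_integral_continuous.
move=> t /andP[a1 b1].
have cft : {for t, continuous f}.
  have [H _ _] := (continuous_within_itvP f (lt_trans a1 b1)).1 cf.
  by apply: H; rewrite in_itv /= a1.
have [d e] := @continuous_FTC1_closed _ f a t b b1 fi a1 cft.
apply: DeriveDef; first exact: d.
by rewrite -derive1E; exact: e.
Qed.

Lemma is_derive_nonincreasing f f' a b : {within `[a, b], continuous f} ->
  (forall x, a < x < b -> is_derive x (1:R) f (f' x)) ->
  (forall x, a < x < b -> f' x <= 0) ->
  forall x y, a <= x -> x <= y -> y <= b -> f y <= f x.
Proof.
move=> cf df f0 x y ax xy yb.
apply: (@ler0_derive1_le_cc _ f a b _ _ cf) => //.
- by move=> z; rewrite in_itv /= => zab; case: (df _ zab).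
- move=> z; rewrite in_itv /= => zab; rewrite derive1E.
  by case: (df _ zab) => _ ->; exact: f0.
- by rewrite in_itv /= yb (le_trans ax).
- by rewrite in_itv /= ax (le_trans xy).
Qed.

Lemma is_derive_nondecreasing f f' a b : {within `[a, b], continuous f} ->
  (forall x, a < x < b -> is_derive x (1:R) f (f' x)) ->
  (forall x, a < x < b -> 0 <= f' x) ->
  forall x y, a <= x -> x <= y -> y <= b -> f x <= f y.
Proof.
move=> cf df f0 x y ax xy yb.
rewrite -lerN2; apply: (@is_derive_nonincreasing (fun x => - f x) (fun x => - f' x) a b) => //.
- by move=> z; apply: cvgN; exact: cf.
- by move=> z zab; have := df _ zab; exact: is_deriveN.
- by move=> z zab; rewrite oppr_le0; exact: f0.
Qed.

Lemma gronwall (Y Y' : R -> R) (T C e : R) : 0 <= e -> 0 <= C ->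
  {within `[0, T], continuous Y} ->
  (forall t, 0 < t < T -> is_derive t (1:R) Y (Y' t)) ->
  (forall t, 0 < t < T -> Y' t <= C * Y t + e) ->
  forall t, 0 <= t <= T -> Y t <= (Y 0 + e * t) * expR (C * t).
Proof.
move=> e0 C0 cY dY YC t /andP[t0 tT].
(* [Z] is nonincreasing: the exponential absorbs the term [C * Y], and [e * t] the constant, because
   the exponential is at most 1. *)
pose Z t := Y t * expR (- (C * t)) - e * t.
pose Z' t := Y' t * expR (- (C * t)) + Y t * (- C * expR (- (C * t))) - e.
have lin k : continuous (fun s : R => k * s).
  by move=> s; apply: cvgM; [exact: cvg_cst|exact: cvg_id].
have ce : continuous (fun s : R => expR (- (C * s))).
  move=> s; have := @continuous_comp _ _ _ (fun s : R => - (C * s)) (@expR R) s; apply.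
    by apply: cvgN; exact: lin.
  exact: continuous_expR.
have : Z t <= Z 0.
  apply: (@is_derive_nonincreasing Z Z' 0 T) => //.
  - apply: within_continuousB; last by apply: within_continuousW; exact: lin.
    by apply: within_continuousM => //; exact: within_continuousW.
  - move=> s sT.
    have d1 : is_derive s (1:R) (fun s : R => expR (- (C * s))) (- C * expR (- (C * s))).
      have dl : is_derive s (1:R) (fun s : R => - (C * s)) (- C).
        have -> : (fun s : R => - (C * s)) = (fun s => (- C) *: s).
          by apply/funext => r; rewrite /GRing.scale /= mulNr.
        have := @is_deriveZ _ _ _ id (- C) s 1 1 (is_derive_id _ _).
        by rewrite /GRing.scale /= mulr1.
      have := @is_derive1_comp _ (@expR R) (fun s => - (C * s)) s _ _ (is_derive_expR _) dl.
      by rewrite mulrC.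
    have d2 := is_deriveM (dY _ sT) d1.
    have d3 : is_derive s (1:R) (fun s : R => e * s) e.
      have := @is_deriveZ _ _ _ id e s 1 1 (is_derive_id _ _).
      by rewrite /GRing.scale /= mulr1.
    have H := is_deriveB d2 d3.
    apply: (is_derive_eq H); rewrite /Z' /GRing.scale /=; ring.
  - move=> s sT; rewrite /Z'.
    have := YC _ sT; have : 0 < expR (- (C * s)) by exact: expR_gt0.
    have : expR (- (C * s)) <= 1.
      by rewrite -expR0 ler_expR oppr_le0 mulr_ge0 //; case/andP: sT => /ltW.
    set E := expR _; nra.
rewrite /Z !mulr0 oppr0 expR0 mulr1 addr0 lerBlDr => H.
have : Y t * expR (- (C * t)) * expR (C * t) <= (Y 0 + e * t) * expR (C * t).
  by apply: ler_wpM2r => //; exact: expR_ge0.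
by rewrite -mulrA -expRD addNr expR0 mulr1.
Qed.

(** At each time one index works; by continuity it works nearby, and by monotonicity so do all later
    ones. Compactness of the interval then yields a common index. This makes the smallness of the
    mass near 0 and of the mean at infinity uniform in time. *)
Lemma dini (r : nat -> R -> R) T : 
  (forall k, {within `[0, T], continuous (r k)}) ->
  (forall k l t, 0 <= t <= T -> (k <= l)%N -> r l t <= r k t) ->
  (forall t, 0 <= t <= T -> r k t @[k --> \oo] --> 0) ->
  forall e, 0 < e -> exists k, forall t, 0 <= t <= T -> r k t < e.
Proof.
move=> cr nr r0 e e0.
have := @segment_compact R 0 T.
rewrite compact_near_coveringP -near_covering_withinP.
move=> /(_ nat \oo (fun k t => r k t < e) _) []; last first.
  move=> N _ /(_ N (leqnn N)) H; exists N => t tT; apply: H.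
  by rewrite /= in_itv.
move=> t /=; rewrite in_itv /= => tT.
have : \forall k \near \oo, r k t < e.
  exact: (cvgr_lt 0 (r0 _ tT)).
move=> [N _ /(_ N (leqnn N)) /= HN].
have /subspace_continuousP /(_ t) := cr N.
rewrite /= in_itv /= => /(_ tT) /cvgr_lt /(_ _ HN).
rewrite near_withinE => near_t.
exists ([set t' | t' \in `[0, T] -> r N t' < e], [set k | (N <= k)%N]).
  split => /=; first exact: near_t.
  by exists N.
move=> [t' k] /= [h1 h2]; rewrite in_itv /= => t'T.
apply: le_lt_trans (h1 _); last by rewrite in_itv.
exact: nr.
Qed.

End Calculus.

(** * Pointwise identities in time from bump averages *)

Section TimeAverages.
Variable R : realType.
Notation mu := (@lebesgue_measure R).
Implicit Types (f g P c G : R -> R) (a b s t d x e A B C M S T : R).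

Lemma sbump_mass d s : 0 < d -> Rintegral mu `[s, s + d] (sbump d s) = 1.
Proof.
move=> d0; have sd : s < s + d by rewrite ltrDl.
have cs : {within `[s, s + d], continuous (sstep d s)}.
  by apply: within_continuousW; exact: sstep_continuous.
have cb : {within `[s, s + d], continuous (sbump d s)}.
  by apply: within_continuousW; exact: sbump_continuous.
rewrite (Rintegral_FTC sd cs (fun x _ => sstep_is_derive s x d0) cb).
by rewrite sstep_eq1 // sstep_eq0 // subr0.
Qed.

Lemma nondecreasing_integrable P S : 0 <= S ->
  (forall s t, 0 <= s -> s <= t -> t <= S -> P s <= P t) ->
  measurable_fun `[0, S] P /\ forall t, 0 <= t <= S -> `|P t| <= `|P 0| + `|P S|.
Proof.
move=> S0 nd; split.
(* Monotonicity is known on [[0, S]] only; projecting the time onto this interval gives a function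
   monotone on the whole line. *)
- pose Q t := P (Num.max 0 (Num.min t S)).
  apply: (eq_measurable_fun Q).
    move=> t; rewrite inE /= in_itv /= => /andP[t0 tS].
    by rewrite /Q min_l // max_r.
  apply: nondecreasing_measurable; first exact: measurable_itv.
  move=> s t st; apply: nd.
  - by rewrite le_max lexx.
  - by rewrite ge_max !le_max lexx /= le_min !ge_min lexx st !orbT.
  - by rewrite ge_max S0 ge_min lexx orbT.
- move=> t /andP[t0 tS].
  have := nd _ _ (lexx 0) t0 tS; have := nd _ _ t0 tS (lexx S).
  have := ler_norm (P S); have := ler_norm (- P 0); rewrite normrN.
  have := normr_ge0 (P 0); have := normr_ge0 (P S).
  by rewrite ler_norml; lra.
Qed.

Lemma bounded_itv_integrable f (A B M : R) : measurable_fun `[A, B] f ->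
  (forall t, A <= t <= B -> `|f t| <= M) -> mu.-integrable `[A, B] (EFin \o f).
Proof.
move=> mf fM; apply: measurable_bounded_integrable => //.
- by rewrite /= lebesgue_measure_itv /=; case: ifP => // _; rewrite -EFinB ltry.
- exists M; split; first exact: num_real.
  move=> N MN t /=; rewrite in_itv /= => tAB; apply: le_trans (fM _ tAB) _; exact: ltW.
Qed.

Lemma monotone_plus_continuous_integrable P c S : 0 <= S ->
  (forall s t, 0 <= s -> s <= t -> t <= S -> P s <= P t) ->
  {within `[0, S], continuous c} ->
  measurable_fun `[0, S] (fun t => P t + c t) /\
  exists M : R, forall t, 0 <= t <= S -> `|P t + c t| <= M.
Proof.
move=> S0 nd cc; have [mP bP] := nondecreasing_integrable S0 nd.
have [M [_ cM]] := within_continuous_bounded cc.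
split.
  by apply: measurable_funD => //; apply: subspace_continuous_measurable_fun.
exists (`|P 0| + `|P S| + M) => t tS; apply: le_trans (ler_normD _ _) _.
by apply: lerD; [exact: bP|exact: cM].
Qed.

Lemma within_near_right f S t e : {within `[0, S], continuous f} -> 0 <= t < S -> 0 < e ->
  exists d, [/\ 0 < d, t + d <= S & forall r, t <= r <= t + d -> `|f r - f t| <= e].
Proof.
move=> cf /andP[t0 tS] e0.
have tI : `[0, S]%classic t by rewrite /= in_itv /= t0 ltW.
have /subspace_continuousP /(_ t tI) /cvgrPdist_le /(_ _ e0) := cf.
rewrite near_withinE => -[d /= d0 H].
exists (Num.min (d / 2) (S - t)); split.
- by rewrite lt_min divr_gt0 //= subr_gt0.
- by rewrite -lerBrDl ge_min lexx orbT.
- move=> r /andP[tr rd]; rewrite distrC; apply: H.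
  + rewrite /ball_ /= distrC ger0_norm ?subr_ge0 //.
    have : r - t <= d / 2 by rewrite lerBlDl (le_trans rd) // lerD2l ge_min lexx.
    by lra.
  + rewrite /= in_itv /= (le_trans t0) //= (le_trans rd) //.
    by rewrite -lerBrDl ge_min lexx orbT.
Qed.

Lemma within_near_left f S t e : {within `[0, S], continuous f} -> 0 < t <= S -> 0 < e ->
  exists d, [/\ 0 < d, 0 <= t - d & forall r, t - d <= r <= t -> `|f r - f t| <= e].
Proof.
move=> cf /andP[t0 tS] e0.
have tI : `[0, S]%classic t by rewrite /= in_itv /= tS ltW.
have /subspace_continuousP /(_ t tI) /cvgrPdist_le /(_ _ e0) := cf.
rewrite near_withinE => -[d /= d0 H].
exists (Num.min (d / 2) t); split.
- by rewrite lt_min divr_gt0 //= t0.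
- by rewrite subr_ge0 ge_min lexx orbT.
- move=> r /andP[tr rd]; rewrite distrC.
  have m2 : Num.min (d / 2) t <= d / 2 by rewrite ge_min lexx.
  have m3 : Num.min (d / 2) t <= t by rewrite ge_min lexx orbT.
  apply: H.
  + rewrite /ball_ /= ger0_norm ?subr_ge0 //.
    by lra.
  + by rewrite /= in_itv /= (le_trans rd tS) andbT; lra.
Qed.

(** Monotonicity of [P] replaces continuity. If [P + c] is negative at [t], it stays below a
    negative constant just before [t], since [P] was not larger there; if positive, it stays above a
    positive constant just after [t]. Either way a bump placed in that window has a nonzero
    average. *)
Lemma bump_average_eq0 P c S :
  (forall s t, 0 <= s -> s <= t -> t <= S -> P s <= P t) ->
  {within `[0, S], continuous c} ->
  (forall s d, 0 <= s -> 0 < d -> s + d <= S ->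
    Rintegral mu `[s, s + d] (fun t => sbump d s t * (P t + c t)) = 0) ->
  forall t, 0 < t < S -> P t + c t = 0.
Proof.
move=> nd cc H t /andP[t0 tS].
have S0 : 0 <= S by lra.
have [mQ [M QM]] := monotone_plus_continuous_integrable S0 nd cc.
have mul s d : 0 <= s -> 0 < d -> s + d <= S ->
    mu.-integrable `[s, s + d] (EFin \o (fun t => sbump d s t * (P t + c t))).
  move=> s0 d0 sd.
  apply: (@bounded_itv_integrable _ _ _ (2 / d * M)).
    apply: measurable_funM.
      by apply: measurable_funS (continuous_measurable_fun (@sbump_continuous R d s)).
    apply: measurable_funS mQ; first exact: measurable_itv.
    by apply: subset_itv; rewrite bnd_simp.
  move=> r rsd; rewrite normrM; apply: ler_pM => //.
    by rewrite ger0_norm ?sbump_ge0 ?sbump_le.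
  by apply: QM; lra.
have cst s d (e : R) : 0 < d ->
    mu.-integrable `[s, s + d] (EFin \o (fun t => e * sbump d s t)) /\
    Rintegral mu `[s, s + d] (fun t => e * sbump d s t) = e.
  move=> d0.
  have i1 : mu.-integrable `[s, s + d] (EFin \o sbump d s).
    by apply: within_integrable; apply: within_continuousW; exact: sbump_continuous.
  split; last by rewrite RintegralZl // sbump_mass // mulr1.
  apply: within_integrable; apply: within_continuousM; first exact: within_cst.
  by apply: within_continuousW; exact: sbump_continuous.
apply/eqP; case: (ltgtP (P t + c t) 0) => // sg.
- pose e := - (P t + c t) / 2.
  have e0 : 0 < e by rewrite /e; lra.
  have [d [d0 td Hd]] := @within_near_left c S t e cc (introT andP (conj t0 (ltW tS))) e0.
  have tdS : t - d + d <= S by lra.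
  have H4 := H (t - d) d td d0 tdS.
  have [i1 I1] := cst (t - d) d (- e) d0.
  have H2 := @le_Rintegral _ _ _ mu `[t - d, t - d + d] _ _ (measurable_itv _)
     (mul (t - d) d td d0 tdS) i1.
  rewrite H4 I1 in H2.
  suff : 0 <= - e by lra.
  apply: H2 => r /=; rewrite in_itv /= => rtd.
  rewrite mulrC; apply: ler_wpM2r; first exact: sbump_ge0.
  have rt : t - d <= r <= t by lra.
  have := Hd r rt; have : P r <= P t by apply: nd; lra.
  rewrite ler_norml /e; lra.
- pose e := (P t + c t) / 2.
  have e0 : 0 < e by rewrite /e; lra.
  have [d [d0 td Hd]] := @within_near_right c S t e cc (introT andP (conj (ltW t0) tS)) e0.
  have H4 := H t d (ltW t0) d0 td.
  have [i1 I1] := cst t d e d0.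
  have := @le_Rintegral _ _ _ mu `[t, t + d] _ _ (measurable_itv _)
     i1 (mul t d (ltW t0) d0 td).
  rewrite I1 => H2.
  suff : e <= 0 by lra.
  rewrite -H4; apply: H2 => r /=; rewrite in_itv /= => rtd.
  rewrite mulrC; apply: ler_wpM2l; first exact: sbump_ge0.
  have := Hd r rtd; have : P t <= P r by apply: nd; lra.
  rewrite ler_norml /e; lra.
Qed.

(* The test functions [1 - sstep d s] turn the weak time derivative into bump
   averages; the primitive of [G] satisfies the same identities as [P + c]. *)
Lemma weak_primitive P c G S m0 :
  (forall s t, 0 <= s -> s <= t -> t <= S -> P s <= P t) ->
  {within `[0, S], continuous c} ->
  {within `[0, S], continuous G} ->
  (forall s d, 0 <= s -> 0 < d -> s + d <= S ->
    Rintegral mu `[0, s + d]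
      (fun t => - sbump d s t * (P t + c t) + (1 - sstep d s t) * G t) = - m0) ->
  forall t, 0 < t < S -> P t + c t = m0 + Rintegral mu `[0, t] G.
Proof.
move=> nd cc cG H.
have [cF dF] := primitive_derive cG.
pose Gam t := m0 + Rintegral mu `[0, t] G.
have cGam : {within `[0, S], continuous Gam}.
  by apply: within_continuousD => //; exact: within_cst.
suff K : forall t, 0 < t < S -> P t + (c t - Gam t) = 0.
  by move=> t tS; have := K t tS; rewrite -/(Gam t); lra.
apply: (@bump_average_eq0 P _ S) => //; first exact: within_continuousB.
move=> s d s0 d0 sd.
have S0 : 0 <= s + d by lra.
have sub : forall f, {within `[0, S], continuous f} -> {within `[0, s + d], continuous f}.
  by move=> f; apply: continuous_subspaceW; apply: subset_itv; rewrite bnd_simp.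
have cb : {within `[0, s + d], continuous (sbump d s)}.
  by apply: within_continuousW; exact: sbump_continuous.
have ct : {within `[0, s + d], continuous (fun t => 1 - sstep d s t)}.
  apply: within_continuousB; first exact: within_cst.
  by apply: within_continuousW; exact: sstep_continuous.
(* The candidate [Gam] satisfies the same identity: the integrand is the derivative of
   [(1 - sstep d s) * Gam], which equals [m0] at 0 and vanishes at [s + d]. Subtracting leaves a
   pure bump average of [P + c - Gam]. *)
have I2 : Rintegral mu `[0, s + d]
    (fun t => - sbump d s t * Gam t + (1 - sstep d s t) * G t) = - m0.
  have c1 : {within `[0, s + d], continuous (fun t => (1 - sstep d s t) * Gam t)}.
    by apply: within_continuousM => //; exact: sub.
  have c2 : {within `[0, s + d], continuous
      (fun t => - sbump d s t * Gam t + (1 - sstep d s t) * G t)}.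
    apply: within_continuousD; apply: within_continuousM => //; last 2 first.
    + exact: sub.
    + exact: sub.
    by move=> t; apply: cvgN; exact: cb.
  have sd0 : 0 < s + d by lra.
  have dd t : 0 < t < s + d -> is_derive t (1:R) (fun t => (1 - sstep d s t) * Gam t)
      (- sbump d s t * Gam t + (1 - sstep d s t) * G t).
    move=> /andP[t0 td].
    have d1 : is_derive t (1:R) Gam (G t).
      have tS : 0 < t < S by lra.
      have := is_derive_sum (is_derive_cst m0 t 1) (dF t tS).
      by rewrite add0r.
    have d2 := is_derive_diff (is_derive_cst (1:R) t 1) (sstep_is_derive s t d0).
    rewrite -[- sbump d s t]sub0r.
    exact: is_derive_prod d2 d1.
  rewrite (Rintegral_FTC sd0 c1 dd c2).
  rewrite sstep_eq1 // sstep_eq0 // subrr mul0r sub0r subr0 mul1r /Gam.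
  by rewrite set_itv1 Rintegral_set1 addr0.
have cQ : measurable_fun `[0, s + d] (fun t => P t + (c t - Gam t)) /\
   exists M : R, forall t, 0 <= t <= s + d -> `|P t + (c t - Gam t)| <= M.
  apply: monotone_plus_continuous_integrable => //.
    by move=> u v u0 uv vs; apply: nd => //; lra.
  by apply: sub; exact: within_continuousB.
have cQ' : measurable_fun `[0, s + d] (fun t => P t + c t) /\
   exists M : R, forall t, 0 <= t <= s + d -> `|P t + c t| <= M.
  apply: monotone_plus_continuous_integrable => //.
    by move=> u v u0 uv vs; apply: nd => //; lra.
  exact: sub.
have bi f : measurable_fun `[0, s + d] f /\
    (exists M : R, forall t, 0 <= t <= s + d -> `|f t| <= M) ->
  mu.-integrable `[0, s + d] (EFin \o (fun t => sbump d s t * f t)).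
  move=> [mf [M fM]].
  apply: (@bounded_itv_integrable _ _ _ (2 / d * M)).
    apply: measurable_funM => //.
    by apply: measurable_funS (continuous_measurable_fun (@sbump_continuous R d s)).
  move=> r rsd; rewrite normrM; apply: ler_pM => //; last exact: fM.
  by rewrite ger0_norm ?sbump_ge0 ?sbump_le.
have iQ := bi _ cQ.
have iG : mu.-integrable `[0, s + d]
    (EFin \o (fun t => - sbump d s t * Gam t + (1 - sstep d s t) * G t)).
  apply: within_integrable.
  apply: within_continuousD; apply: within_continuousM => //; last 2 first.
    + exact: sub.
    + exact: sub.
    by move=> t; apply: cvgN; exact: cb.
have := H s d s0 d0 sd.
have -> : Rintegral mu `[0, s + d]
      (fun t => - sbump d s t * (P t + c t) + (1 - sstep d s t) * G t) =
   - Rintegral mu `[0, s + d] (fun t => sbump d s t * (P t + (c t - Gam t))) - m0.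
  rewrite -I2 [RHS]addrC -RintegralB //; apply: eq_Rintegral => t _; ring.
set I0 := Rintegral _ _ _ => H0.
have {H0} : I0 = 0 by lra.
rewrite /I0 => <-.
(* The bump vanishes before [s], so both domains give the same integral. *)
rewrite Rintegral_mkcond [RHS]Rintegral_mkcond; apply: eq_Rintegral => t _.
rewrite !patchE !mem_setE !in_itv /=.
case: (leP s t) => st /=; first by rewrite (le_trans s0 st).
case: ifP => // _; rewrite sbump_supp ?mul0r // => /andP[h1 _].
by have := lt_trans h1 st; rewrite ltxx.
Qed.

(** A null set contains no interval of positive length. It serves to pick, arbitrarily close to a
    given time, a time at which an almost-everywhere bound holds. *)
Lemma ae_itv_exists (Q : R -> Prop) A B x y :
  {ae mu, forall t, t \in `]A, B[ -> Q t} ->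
  A <= x -> x < y -> y <= B -> exists t, x < t < y /\ Q t.
Proof.
move=> [N [mN N0 QN]] Ax xy yB; apply: contrapT => nex.
have sub : `]x, y[%classic `<=` N.
  move=> t /=; rewrite in_itv /= => /andP[xt ty]; apply: QN => /= h.
  apply: nex; exists t; split; first by rewrite xt.
  by apply: h; rewrite in_itv /= (le_lt_trans Ax xt) (lt_le_trans ty yB).
have := le_measure mu _ _ sub; rewrite !inE => /(_ (measurable_itv _) mN).
by rewrite [X in (_ <= X)%E]N0 /= lebesgue_measure_itv /= lte_fin xy -EFinB lee_fin subr_le0 leNgt xy.
Qed.

End TimeAverages.

(** * Consequences of the weak formulation *)

#[local] Opaque step bump ramp.
Section Solution.
Variable R : realType.
Notation mu := (@lebesgue_measure R).
Notation HL := (@halfline R).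
Implicit Types (g zeta theta : R -> R) (s t d x y h e C M S B : R).

Lemma cvgn_le (w : nat -> R) (l M : R) : w k @[k --> \oo] --> l ->
  (forall k, w k <= M) -> l <= M.
Proof.
move=> cw H; rewrite -(cvg_lim (@Rhausdorff R) cw); apply: limr_le; first by apply/cvg_ex; exists l.
exact: nearW.
Qed.

Lemma measurable_inv_HL : measurable_fun HL (fun x : R => x^-1).
Proof.
apply: subspace_continuous_measurable_fun; first exact: measurable_itv.
apply: continuous_in_subspaceT => x; rewrite inE HLE => x0.
by apply: inv_continuous; rewrite gt_eqF.
Qed.

(** Smooth cutoff, 0 up to [1/(k+1)] and 1 from [2/(k+1)] on. It increases to 1 with [k], and being
    at most [(k+1) x] it is an observable to which the weak continuity of solutions applies. *)
Definition cut (k : nat) : R -> R := sstep (k.+1%:R^-1) (k.+1%:R^-1).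

Lemma cut01 k x : 0 <= cut k x <= 1. Proof. exact: sstep01. Qed.

Lemma cut_norm k x : `|cut k x| = cut k x.
Proof. by rewrite ger0_norm //; case/andP: (cut01 k x). Qed.

Lemma kinv_gt0 k : 0 < (k.+1%:R^-1 : R). Proof. by rewrite invr_gt0. Qed.

Lemma cut_le_id k x : 0 < x -> cut k x <= k.+1%:R * x.
Proof.
move=> x0; have k0 : (0 : R) < k.+1%:R by [].
have [xk|kx] := leP x (k.+1%:R^-1).
  by rewrite /cut sstep_eq0 ?kinv_gt0 // mulr_ge0 // ltW.
have /andP[_ c1] := cut01 k x; apply: (le_trans c1).
by rewrite -ler_pdivrMl // mulr1 ltW.
Qed.

Lemma cut_nondecreasing k l x : 0 < x -> (k <= l)%N -> cut k x <= cut l x.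
Proof.
move=> x0 kl; rewrite /cut /sstep; apply: step_le.
rewrite !invrK !mulrBl !mulVf ?pnatr_eq0 // lerD2r.
by apply: ler_wpM2l; [exact: ltW|rewrite ler_nat].
Qed.

Lemma cut_cvg x : 0 < x -> cut k x @[k --> \oo] --> (1 : R).
Proof.
move=> x0; apply: cvg_near_cst.
have /cvgr_le /(_ (x / 2)) := @cvg_harmonic R.
move=> /(_ ltac:(by rewrite divr_gt0)).
apply: filterS => k /= Hk; rewrite /cut sstep_eq1 ?kinv_gt0 //.
by rewrite [leRHS]splitr lerD.
Qed.

Lemma measurable_cut k : measurable_fun HL (cut k).
Proof. by apply: continuous_measurable_HL; exact: sstep_continuous. Qed.

Lemma adm_cut k : adm (cut k).
Proof. exact: adm_sstep1. Qed.

Variables (rho Phi0 T A : R) (a b n fin : R -> R) (f : R -> R -> R).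
Hypothesis ab0 : forall x, 0 <= x -> 0 <= a x /\ 0 <= b x.
Hypothesis ca : {within `[0, +oo[, continuous a}.
Hypothesis cb : {within `[0, +oo[, continuous b}.
Hypothesis growth : forall x, 0 <= x -> a x <= A * (1 + x) /\ b x <= A * (1 + x).
Hypothesis nlip : forall K, exists L : R, forall s r, Phi0 <= s <= K -> Phi0 <= r <= K ->
       `|n s - n r| <= L * `|s - r|.
Hypothesis dfin : dens fin.
Hypothesis sol : LS_solution T rho Phi0 a b n fin f.

Let u t := LS_u rho f t.

Lemma timeintE t : (t \in timeint T) = (0 <= t < T).
Proof. by apply/idP/idP; rewrite inE /timeint /= in_itv. Qed.

Lemma measurable_rate g : {within `[0, +oo[, continuous g} -> measurable_fun HL g.
Proof.
move=> cg; have : measurable_fun (`[0, +oo[ : set R) g.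
  by apply: subspace_continuous_measurable_fun => //; exact: measurable_itv.
apply: measurable_funS; first exact: measurable_itv.
by move=> x; rewrite HLE /= in_itv /= andbT => /ltW.
Qed.

Lemma adm_a : adm a.
Proof.
split; first exact: measurable_rate.
exists A => x /ltW x0; rewrite ger0_norm; first by case: (growth x0).
by case: (ab0 x0).
Qed.

Lemma adm_b : adm b.
Proof.
split; first exact: measurable_rate.
exists A => x /ltW x0; rewrite ger0_norm; first by case: (growth x0).
by case: (ab0 x0).
Qed.

Lemma adm_speed s : adm (fun y => a y * s - b y).
Proof.
apply: admB adm_b; have := admZ s adm_a.
by under eq_fun do rewrite mulrC.
Qed.

Lemma measurable_sol t : 0 <= t < T -> measurable_fun HL (f t).
Proof.
move=> tT; have [H _ _ _] := sol.
have mi : measurable_fun HL (fun x => x * f t x).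
  by apply/measurable_EFinP; apply: measurable_int (H t _); rewrite timeintE.
apply: (eq_measurable_fun (fun x => x^-1 * (x * f t x))).
  by move=> x; rewrite inE HLE => x0; rewrite mulrA mulVf ?gt_eqF // mul1r.
by apply: measurable_funM => //; exact: measurable_inv_HL.
Qed.

Lemma within_timeint g S : S < T -> {within timeint T, continuous g} ->
  {within `[0, S], continuous g}.
Proof.
move=> ST; apply: continuous_subspaceW => t /=; rewrite in_itv /= => /andP[t0 tS].
by rewrite /timeint /= in_itv /= t0 (le_lt_trans tS).
Qed.

(** Solutions are continuous in time when [x * f t x] is tested against bounded functions; here the
    bounded function is [g x / x], extended by 0 outside the half-line. *)
Lemma mom_time_continuous g C S : S < T -> measurable_fun HL g ->
  (forall x, 0 < x -> `|g x| <= C * x) ->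
  {within `[0, S], continuous (fun t => mom (f t) g)}.
Proof.
move=> ST mg gC; have [_ H _ _] := sol.
pose g' := (fun x => g x / x) \_ HL.
have mg' : measurable_fun setT g'.
  apply/(measurable_restrictT _ (@measurable_HL R)).
  by apply: measurable_funM => //; exact: measurable_inv_HL.
have bg' : exists M, forall x, `|g' x| <= M.
  exists `|C| => x; rewrite /g' patchE; case: ifPn => [|_]; last by rewrite normr0.
  rewrite inE HLE => x0; rewrite normrM normfV (gtr0_norm x0) ler_pdivrMr //.
  by apply: le_trans (gC _ x0) _; rewrite ler_pM2r // ler_norm.
have := within_timeint ST (H _ mg' bg').
apply: eq_within => t _; apply: eq_Rintegral => x; rewrite inE => x0.
rewrite /g' patchE mem_set //; move: x0; rewrite HLE => x0.
by rewrite mulrA divfK // gt_eqF.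
Qed.

Lemma sol_ae_ge0 t : 0 <= t < T -> {ae mu, forall x, x \in HL -> 0 <= f t x}.
Proof. by move=> tT; have [_ _ H _] := sol; apply: H; rewrite timeintE. Qed.

Lemma cut_integrable k t : 0 <= t < T ->
  mu.-integrable HL (EFin \o (fun x => cut k x * f t x)).
Proof.
move=> tT; have [H _ _ _] := sol.
have tT' : t \in timeint T by rewrite timeintE.
have iG : mu.-integrable HL (fun x => (k.+1%:R%:E * (x * f t x)%:E)%E).
  by apply: integrableZl (H t tT'); exact: measurable_itv.
apply: le_integrable iG.
- exact: measurable_itv.
- by apply/measurable_EFinP; apply: measurable_funM; [exact: measurable_cut|exact: measurable_sol].
- move=> x; rewrite HLE => x0 /=; rewrite lee_fin (normrM (cut k x)) cut_norm (normrM k.+1%:R) (normrM x) mulrA.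
  apply: ler_wpM2r => //; rewrite -normrM ger0_norm; first exact: cut_le_id.
  by rewrite mulr_ge0 // ltW.
Qed.

Lemma mom_cut_norm k t : 0 <= t < T ->
  (\int[mu]_(x in HL) `|cut k x * f t x|%:E)%E = (mom (f t) (cut k))%:E.
Proof.
move=> tT; have ik := cut_integrable k tT.
rewrite /mom /Rintegral fineK; last by apply: integrable_fin_num => //; exact: measurable_itv.
apply: ae_eq_integral.
- exact: measurable_itv.
- apply/measurable_EFinP; apply: measurableT_comp => //.
  by apply/measurable_EFinP; exact: measurable_int ik.
- exact: measurable_int ik.
- have := sol_ae_ge0 tT; apply: filterS; first exact: (ae_filter_ringOfSetsType mu).
  move=> x xp; rewrite HLE => x0.
  rewrite ger0_norm // mulr_ge0 //; first by case/andP: (cut01 k x).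
  by apply: xp; rewrite inE HLE.
Qed.

(* The definition of solutions bounds the mass for almost every time only; the
   bound extends to all times because the truncated masses are continuous. *)
Lemma mass_bound S : S < T -> exists M, forall t, 0 <= t <= S ->
  mu.-integrable HL (EFin \o f t) /\ mom (f t) (cst 1) <= M.
Proof.
move=> ST.
(* Good times are sought just after [t], and [t = S] is allowed; [S'] leaves room to the right. *)
pose S' := (Num.max 0 S + T) / 2.
have [T0|T0] := leP T 0; first by exists 0 => t tS; lra.
have mST : Num.max 0 S < T by rewrite gt_max T0.
have mS : S <= Num.max 0 S by rewrite le_max lexx orbT.
have m0 : 0 <= Num.max 0 S by rewrite le_max lexx.
have S'T : S' < T by rewrite /S'; lra.
have SS' : S < S' by rewrite /S'; lra.
have [_ _ _ [H _ _]] := sol.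
have [M HM] := H S' S'T.
exists M.
(* A truncated mass above [M] at [t] would stay above [M] on a right neighbourhood of [t], which
   contains a time where the bound by [M] holds. *)
have st1 k t : 0 <= t <= S -> mom (f t) (cut k) <= M.
  move=> tS; have [//|Mlt] := leP (mom (f t) (cut k)) M; exfalso.
  have ck : {within `[0, S'], continuous (fun t => mom (f t) (cut k))}.
    apply: (@mom_time_continuous _ k.+1%:R) => //; first exact: measurable_cut.
    move=> x x0; rewrite ger0_norm; first exact: cut_le_id.
    by case/andP: (cut01 k x).
  have e0 : 0 < (mom (f t) (cut k) - M) / 2 by lra.
  have tS' : 0 <= t < S' by lra.
  have [d [d0 td Hd]] := within_near_right ck tS' e0.
  have tt0 : 0 <= t by lra.
  have ttd : t < t + d by lra.
  have [r [rtd [ir Ir]]] := ae_itv_exists HM tt0 ttd td.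
  have rT : 0 <= r < T by lra.
  have dr : dens (f r).
    split => //; last exact: sol_ae_ge0.
    by have [Hi _ _ _] := sol; apply: Hi; rewrite timeintE.
  have h1 : mom (f r) (cut k) <= mom (f r) (cst 1).
    apply: mom_le => //; [exact: adm_cut|exact: adm_cst|].
    by move=> x _; case/andP: (cut01 k x).
  have h2 : mom (f r) (cst 1) <= M.
    rewrite -lee_fin /mom /Rintegral fineK; last first.
      apply: integrable_fin_num; first exact: measurable_itv.
      by apply: eq_integrable ir => //; [exact: measurable_itv|move=> x _ /=; rewrite mul1r].
    apply: le_trans Ir; rewrite le_eqVlt; apply/orP; left; apply/eqP.
    by apply: eq_integral => x _; rewrite mul1r.
  have rr : t <= r <= t + d by lra.
  have := Hd r rr; rewrite ler_norml; lra.
move=> t tS; have tT : 0 <= t < T by lra.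
have mf := measurable_sol tT.
have cvx x : HL x -> (`|cut k x * f t x|%:E @[k --> \oo] --> `|f t x|%:E)%E.
  rewrite HLE => x0; apply/fine_cvgP; split; first exact: nearW.
  apply: cvg_norm; rewrite -[X in _ --> X]mul1r; apply: cvgM; last exact: cvg_cst.
  exact: cut_cvg.
have mg k : measurable_fun HL (fun x => `|cut k x * f t x|%:E).
  apply/measurable_EFinP; apply: measurableT_comp => //.
  by apply: measurable_funM => //; exact: measurable_cut.
have nng k x : HL x -> (0 <= `|cut k x * f t x|%:E)%E by rewrite lee_fin.
have ndg x : HL x -> {homo (fun k => `|cut k x * f t x|%:E) : i j / (i <= j)%N >-> (i <= j)%E}.
  rewrite HLE => x0 i j ij; rewrite lee_fin (normrM (cut i x)) (normrM (cut j x)) !cut_norm; apply: ler_wpM2r => //.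
  by exact: cut_nondecreasing.
(* Monotone rather than dominated convergence, since the integrability of [f t] is what is being
   proved. *)
have cvI := @cvg_monotone_convergence _ _ _ mu HL (measurable_itv _) _ mg nng ndg.
have ile : (\int[mu]_(x in HL) `|f t x|%:E <= M%:E)%E.
  have -> : (\int[mu]_(x in HL) `|f t x|%:E =
     \int[mu]_(x in HL) limn (fun k => `|cut k x * f t x|%:E))%E.
    apply: eq_integral => x; rewrite inE => xH.
    by apply/esym/cvg_lim => //; exact: cvx.
  rewrite -(cvg_lim _ cvI) //; apply: lime_le; first by apply/cvg_ex; eexists; exact: cvI.
  by apply: nearW => k; rewrite mom_cut_norm // lee_fin; exact: st1.
have ift : mu.-integrable HL (EFin \o f t).
  apply/integrableP; split; first exact/measurable_EFinP.
  by apply: le_lt_trans ile _; exact: ltry.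
split => //.
have dt : dens (f t).
  split => //; last exact: sol_ae_ge0.
  by have [Hi _ _ _] := sol; apply: Hi; rewrite timeintE.
apply: (@cvgn_le (fun k => mom (f t) (cut k))); last by move=> k; exact: st1.
apply: (@mom_cvg _ _ _ _ 1) => //.
- exact: measurable_cut.
- move=> k x x0; have /andP[c0 c1] := cut01 k x; rewrite ger0_norm //; lra.
- exact: cut_cvg.
Qed.

Lemma dens_sol t : 0 <= t < T -> dens (f t).
Proof.
move=> tT; have [t0 t1] := andP tT.
have [M /(_ t _)[]] := mass_bound t1; first by rewrite t0 lexx.
move=> i _; split => //; last exact: sol_ae_ge0.
by have [Hi _ _ _] := sol; apply: Hi; rewrite timeintE.
Qed.

Lemma u_bounds t : 0 <= t < T -> Phi0 < u t <= rho.
Proof.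
move=> tT; apply/andP; split.
  by have [_ _ _ [_ H _]] := sol; apply: H; rewrite timeintE.
rewrite /u /LS_u lerBlDr lerDl.
by apply: (@mom_ge0 _ (f t) id (dens_sol tT) (@adm_id R)) => x /ltW.
Qed.

Lemma u_mom t : u t = rho - mom (f t) id. Proof. by []. Qed.

Lemma mom_id_le t : 0 <= t < T -> mom (f t) id <= rho - Phi0.
Proof. by move=> /u_bounds; rewrite u_mom; lra. Qed.

Lemma u_continuous S : S < T -> {within `[0, S], continuous u}.
Proof.
move=> ST; apply: within_continuousB; first exact: within_cst.
apply: (@mom_time_continuous id 1) => // x x0.
by rewrite mul1r gtr0_norm.
Qed.

Lemma n_continuous S : S < T -> {within `[0, S], continuous (fun t => n (u t))}.
Proof.
move=> ST; have [L nL] := nlip rho.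
apply/subspace_continuousP => t tS; apply/cvgrPdist_le => e e0.
have L1 : 0 < `|L| + 1 by rewrite ltr_wpDl.
have e1 : 0 < e / (`|L| + 1) by rewrite divr_gt0.
have /subspace_continuousP /(_ t tS) /cvgrPdist_le /(_ _ e1) := u_continuous ST.
rewrite !near_withinE; apply: filterS => r + rS => /(_ rS) H.
have ur z : `[0, S]%classic z -> Phi0 <= u z <= rho.
  rewrite /= in_itv /= => zS; have zT : 0 <= z < T by lra.
  by have := u_bounds zT; lra.
apply: le_trans (nL _ _ (ur _ tS) (ur _ rS)) _.
move: H; rewrite ler_pdivlMr // => H; apply: le_trans H.
rewrite mulrC; apply: ler_wpM2l => //.
by apply: le_trans (ler_norm _) _; rewrite lerDl.
Qed.


Lemma A_ge0 : 0 <= A.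
Proof.
have [h1 _] := growth (lexx 0); have [h2 _] := ab0 (lexx 0).
by move: h1; rewrite addr0 mulr1; exact: le_trans.
Qed.

Lemma adm_flux g C s : continuous g -> (forall x, 0 < x -> `|g x| <= C) ->
  adm (fun y => (a y * s - b y) * g y).
Proof.
move=> cg gC; have := admM (continuous_measurable_HL cg) gC (adm_speed s).
by under eq_fun do rewrite mulrC.
Qed.

(** The weak formulation for a test function with separated variables. The identity stays in the
    extended reals, because integrability in time of the terms is established only later, in
    [weak_time]. *)
Lemma weak_product theta dtheta zeta dzeta C :
  (forall t, is_derive t (1:R) theta (dtheta t)) -> continuous dtheta ->
  (exists T', T' < T /\ forall t, T' <= t -> theta t = 0) ->
  (forall x, is_derive x (1:R) zeta (dzeta x)) -> continuous dzeta ->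
  (exists X, forall x, X <= x -> zeta x = 0) ->
  adm zeta -> (forall x, 0 < x -> `|dzeta x| <= C) ->
  (\int[mu]_(t in timeint T) (dtheta t * mom (f t) zeta +
     theta t * mom (f t) (fun x => (a x * u t - b x) * dzeta x))%:E +
   \int[mu]_(t in timeint T) (theta t * zeta 0 * n (u t))%:E +
   (theta 0 * mom fin zeta)%:E = 0)%E.
Proof.
move=> dth cth [T' [T'T th0]] dze cze [X ze0] aze bze.
have [_ _ _ [_ _ H]] := sol.
have contd (g g' : R -> R) : (forall t, is_derive t (1:R) g (g' t)) -> continuous g.
  move=> H' t; apply: differentiable_continuous; apply/derivable1_diffP.
  by case: (H' t).
have cprod (g g' : R -> R) : continuous g -> continuous g' ->
    continuous (fun p : R * R => g p.1 * g' p.2).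
  move=> c1 c2 p; apply: cvgM.
    by apply: (@continuous_comp _ _ _ fst g); [exact: cvg_fst|exact: c1].
  by apply: (@continuous_comp _ _ _ snd g'); [exact: cvg_snd|exact: c2].
have test : LS_test T (fun t x => theta t * zeta x) (fun t x => dtheta t * zeta x)
    (fun t x => theta t * dzeta x).
  split.
  - move=> t x; have := is_derive_scale (zeta x) (dth t).
    by rewrite mulrC; under eq_fun do rewrite mulrC.
  - by move=> t x; exact: is_derive_scale.
  - by apply: cprod => //; exact: contd dze.
  - by apply: cprod => //; exact: contd dth.
  - exists T', X; split => // t x [tT|xX]; first by rewrite th0 // mul0r.
    by rewrite ze0 // mulr0.
have := H _ _ _ test; rewrite -/u.
have -> : (\int[mu]_(x in HL) (theta 0 * zeta x * fin x)%:E = (theta 0 * mom fin zeta)%:E)%E.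
  rewrite -momZ // /mom /Rintegral fineK //.
  apply: integrable_fin_num; first exact: measurable_itv.
  by apply: adm_integrable => //; exact: admZ.
move=> <-; congr (_ + _ + _)%E.
apply: eq_integral => t; rewrite -inE => /[!inE] tT.
have {}tT : 0 <= t < T by rewrite -timeintE inE.
have dt := dens_sol tT.
have af := @adm_flux dzeta C (u t) cze bze.
rewrite -momZ // -momZ // -momD //; [|exact: admZ..].
rewrite /mom /Rintegral fineK; last first.
  apply: integrable_fin_num; first exact: measurable_itv.
  by apply: adm_integrable => //; apply: admD; exact: admZ.
apply: eq_integral => x _; congr EFin; rewrite -/(u t); ring.
Qed.

Lemma timeint_truncate (F : R -> R) S : S < T -> (forall t, S < t -> F t = 0) ->
  (\int[mu]_(t in timeint T) (F t)%:E = \int[mu]_(t in `[0%R, S]) (F t)%:E)%E.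
Proof.
move=> ST F0; rewrite integral_mkcond [RHS]integral_mkcond.
apply: eq_integral => t _; rewrite !patchE /timeint !mem_setE !in_itv /=.
have [tS|St] := leP t S; first by rewrite andbT (le_lt_trans tS ST) andbT.
by rewrite F0 // andbF if_same.
Qed.

(** Writing the moment as a nondecreasing [P] plus a continuous [c] covers both uses: [P = 0] when
    [zeta] vanishes near 0 and the moment is continuous, and [P] equal to the mass when [zeta] is 1
    near 0. *)
Lemma weak_time zeta dzeta C (P c : R -> R) S : S < T ->
  (forall x, is_derive x (1:R) zeta (dzeta x)) -> continuous dzeta ->
  (exists X, forall x, X <= x -> zeta x = 0) ->
  adm zeta -> (forall x, 0 < x -> `|dzeta x| <= C) ->
  (forall s t, 0 <= s -> s <= t -> t <= S -> P s <= P t) ->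
  {within `[0, S], continuous c} ->
  (forall t, 0 <= t <= S -> mom (f t) zeta = P t + c t) ->
  {within `[0, S], continuous (fun t => mom (f t) (fun x => (a x * u t - b x) * dzeta x))} ->
  forall t, 0 < t < S -> mom (f t) zeta = mom fin zeta + Rintegral mu `[0, t]
    (fun t => mom (f t) (fun x => (a x * u t - b x) * dzeta x) + zeta 0 * n (u t)).
Proof.
move=> ST dze cze ze0 aze bze nd cc mPc cG t tS.
have [t0 t1] := andP tS.
rewrite mPc; last lra.
set G1 := fun t => mom (f t) (fun x => (a x * u t - b x) * dzeta x).
have cn : {within `[0, S], continuous (fun t => zeta 0 * n (u t))}.
  by apply: within_continuousM; [exact: within_cst|exact: n_continuous].
apply: (@weak_primitive _ P c _ S) => //; first exact: within_continuousD.
move=> s d s0 d0 sd.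
have sdT : s + d < T by lra.
have sd0 : 0 <= s + d by lra.
have sub : forall g, {within `[0, S], continuous g} -> {within `[0, s + d], continuous g}.
  by move=> g; apply: continuous_subspaceW; apply: subset_itv; rewrite bnd_simp.
have thsd r : s + d < r -> 1 - sstep d s r = 0.
  by move=> sr; rewrite sstep_eq1 ?subrr // ltW.
have busd r : s + d < r -> sbump d s r = 0.
  by move=> sr; rewrite sbump_supp // => /andP[_ rs]; have := lt_trans sr rs; rewrite ltxx.
have H1 r : is_derive r (1:R) (fun t => 1 - sstep d s t) (- sbump d s r).
  have := is_derive_diff (is_derive_cst (1:R) r 1) (sstep_is_derive s r d0).
  by rewrite sub0r.
have cb' : continuous (fun t => - sbump d s t).
  by move=> r; apply: cvgN; exact: sbump_continuous.
have H3 : exists T', T' < T /\ forall t, T' <= t -> 1 - sstep d s t = 0.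
  by exists (s + d); split => // r sr; rewrite sstep_eq1 ?subrr.
have := weak_product H1 cb' H3 dze cze ze0 aze bze.
rewrite (timeint_truncate sdT); last by move=> r sr; rewrite busd // thsd // oppr0 !mul0r addr0.
rewrite (timeint_truncate sdT); last by move=> r sr; rewrite thsd // !mul0r.
have -> : (\int[mu]_(t in `[0%R, (s + d)%R]) (- sbump d s t * mom (f t) zeta +
     (1 - sstep d s t) * mom (f t) (fun x => (a x * u t - b x) * dzeta x))%:E =
   \int[mu]_(t in `[0%R, (s + d)%R]) (- sbump d s t * (P t + c t) + (1 - sstep d s t) * G1 t)%:E)%E.
  apply: eq_integral => r; rewrite inE /= in_itv /= => rsd.
  by rewrite mPc //; lra.
have ct : {within `[0, s + d], continuous (fun t => 1 - sstep d s t)}.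
  apply: within_continuousB; first exact: within_cst.
  by apply: within_continuousW; exact: sstep_continuous.
have i1 : mu.-integrable `[0, s + d]
    (EFin \o (fun t => - sbump d s t * (P t + c t) + (1 - sstep d s t) * G1 t)).
  have [||mQ [M QM]] := @monotone_plus_continuous_integrable _ P c (s + d) sd0.
  - by move=> p q p0 pq qs; apply: nd => //; lra.
  - exact: sub.
  have cTG : {within `[0, s + d], continuous (fun t => (1 - sstep d s t) * G1 t)}.
    by apply: within_continuousM => //; exact: sub.
  have [M' [_ TGM]] := within_continuous_bounded cTG.
  apply: (@bounded_itv_integrable _ _ _ _ (2 / d * M + M')).
    apply: measurable_funD.
      apply: measurable_funM => //.
      by apply: measurable_funS (continuous_measurable_fun cb').
    by apply: subspace_continuous_measurable_fun.
  move=> r rsd; apply: le_trans (ler_normD _ _) _; apply: lerD; last exact: TGM.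
  rewrite normrM; apply: ler_pM => //; last exact: QM.
  by rewrite normrN ger0_norm ?sbump_ge0 ?sbump_le.
have i2 : mu.-integrable `[0, s + d]
    (EFin \o (fun t => (1 - sstep d s t) * zeta 0 * n (u t))).
  apply: within_integrable.
  apply: within_continuousM; first by apply: within_continuousM => //; exact: within_cst.
  by apply: sub; exact: n_continuous.
rewrite sstep_eq0 // subr0 mul1r.
have toR (g : R -> R) : mu.-integrable `[0, s + d] (EFin \o g) ->
    (\int[mu]_(t in `[0%R, (s + d)%R]) (g t)%:E = (Rintegral mu `[0, s + d] g)%:E)%E.
  by move=> ig; rewrite /Rintegral fineK //; apply: integrable_fin_num.
rewrite (toR _ i1) (toR _ i2) -!EFinD => -[].
rewrite -RintegralD // => H0.
apply: (addIr (mom fin zeta)); rewrite addNr -[RHS]H0; congr (_ + _).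
apply: eq_Rintegral => r _; rewrite /G1; ring.
Qed.

Lemma sub_id_bound g g' C C' x y : 0 < x -> 0 < y ->
  (forall y, 0 < y -> y <= x -> g y = 0) -> (forall y, 0 < y -> `|g y| <= C) ->
  (forall y, 0 < y -> `|g' y| <= C' * (1 + y)) ->
  `|g' y * g y| <= `|C'| * C * (x^-1 + 1) * y.
Proof.
move=> x0 y0 gx gC gC'.
have C0 : 0 <= C by apply: le_trans (gC _ y0).
have x1 : 0 < x^-1 by rewrite invr_gt0.
have [yx|xy] := leP y x.
  by rewrite gx // mulr0 normr0 !mulr_ge0 // ?addr_ge0 // ltW.
have xy1 : 1 <= x^-1 * y by rewrite -ler_pdivrMl ?invr_gt0 // invrK mulr1 ltW.
rewrite normrM.
have -> : `|C'| * C * (x^-1 + 1) * y = `|C'| * (x^-1 * y + y) * C by ring.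
apply: ler_pM => //; last exact: gC.
apply: le_trans (gC' _ y0) _.
apply: le_trans (_ : `|C'| * (1 + y) <= _).
  by apply: ler_wpM2r; [lra|exact: ler_norm].
by apply: ler_wpM2l => //; rewrite lerD2r.
Qed.

Lemma flux_continuous g C x S : S < T -> continuous g -> 0 < x ->
  (forall y, 0 < y -> y <= x -> g y = 0) -> (forall y, 0 < y -> `|g y| <= C) ->
  {within `[0, S], continuous (fun t => mom (f t) (fun y => (a y * u t - b y) * g y))}.
Proof.
move=> ST cg x0 gx gC.
have mg : measurable_fun HL g by exact: continuous_measurable_HL.
have aga : adm (fun y => a y * g y).
  by have := admM mg gC adm_a; under eq_fun do rewrite mulrC.
have agb : adm (fun y => b y * g y).
  by have := admM mg gC adm_b; under eq_fun do rewrite mulrC.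
have ba y : 0 < y -> `|a y| <= A * (1 + y).
  by move=> /ltW y0; rewrite ger0_norm; [case: (growth y0)|case: (ab0 y0)].
have bb y : 0 < y -> `|b y| <= A * (1 + y).
  by move=> /ltW y0; rewrite ger0_norm; [case: (growth y0)|case: (ab0 y0)].
(* Continuity in time is available for fixed observables only, so the factor [u t] is first taken
   out of the moment. *)
apply: (@eq_within _ _ (fun t => u t * mom (f t) (fun y => a y * g y) -
   mom (f t) (fun y => b y * g y))).
  move=> t; rewrite /= in_itv /= => tS; have tT : 0 <= t < T by lra.
  rewrite -momZ //; [|exact: dens_sol].
  rewrite -momB //; [|exact: dens_sol|exact: admZ].
  by apply: eq_mom => y _; ring.
apply: within_continuousB.
  apply: within_continuousM; first exact: u_continuous.
  apply: mom_time_continuous => //; first by case: aga.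
  by move=> y y0; exact: (@sub_id_bound g a C A x y).
apply: mom_time_continuous => //; first by case: agb.
by move=> y y0; exact: (@sub_id_bound g b C A x y).
Qed.


Lemma sstep_le_id h x y : 0 < h -> 0 < x -> 0 < y -> sstep h x y <= x^-1 * y.
Proof.
move=> h0 x0 y0; have [yx|xy] := leP y x.
  by rewrite sstep_eq0 // mulr_ge0 // ?invr_ge0 ltW.
have /andP[_ s1] := sstep01 h x y; apply: (le_trans s1).
by rewrite mulrC ler_pdivlMr // mul1r ltW.
Qed.

Lemma sstep_norm h x y : `|sstep h x y| = sstep h x y.
Proof. by rewrite ger0_norm //; case/andP: (sstep01 h x y). Qed.

Lemma sbump_norm_le h x y : 0 < h -> `|sbump h x y| <= 2 / h.
Proof. by move=> h0; rewrite ger0_norm ?sbump_ge0 ?sbump_le. Qed.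

Lemma sbump_eq0l h x y : 0 < h -> y <= x -> sbump h x y = 0.
Proof. by move=> h0 yx; rewrite sbump_supp // => /andP[xy _]; have := le_lt_trans yx xy; rewrite ltxx. Qed.

Lemma mom_sstep_continuous_time h x S : S < T -> 0 < h -> 0 < x ->
  {within `[0, S], continuous (fun t => mom (f t) (sstep h x))}.
Proof.
move=> ST h0 x0; apply: (@mom_time_continuous _ x^-1) => //.
  by apply: continuous_measurable_HL; exact: sstep_continuous.
by move=> y y0; rewrite sstep_norm; exact: sstep_le_id.
Qed.

Lemma flux_sbump_continuous h x S : S < T -> 0 < h -> 0 < x ->
  {within `[0, S], continuous (fun t => mom (f t) (fun y => (a y * u t - b y) * sbump h x y))}.
Proof.
move=> ST h0 x0; apply: (@flux_continuous _ (2 / h) x) => //.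
- exact: sbump_continuous.
- by move=> y _ yx; exact: sbump_eq0l.
- by move=> y _; exact: sbump_norm_le.
Qed.

Lemma speed_bound t y : 0 <= t < T -> 0 < y ->
  `|a y * u t - b y| <= A * (1 + y) * (`|Phi0| + `|rho| + 1).
Proof.
move=> tT /ltW y0; have [a1 b1] := ab0 y0; have [a2 b2] := growth y0.
have ut : `|u t| <= `|Phi0| + `|rho|.
  have := u_bounds tT; have := ler_norm rho; have := ler_norm (- Phi0); rewrite normrN.
  have := normr_ge0 rho; have := normr_ge0 Phi0.
  by rewrite ler_norml; lra.
apply: le_trans (ler_normB _ _) _; rewrite [leRHS]mulrDr mulr1; apply: lerD.
  by rewrite normrM ger0_norm //; apply: ler_pM.
by rewrite ger0_norm.
Qed.

(** The cutoff at infinity has width [X]: its bump is at most [2 / X] and lives where [y > X >= 1],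
    hence where [1 + y <= 2 * y]. The linear growth of the speed thus costs a multiple of the mean,
    divided by [X]; the 4 is the product of these two factors 2. *)
Lemma flux_tail_bound t X : 0 <= t < T -> 1 <= X ->
  `|mom (f t) (fun y => (a y * u t - b y) * sbump X X y)| <=
  4 * A * (`|Phi0| + `|rho| + 1) * (rho - Phi0) / X.
Proof.
move=> tT X1; have X0 : 0 < X by lra.
have dt := dens_sol tT.
set K := `|Phi0| + `|rho| + 1.
have K0 : 0 <= K by rewrite /K !addr_ge0.
have Xi : 0 < X^-1 by rewrite invr_gt0.
apply: le_trans (_ : 4 * A * K / X * mom (f t) id <= _); last first.
  rewrite mulrAC; apply: ler_wpM2r; first exact: ltW.
  apply: ler_wpM2l; last exact: mom_id_le.
  by rewrite !mulr_ge0 // A_ge0.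
rewrite -momZ //; last exact: adm_id.
apply: mom_norm_le => //.
- apply: (@adm_flux _ (2 / X)); first exact: sbump_continuous.
  by move=> y _; exact: sbump_norm_le.
- by apply: admZ; exact: adm_id.
move=> y y0; have [yX|Xy] := leP y X.
  rewrite sbump_eq0l // mulr0 normr0 !mulr_ge0 ?A_ge0 //; exact: ltW.
rewrite normrM; apply: le_trans (ler_pM _ _ (speed_bound tT y0) (sbump_norm_le _ _ X0)) _ => //.
rewrite -/K.
have -> : 4 * A * K / X * y = A * (2 * y) * K * (2 / X) by ring.
apply: ler_wpM2r; first by rewrite mulr_ge0 // ltW.
apply: ler_wpM2r => //; apply: ler_wpM2l; first exact: A_ge0.
by lra.
Qed.

Lemma mom_tail_bound (phi : R -> R) X : dens phi -> 1 <= X -> `|mom phi (sstep X X)| <= mom phi id / X.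
Proof.
move=> d X1; have X0 : 0 < X by lra.
rewrite mulrC -momZ //; last exact: adm_id.
apply: mom_norm_le => //; first exact: adm_sstep1.
  by apply: admZ; exact: adm_id.
by move=> y y0; rewrite sstep_norm; exact: sstep_le_id.
Qed.

Lemma mom_flux_sub h x X t : 0 <= t < T -> 0 < h -> 0 < X ->
  mom (f t) (fun y => (a y * u t - b y) * (sbump h x y - sbump X X y)) =
  mom (f t) (fun y => (a y * u t - b y) * sbump h x y) -
  mom (f t) (fun y => (a y * u t - b y) * sbump X X y).
Proof.
move=> tT h0 X0; have dt := dens_sol tT.
rewrite -momB //; first by apply: eq_mom => y _; rewrite mulrBr.
- apply: (@adm_flux _ (2 / h)); first exact: sbump_continuous.
  by move=> y _; exact: sbump_norm_le.
- apply: (@adm_flux _ (2 / X)); first exact: sbump_continuous.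
  by move=> y _; exact: sbump_norm_le.
Qed.

Lemma le_over_eq0 (r K : R) : (forall X, 1 <= X -> `|r| <= K / X) -> r = 0.
Proof.
move=> H; apply/eqP; rewrite -normr_le0 leNgt; apply/negP => r0.
pose X := Num.max 1 (2 * `|K| / `|r|).
have X1 : 1 <= X by rewrite le_max lexx.
have X0 : 0 < X by lra.
have := H _ X1; rewrite ler_pdivlMr // => H1.
have : 2 * `|K| <= `|r| * X by rewrite [leRHS]mulrC -ler_pdivrMr // /X le_max lexx orbT.
have := ler_norm K; have := normr_ge0 K => k0 k1 k2.
have K0 : `|K| = 0 by lra.
have : 0 < `|r| * X by rewrite mulr_gt0.
lra.
Qed.

(** [sstep h x] is not compactly supported, so [sstep h x - sstep X X] is tested instead. It
    vanishes near 0, which removes the boundary term, and the contributions of [sstep X X] are of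
    order [1 / X]. *)
Lemma evolution_interior h x t : 0 < h -> 0 < x -> 0 < t < T ->
  mom (f t) (sstep h x) = mom fin (sstep h x) +
   Rintegral mu `[0, t] (fun r => mom (f r) (fun y => (a y * u r - b y) * sbump h x y)).
Proof.
move=> h0 x0 /andP[t0 tT]; apply/eqP; rewrite -subr_eq0; apply/eqP.
set fl := fun r => mom (f r) (fun y => (a y * u r - b y) * sbump h x y).
pose S := (t + T) / 2.
have ST : S < T by rewrite /S; lra.
have tS : 0 < t < S by rewrite /S; lra.
set K1 := 4 * A * (`|Phi0| + `|rho| + 1) * (rho - Phi0).
(* The three summands bound the tail of [f t], the tail of [fin] and the time integral of the flux
   near [X]. *)
apply: (@le_over_eq0 _ ((rho - Phi0) + mom fin id + K1 * t)) => X X1.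
have X0 : 0 < X by lra.
have Xi : 0 < X^-1 by rewrite invr_gt0.
pose zeta y := sstep h x y - sstep X X y.
pose dzeta y := sbump h x y - sbump X X y.
have dt : dens (f t) by apply: dens_sol; lra.
have dze y : is_derive y (1:R) zeta (dzeta y).
  by apply: is_derive_diff; exact: sstep_is_derive.
have cze : continuous dzeta.
  by move=> y; apply: cvgB; exact: sbump_continuous.
have ze0 : exists X', forall y, X' <= y -> zeta y = 0.
  exists (Num.max (X + X) (x + h)) => y; rewrite ge_max => /andP[y1 y2].
  by rewrite /zeta !sstep_eq1 // subrr.
have aze : adm zeta by apply: admB; exact: adm_sstep1.
have bze y : 0 < y -> `|dzeta y| <= 2 / h + 2 / X.
  by move=> _; apply: le_trans (ler_normB _ _) _; apply: lerD; exact: sbump_norm_le.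
have cm : {within `[0, S], continuous (fun t => mom (f t) zeta)}.
  apply: (@mom_time_continuous _ (x^-1 + X^-1)) => //; first by case: aze.
  move=> y y0; apply: le_trans (ler_normB _ _) _; rewrite mulrDl !sstep_norm.
  by apply: lerD; exact: sstep_le_id.
have cf : {within `[0, S], continuous
    (fun t => mom (f t) (fun y => (a y * u t - b y) * dzeta y))}.
  apply: (@flux_continuous _ (2 / h + 2 / X) (Num.min x X)) => //.
    by rewrite lt_min x0.
  move=> y _; rewrite le_min => /andP[y1 y2].
  by rewrite /dzeta !sbump_eq0l // subrr.
have := @weak_time zeta dzeta _ (fun=> 0) (fun t => mom (f t) zeta) S ST dze cze ze0 aze bze
  (fun _ _ _ _ _ => lexx 0) cm (fun r _ => esym (add0r _)) cf t tS.
have -> : zeta 0 = 0 by rewrite /zeta !sstep_eq0 ?subrr // ltW.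
have -> : mom (f t) zeta = mom (f t) (sstep h x) - mom (f t) (sstep X X).
  by rewrite -momB //; exact: adm_sstep1.
have -> : mom fin zeta = mom fin (sstep h x) - mom fin (sstep X X).
  by rewrite -momB //; exact: adm_sstep1.
set ft := fun r => mom (f r) (fun y => (a y * u r - b y) * sbump X X y).
have cfl S' : S' <= S -> {within `[0, S'], continuous fl}.
  by move=> S'S; apply: flux_sbump_continuous => //; lra.
have cft S' : S' <= S -> {within `[0, S'], continuous ft}.
  by move=> S'S; apply: flux_sbump_continuous => //; lra.
have tS1 : t <= S by lra.
have -> : Rintegral mu `[0, t] (fun t => mom (f t) (fun y => (a y * u t - b y) * dzeta y) +
    0 * n (u t)) = Rintegral mu `[0, t] fl - Rintegral mu `[0, t] ft.
  rewrite -RintegralB //; [|by apply: within_integrable; auto..].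
  apply: eq_Rintegral => r; rewrite inE /= in_itv /= => rt.
  by rewrite mul0r addr0 mom_flux_sub //; lra.
move=> E.
have -> : mom (f t) (sstep h x) - (mom fin (sstep h x) + Rintegral mu `[0, t] fl) =
   mom (f t) (sstep X X) - mom fin (sstep X X) - Rintegral mu `[0, t] ft.
  move: (mom (f t) (sstep h x)) (mom (f t) (sstep X X)) (mom fin (sstep h x))
    (mom fin (sstep X X)) (Rintegral mu `[0, t] fl) (Rintegral mu `[0, t] ft) E => *.
  lra.
rewrite (mulrDl _ (K1 * t)) (mulrDl (rho - Phi0)).
apply: le_trans (ler_normB _ _) _; apply: lerD.
  apply: le_trans (ler_normB _ _) _; apply: lerD; last exact: mom_tail_bound.
  apply: le_trans (mom_tail_bound dt X1) _; apply: ler_wpM2r; first exact: ltW.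
  by apply: mom_id_le; lra.
have it := within_integrable (cft t tS1).
apply: le_trans (le_normr_Rintegral _ it) _ => //.
have -> : K1 * t / X = K1 / X * t by ring.
have cK : {within `[0, t], continuous (fun=> K1 / X : R)} by exact: within_cst.
have : Rintegral mu `[0, t] (fun=> K1 / X) = K1 / X * t.
  rewrite Rintegral_cst //; congr (_ * _).
  by rewrite /= lebesgue_measure_itv /= lte_fin t0 -EFinB /= subr0.
move=> <-; apply: Rintegral_le => //.
  by apply: within_continuous_comp (cft t tS1); exact: norm_continuous.
by move=> r rt; apply: flux_tail_bound => //; lra.
Qed.

Lemma within_continuous_eq0 g S : 0 < S -> {within `[0, S], continuous g} ->
  (forall t, 0 < t < S -> g t = 0) -> g 0 = 0.
Proof.
move=> S0 cg g0; apply/eqP; rewrite -normr_le0; apply/ler_addgt0Pl => e e0.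
rewrite addr0.
have z0 : 0 <= (0 : R) < S by lra.
have [d [d0 dS H]] := within_near_right cg z0 e0.
have := H (Num.min d (S / 2)) _; rewrite g0 ?sub0r ?normrN.
  apply; rewrite add0r ge_min lexx /= le_min (ltW d0) /=; lra.
by rewrite lt_min d0 gt_min; apply/andP; split; [lra|apply/orP; right; lra].
Qed.

Lemma evolution h x t : 0 < h -> 0 < x -> 0 <= t < T ->
  mom (f t) (sstep h x) = mom fin (sstep h x) +
   Rintegral mu `[0, t] (fun r => mom (f r) (fun y => (a y * u r - b y) * sbump h x y)).
Proof.
move=> h0 x0 /andP[t0 tT].
move: t0; rewrite le_eqVlt => /predU1P[t0|t0]; last first.
  by apply: evolution_interior; rewrite ?t0.
rewrite -t0; apply/eqP; rewrite -subr_eq0; apply/eqP.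
pose S := T / 2; have S0 : 0 < S by rewrite /S; lra.
have ST : S < T by rewrite /S; lra.
set fl := fun r => mom (f r) (fun y => (a y * u r - b y) * sbump h x y).
apply: (@within_continuous_eq0 (fun t => mom (f t) (sstep h x) -
    (mom fin (sstep h x) + Rintegral mu `[0, t] fl)) S S0).
  apply: within_continuousB; first exact: mom_sstep_continuous_time.
  apply: within_continuousD; first exact: within_cst.
  by case: (primitive_derive (flux_sbump_continuous ST h0 x0)).
move=> r rS; rewrite {1}evolution_interior ?subrr //; lra.
Qed.

Lemma evolution_derive h x t : 0 < h -> 0 < x -> 0 < t < T ->
  is_derive t (1:R) (fun t => mom (f t) (sstep h x))
    (mom (f t) (fun y => (a y * u t - b y) * sbump h x y)).
Proof.
move=> h0 x0 /andP[t0 tT].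
pose S := (t + T) / 2.
have ST : S < T by rewrite /S; lra.
have tS : 0 < t < S by rewrite /S; lra.
have [_ /(_ t tS) d] := primitive_derive (flux_sbump_continuous ST h0 x0).
have := is_derive_sum (is_derive_cst (mom fin (sstep h x)) t 1) d.
rewrite add0r => D; apply: (near_eq_is_derive _ D).
have : \forall r \near t, r \in `]0, S[.
  by apply: near_in_itvoo; rewrite in_itv.
by apply: filterS => r; rewrite in_itv /= => rS; rewrite -evolution //; lra.
Qed.

Lemma evolution_init h x : 0 < h -> 0 < x -> 0 < T ->
  mom (f 0) (sstep h x) = mom fin (sstep h x).
Proof.
move=> h0 x0 T0; rewrite evolution // ?lexx //.
by rewrite set_itv1 Rintegral_set1 addr0.
Qed.

Lemma mom_cut_cvg phi : dens phi -> mom phi (cut k) @[k --> \oo] --> mom phi (cst 1).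
Proof.
move=> d; apply: (@mom_cvg _ _ _ _ 1) => //.
- exact: measurable_cut.
- by move=> k x x0; have /andP[c0 c1] := cut01 k x; rewrite ger0_norm //; lra.
- exact: cut_cvg.
Qed.

(** The derivative of the truncated mass is the flux through a bump supported in
    [(1/(k+1), 2/(k+1))]. Once [2/(k+1) <= x0] the speed is nonnegative there, so the truncated
    masses are nondecreasing in time, and so is their limit. *)
Lemma mass_nondecreasing S x0 : S < T -> 0 < x0 ->
  (forall t y, 0 <= t <= S -> 0 < y <= x0 -> b y <= a y * u t) ->
  forall s t, 0 <= s -> s <= t -> t <= S -> mom (f s) (cst 1) <= mom (f t) (cst 1).
Proof.
move=> ST x00 inflow s t s0 st tS.
have ds : dens (f s) by apply: dens_sol; lra.
have dt : dens (f t) by apply: dens_sol; lra.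
apply: (ler_cvg_to (mom_cut_cvg ds) (mom_cut_cvg dt)).
have /cvgr_le /(_ (x0 / 2)) := @cvg_harmonic R.
move=> /(_ ltac:(by rewrite divr_gt0)).
apply: filterS => k /= Hk; have k0 := kinv_gt0 k.
pose fl r := mom (f r) (fun y => (a y * u r - b y) * sbump k.+1%:R^-1 k.+1%:R^-1 y).
apply: (@is_derive_nondecreasing _ (fun t => mom (f t) (cut k)) fl 0 S) => //.
- exact: mom_sstep_continuous_time.
- by move=> r rS; apply: evolution_derive => //; lra.
- move=> r rS; have rT : 0 <= r < T by lra.
  apply: mom_ge0; first exact: dens_sol.
    apply: (@adm_flux _ (2 / k.+1%:R^-1)); first exact: sbump_continuous.
    by move=> y _; exact: sbump_norm_le.
  move=> y y0; have [yx|xy] := leP y x0.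
    apply: mulr_ge0; last exact: sbump_ge0.
    by rewrite subr_ge0; apply: inflow; [lra|rewrite y0].
  rewrite sbump_supp ?mulr0 // => /andP[_ yk].
  have h : k.+1%:R^-1 + k.+1%:R^-1 <= x0 by rewrite [leRHS]splitr lerD.
  by have := lt_trans xy (lt_le_trans yk h); rewrite ltxx.
Qed.

(* Under the inflow condition nothing leaves the domain at 0, so that the boundary
   term of the weak formulation is the only source of mass. *)
Lemma mass_identity S x0 : S < T -> 0 < x0 ->
  (forall t y, 0 <= t <= S -> 0 < y <= x0 -> b y <= a y * u t) ->
  forall t, 0 <= t < S ->
  mom (f t) (cst 1) = mom fin (cst 1) + Rintegral mu `[0, t] (fun r => n (u r)).
Proof.
move=> ST x00 inflow t /andP[t0 tS].
move: t0; rewrite le_eqVlt => /predU1P[t0|t0].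
  (* At time 0 all truncated masses of [f 0] and [fin] agree, hence so do their limits. *)
  rewrite -t0 set_itv1 Rintegral_set1 addr0.
  have T0 : 0 < T by lra.
  have d0 : dens (f 0) by apply: dens_sol; rewrite lexx.
  have c1 := mom_cut_cvg d0; have := mom_cut_cvg dfin.
  have -> : (fun k => mom fin (cut k)) = (fun k => mom (f 0) (cut k)).
    by apply/funext => k; rewrite evolution_init // kinv_gt0.
  by move=> /(cvg_unique _ c1) ->.
(* A test function equal to 1 at 0 brings in the boundary term. Its moment is the mass, which is
   monotone, minus a tail, which is continuous. *)
pose zeta (y : R) : R := 1 - sstep 1 1 y.
pose dzeta (y : R) : R := - sbump 1 1 y.
have o0 : 0 < 1 :> R by [].
have dze y : is_derive y (1:R) zeta (dzeta y).
  have := is_derive_diff (is_derive_cst (1:R) y 1) (sstep_is_derive 1 y o0).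
  by rewrite sub0r.
have cze : continuous dzeta.
  by move=> y; apply: cvgN; exact: sbump_continuous.
have ze0 : exists X', forall y, X' <= y -> zeta y = 0.
  by exists (1 + 1) => y y2; rewrite /zeta sstep_eq1 // subrr.
have a1 := adm_cst (1 : R).
have aze : adm zeta by apply: admB => //; exact: adm_sstep1.
have bze y : 0 < y -> `|dzeta y| <= 2 / 1.
  by move=> _; rewrite normrN; exact: sbump_norm_le.
have nd := mass_nondecreasing ST x00 inflow.
have cc : {within `[0, S], continuous (fun t => - mom (f t) (sstep 1 1))}.
  by move=> r; apply: cvgN; exact: mom_sstep_continuous_time.
have mPc r : 0 <= r <= S -> mom (f r) zeta = mom (f r) (cst 1) + - mom (f r) (sstep 1 1).
  by move=> rS; rewrite -momB //; [apply: dens_sol; lra|exact: adm_sstep1].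
have flN r : 0 <= r <= S -> mom (f r) (fun y => (a y * u r - b y) * dzeta y) =
    - mom (f r) (fun y => (a y * u r - b y) * sbump 1 1 y).
  move=> rS; rewrite -mulN1r -momZ; last 2 first.
  - by apply: dens_sol; lra.
  - apply: (@adm_flux _ (2 / 1)); first exact: sbump_continuous.
    by move=> y _; exact: sbump_norm_le.
  by apply: eq_mom => y _; rewrite /dzeta; ring.
have cfl := flux_sbump_continuous ST o0 o0.
have cfl' : {within `[0, S], continuous
    (fun t => mom (f t) (fun y => (a y * u t - b y) * dzeta y))}.
  apply: (@eq_within _ _ (fun r => - mom (f r) (fun y => (a y * u r - b y) * sbump 1 1 y))).
    by move=> r; rewrite /= in_itv /= => rS; rewrite flN.
  by move=> r; apply: cvgN; exact: cfl.
have tS' : 0 < t < S by rewrite t0.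
have := weak_time ST dze cze ze0 aze bze nd cc mPc cfl' tS'.
have sub g : {within `[0, S], continuous g} -> {within `[0, t], continuous g}.
  by apply: continuous_subspaceW; apply: subset_itv; rewrite bnd_simp // ltW.
have -> : zeta 0 = 1 by rewrite /zeta sstep_eq0 // subr0.
have -> : mom fin zeta = mom fin (cst 1) - mom fin (sstep 1 1).
  by rewrite -momB //; exact: adm_sstep1.
have -> : Rintegral mu `[0, t] (fun r => mom (f r) (fun y => (a y * u r - b y) * dzeta y) +
    1 * n (u r)) = Rintegral mu `[0, t] (fun r => n (u r)) -
   Rintegral mu `[0, t] (fun r => mom (f r) (fun y => (a y * u r - b y) * sbump 1 1 y)).
  rewrite -RintegralB //.
  - apply: eq_Rintegral => r; rewrite inE /= in_itv /= => rt.
    by rewrite flN; [rewrite mul1r addrC|lra].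
  - by apply: within_integrable; apply: sub; exact: n_continuous.
  - by apply: within_integrable; exact: sub.
rewrite mPc; last by lra.
have tT : 0 <= t < T by lra.
(* Adding the evolution of the tail cancels the flux through the support of [sbump 1 1] and
   completes [zeta] to the constant 1. *)
have := evolution o0 o0 tT; lra.
Qed.

End Solution.

(** * The energy inequality *)

Section SmoothAbs.
Variable R : realType.
Implicit Types e z : R.

(** A differentiable majorant of the absolute value, exceeding it by at most [e] and with slope at
    most 1. As a majorant it controls the integral of [|D|]; the price is an initial energy equal to
    [e] times the integral of the weight. *)
Definition sabs e z : R := Num.sqrt (z ^+ 2 + e ^+ 2).

Lemma sabs_arg_gt0 e z : 0 < e -> 0 < z ^+ 2 + e ^+ 2.
Proof. by move=> e0; rewrite ltr_wpDl ?sqr_ge0 // exprn_gt0. Qed.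

Lemma sabs_gt0 e z : 0 < e -> 0 < sabs e z.
Proof. by move=> e0; rewrite sqrtr_gt0 sabs_arg_gt0. Qed.

Lemma sabs_ge e z : `|z| <= sabs e z.
Proof. by rewrite -sqrtr_sqr ler_sqrt ?addr_ge0 ?sqr_ge0 // lerDl sqr_ge0. Qed.

Lemma sabs_le e z : 0 < e -> sabs e z <= `|z| + e.
Proof.
move=> e0; have z0 := normr_ge0 z.
have H : 0 <= `|z| + e by rewrite addr_ge0 // ltW.
rewrite -[leRHS](ger0_norm H) -[leRHS]sqrtr_sqr ler_sqrt ?sqr_ge0 // sqrrD real_normK ?num_real //.
by rewrite -addrA lerD2l lerDr mulrn_wge0 // mulr_ge0 // ltW.
Qed.

Lemma sabs0 e : 0 < e -> sabs e 0 = e.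
Proof. by move=> e0; rewrite /sabs expr0n add0r sqrtr_sqr gtr0_norm. Qed.

Lemma sabs_is_derive e z : 0 < e -> is_derive z (1:R) (sabs e) (z / sabs e z).
Proof.
move=> e0.
have d1 : is_derive z (1:R) (fun z => z ^+ 2 + e ^+ 2) (z + z).
  have := is_derive_sum (is_derive_prod (is_derive_id z 1) (is_derive_id z 1))
    (is_derive_cst (e ^+ 2) z 1).
  by rewrite mulr1 mul1r addr0.
have d2 := is_derive1_sqrt (sabs_arg_gt0 z e0).
have H := @is_derive_compose R (@Num.sqrt R) (fun z => z ^+ 2 + e ^+ 2) z _ _ d2 d1.
apply: (is_derive_eq H).
rewrite -/(sabs e z); have := sabs_gt0 z e0; move: (sabs e z) => s s0.
by field; rewrite gt_eqF.
Qed.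

Lemma sabs_derive_le1 e z : 0 < e -> `|z / sabs e z| <= 1.
Proof.
move=> e0; rewrite normrM normfV (gtr0_norm (sabs_gt0 z e0)).
by rewrite ler_pdivrMr ?sabs_gt0 // mul1r sabs_ge.
Qed.

Lemma sabs_continuous e : 0 < e -> continuous (sabs e).
Proof.
move=> e0 z; apply: differentiable_continuous; apply/derivable1_diffP.
by case: (sabs_is_derive z e0).
Qed.

Lemma sabs_derive_continuous e : 0 < e -> continuous (fun z => z / sabs e z).
Proof.
move=> e0 z; apply: cvgM; first exact: cvg_id.
by apply: cvgV; [rewrite gt_eqF ?sabs_gt0|exact: sabs_continuous].
Qed.

End SmoothAbs.

Section Lipschitz.
Variable R : realType.
Implicit Types (g : R -> R) (s t K S : R).

(** Both [K * t - g t] and [K * t + g t] are nondecreasing. *)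
Lemma is_derive_lip g (g' : R -> R) K (A B : R) : {within `[A, B], continuous g} ->
  (forall t, A < t < B -> is_derive t (1:R) g (g' t)) ->
  (forall t, A < t < B -> `|g' t| <= K) ->
  forall s t, A <= s <= B -> A <= t <= B -> `|g t - g s| <= K * `|t - s|.
Proof.
move=> cg dg gK.
have lin : continuous (fun s : R => K * s).
  by move=> s; apply: cvgM; [exact: cvg_cst|exact: cvg_id].
have dl t : is_derive t (1:R) (fun s : R => K * s) K.
  by have := is_derive_scale K (is_derive_id t (1:R)); rewrite mulr1.
have H s t : A <= s -> s <= t -> t <= B -> `|g t - g s| <= K * `|t - s|.
  move=> s0 st tS; rewrite (ger0_norm (_ : 0 <= t - s)) ?subr_ge0 //.
  have h1 : K * s - g s <= K * t - g t.
    apply: (@is_derive_nondecreasing _ (fun t => K * t - g t) (fun t => K - g' t) A B) => //.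
    - by apply: within_continuousB => //; exact: within_continuousW.
    - by move=> x xS; apply: is_derive_diff => //; exact: dg.
    - by move=> x xS; rewrite subr_ge0; apply: le_trans (gK _ xS); exact: ler_norm.
  have h2 : K * s + g s <= K * t + g t.
    apply: (@is_derive_nondecreasing _ (fun t => K * t + g t) (fun t => K + g' t) A B) => //.
    - by apply: within_continuousD => //; exact: within_continuousW.
    - by move=> x xS; apply: is_derive_sum => //; exact: dg.
    - move=> x xS; have := gK _ xS; rewrite ler_norml => /andP[h _]; lra.
  by rewrite ler_norml mulrBr; apply/andP; split; lra.
move=> s t /andP[s0 sS] /andP[t0 tS]; have [st|ts] := leP s t; first exact: H.
by rewrite distrC [`|t - s|]distrC; apply: H => //; exact: ltW.
Qed.

Lemma lip_within g K (A B : R) :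
  (forall s t, A <= s <= B -> A <= t <= B -> `|g t - g s| <= K * `|t - s|) ->
  {within `[A, B], continuous g}.
Proof.
move=> H; apply/subspace_continuousP => t tI; apply/cvgrPdist_le => e e0.
have K1 : 0 < `|K| + 1 by rewrite ltr_wpDl.
have e1 : 0 < e / (`|K| + 1) by rewrite divr_gt0.
have /cvgrPdist_le/(_ _ e1) : y @[y --> t] --> t by exact: cvg_id.
rewrite near_withinE; apply: filterS => r + rI.
rewrite ler_pdivlMr // => he.
move: tI rI; rewrite /= !in_itv /= => tI rI.
apply: le_trans (H _ _ rI tI) _; apply: le_trans he; rewrite mulrC.
by apply: ler_wpM2l => //; apply: le_trans (ler_norm _) _; rewrite lerDl.
Qed.

End Lipschitz.

(** * The weighted energy of a difference of smoothed tails *)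

Section Energy.
Variable R : realType.
Notation mu := (@lebesgue_measure R).
Notation HL := (@halfline R).
Variables (a b da db : R -> R).
Hypothesis adma : adm a.
Hypothesis admb : adm b.
Hypothesis a_ge0 : forall x, 0 < x -> 0 <= a x.

(** What the energy argument retains of a solution: bounds uniform in time, continuity of moments
    and the evolution of smoothed tails. The bounds [U] and [M] are parameters so that two solutions
    can share them. *)
Record flow (S U M : R) (u fin : R -> R) (f : R -> R -> R) : Prop := Flow {
  flow_dens : forall t, 0 <= t <= S -> dens (f t);
  flow_mass : forall t, 0 <= t <= S -> mom (f t) (cst 1) <= M;
  flow_mean : forall t, 0 <= t <= S -> mom (f t) id <= M;
  flow_u : forall t, 0 <= t <= S -> `|u t| <= U;
  flow_continuous : forall (g : R -> R) (C : R), measurable_fun HL g ->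
    (forall x, 0 < x -> `|g x| <= C * x) ->
    {within `[0, S], continuous (fun t => mom (f t) g)};
  flow_derive : forall h x t : R, 0 < h -> 0 < x -> 0 < t < S ->
    is_derive t (1:R) (fun t => mom (f t) (sstep h x))
      (mom (f t) (fun y => (a y * u t - b y) * sbump h x y));
  flow_init : forall h x : R, 0 < h -> 0 < x ->
    mom (f 0) (sstep h x) = mom fin (sstep h x)
}.

Variables (S U M : R) (u1 u2 fin : R -> R) (f1 f2 : R -> R -> R).
Hypothesis fl1 : flow S U M u1 fin f1.
Hypothesis fl2 : flow S U M u2 fin f2.
Variables (h eta al ga : R).
Hypothesis h0 : 0 < h.
Hypothesis eta0 : 0 < eta.
Hypothesis al0 : 0 < al.
Hypothesis alga : al < ga.
Hypothesis S0 : 0 < S.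

Implicit Types s t x y : R.

Definition tail (f : R -> R -> R) h s x := mom (f s) (sstep h x).
Let D s x := tail f1 h s x - tail f2 h s x.
Let v (u : R -> R) s x := a x * u s - b x.
Let fluxm (f : R -> R -> R) (u : R -> R) s x := mom (f s) (fun y => v u s y * sbump h x y).
Let dD s x := fluxm f1 u1 s x - fluxm f2 u2 s x.

Lemma sstep_continuous_flow f u : flow S U M u fin f -> forall x, 0 < x ->
  {within `[0, S], continuous (fun t => mom (f t) (sstep h x))}.
Proof.
move=> fl x x0; apply: (flow_continuous fl (C := x^-1)).
  by apply: continuous_measurable_HL; exact: sstep_continuous.
move=> y y0; have /andP[s0 s1] := sstep01 h x y; rewrite ger0_norm //.
have [yx|xy] := leP y x.
  by rewrite sstep_eq0 // mulr_ge0 // ?invr_ge0 ltW.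
by apply: (le_trans s1); rewrite mulrC ler_pdivlMr // mul1r ltW.
Qed.

Lemma adm_v u s : adm (v u s).
Proof. by apply: admB admb; have := admZ (u s) adma; under eq_fun do rewrite mulrC. Qed.

Lemma adm_v_sbump u s x : adm (fun y => v u s y * sbump h x y).
Proof. by have := adm_sbump x h0 (adm_v u s); under eq_fun do rewrite mulrC. Qed.

Lemma v_bound u s : exists2 K : R, 0 <= K &
  forall f fin s, flow S U M u fin f -> 0 <= s <= S -> forall x, 0 < x -> `|v u s x| <= K * (1 + x).
Proof.
have [_ [A hA]] := adma; have [_ [B hB]] := admb.
exists (`|A| * `|U| + `|B|); first by rewrite addr_ge0 // mulr_ge0.
move=> f fin' {}s fl sS x x0; apply: le_trans (ler_normB _ _) _; rewrite mulrDl.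
apply: lerD.
  rewrite normrM -mulrA [_ * (1 + x)]mulrC mulrA; apply: ler_pM => //.
    apply: le_trans (hA _ x0) _; apply: ler_wpM2r; first lra.
    exact: ler_norm.
  by apply: le_trans (flow_u fl sS) _; exact: ler_norm.
apply: le_trans (hB _ x0) _; apply: ler_wpM2r; first lra.
exact: ler_norm.
Qed.

(** For fixed [h] the bump is at most [2 / h]. The bound may degenerate with [h]: it only provides
    the domination for differentiating the energy in time and its Lipschitz continuity. *)
Lemma fluxm_bound f u : flow S U M u fin f -> exists2 K : R, 0 <= K &
  forall s x, 0 <= s <= S -> `|fluxm f u s x| <= K.
Proof.
move=> fl; have [K K0 HK] := v_bound u 0.
have h2 : 0 <= 2 / h by rewrite divr_ge0 // ltW.
have M0 : 0 <= M.
  have sS : 0 <= (0 : R) <= S by rewrite lexx ltW.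
  apply: le_trans (flow_mass fl sS); apply: mom_ge0 => //; first exact: (flow_dens fl sS).
  exact: adm_cst.
exists (2 / h * K * (M + M)); first by apply: mulr_ge0; [apply: mulr_ge0|apply: addr_ge0].
move=> s x sS; have ds := flow_dens fl sS.
have adm1 : adm (fun y : R => 1 + y) by apply: admD; [exact: adm_cst|exact: adm_id].
apply: le_trans (_ : 2 / h * K * mom (f s) (fun y => 1 + y) <= _).
  rewrite -momZ //; apply: mom_norm_le => //; first exact: adm_v_sbump.
    exact: admZ.
  move=> y y0; rewrite normrM mulrC -[leRHS]mulrA; apply: ler_pM => //.
    by rewrite ger0_norm ?sbump_ge0 ?sbump_le.
  exact: (HK _ _ _ fl).
apply: ler_wpM2l; first by rewrite mulr_ge0.
rewrite momD //; [|exact: adm_cst|exact: adm_id].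
by apply: lerD; [exact: (flow_mass fl sS)|exact: (flow_mean fl sS)].
Qed.

(** The weight is kept abstract because the energy is used twice, near 0 and far from it. Two
    conditions matter: [wC] says that the derivative of [w] times the speed is at most [C * w], and
    [wK] controls the effect of [u1 - u2], whose coefficient is [a] averaged over the smoothing
    window. *)
Variables (w dw : R -> R) (L W K C : R).
Hypothesis dwP : forall x, al <= x <= ga -> is_derive x (1:R) w (dw x).
Hypothesis daP : forall x, al <= x <= ga -> is_derive x (1:R) a (da x).
Hypothesis dbP : forall x, al <= x <= ga -> is_derive x (1:R) b (db x).
Hypothesis cdw : {within `[al, ga], continuous dw}.
Hypothesis cda : {within `[al, ga], continuous da}.
Hypothesis cdb : {within `[al, ga], continuous db}.
Hypothesis w_ge0 : forall x, al <= x <= ga -> 0 <= w x.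
Hypothesis wW : forall x, al <= x <= ga -> w x <= W.
Hypothesis L_ge0 : 0 <= L.
Hypothesis lipa : forall x y, al <= x -> x <= y -> `|a y - a x| <= L * (y - x).
Hypothesis lipb : forall x y, al <= x -> x <= y -> `|b y - b x| <= L * (y - x).
Hypothesis K_ge0 : 0 <= K.
Hypothesis wK : forall x y, al <= x <= ga -> x <= y <= x + h -> w x * a y <= K * (1 + y).
Hypothesis wC : forall s x, 0 < s < S -> al <= x <= ga ->
  dw x * v u1 s x + w x * (da x * u1 s - db x) <= C * w x.

Let e s := Rintegral mu `[al, ga] (fun x => w x * sabs eta (D s x)).

Lemma tail_x_derive f u s x : flow S U M u fin f -> 0 <= s <= S ->
  is_derive x (1:R) (tail f h s) (- mom (f s) (sbump h x)).
Proof. by move=> fl sS; apply: mom_sstep_is_derive1 => //; exact: (flow_dens fl sS). Qed.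

Lemma adm_sbump1 x : adm (sbump h x).
Proof.
by have := adm_sbump x h0 (adm_cst (1 : R)); under eq_fun do rewrite mulr1.
Qed.

Lemma mom_sbump1_continuous phi : dens phi -> continuous (fun x => mom phi (sbump h x)).
Proof.
move=> d; have := mom_sbump_continuous d (adm_cst (1:R)) h0.
by under eq_fun do under eq_fun do rewrite mulr1.
Qed.

Lemma D_x_derive s x : 0 <= s <= S ->
  is_derive x (1:R) (D s) (- mom (f1 s) (sbump h x) + mom (f2 s) (sbump h x)).
Proof.
move=> sS; have := is_derive_diff (tail_x_derive x fl1 sS) (tail_x_derive x fl2 sS).
by rewrite opprK.
Qed.

Lemma cw : {within `[al, ga], continuous w}.
Proof. exact: within_is_derive dwP. Qed.

Lemma D_x_continuous s : 0 <= s <= S -> {within `[al, ga], continuous (D s)}.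
Proof. by move=> sS; apply: within_is_derive => x _; exact: D_x_derive. Qed.

Lemma energy_integrand_continuous s : 0 <= s <= S ->
  {within `[al, ga], continuous (fun x => w x * sabs eta (D s x))}.
Proof.
move=> sS; apply: within_continuousM; first exact: cw.
by apply: within_continuous_comp; [exact: sabs_continuous|exact: D_x_continuous].
Qed.

Lemma D_s_derive s x : 0 < s < S -> 0 < x ->
  is_derive s (1:R) (fun s => D s x) (dD s x).
Proof.
move=> sS x0; apply: is_derive_diff; first exact: (flow_derive fl1).
exact: (flow_derive fl2).
Qed.

Lemma dD_bound : exists2 B : R, 0 <= B & forall s x, 0 <= s <= S -> `|dD s x| <= B.
Proof.
have [K1 K10 H1] := fluxm_bound fl1; have [K2 K20 H2] := fluxm_bound fl2.
exists (K1 + K2); first by rewrite addr_ge0.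
by move=> s x sS; apply: le_trans (ler_normB _ _) _; apply: lerD; auto.
Qed.

Lemma sabsD_s_derive s x : 0 < s < S -> 0 < x ->
  is_derive s (1:R) (fun s => w x * sabs eta (D s x))
    (w x * (D s x / sabs eta (D s x) * dD s x)).
Proof.
move=> sS x0; apply: is_derive_scale.
exact: is_derive_compose (sabs_is_derive _ eta0) (D_s_derive sS x0).
Qed.

Lemma itv_pos x : al <= x <= ga -> 0 < x.
Proof. by move=> /andP[alx _]; exact: lt_le_trans alx. Qed.

Lemma energy_derive s : 0 < s < S -> is_derive s (1:R) e
  (Rintegral mu `[al, ga] (fun x => w x * (D s x / sabs eta (D s x) * dD s x))).
Proof.
move=> sS; have [B B0 HB] := dD_bound.
have W0 : 0 <= W.
  have aI : al <= al <= ga by rewrite lexx ltW.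
  exact: le_trans (w_ge0 aI) (wW aI).
have Is : `]0%R, S[%classic s by rewrite /= in_itv.
have intf r : `]0%R, S[%classic r ->
    mu.-integrable `[al, ga] (EFin \o (fun x => w x * sabs eta (D r x))).
  rewrite /= in_itv /= => rS; apply: within_integrable.
  by apply: energy_integrand_continuous; lra.
have der r x : `]0%R, S[%classic r -> `[al, ga]%classic x ->
    derivable (fun s => w x * sabs eta (D s x)) r 1.
  rewrite /= !in_itv /= => rS xI.
  by case: (sabsD_s_derive rS (itv_pos xI)).
have G0 (y : R) : 0 <= (cst (W * B) : R -> R) y by rewrite mulr_ge0.
have iG : mu.-integrable `[al, ga] (EFin \o cst (W * B)).
  by apply: within_integrable; exact: within_cst.
have dE r x : 0 < r < S -> al <= x <= ga ->
    partial1of2 (fun s x => w x * sabs eta (D s x)) r x =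
    w x * (D r x / sabs eta (D r x) * dD r x).
  move=> rS xI; rewrite partial1of2E.
  by case: (sabsD_s_derive rS (itv_pos xI)).
have Gub r x : `]0%R, S[%classic r -> `[al, ga]%classic x ->
    `|partial1of2 (fun s x => w x * sabs eta (D s x)) r x| <= cst (W * B) x.
  rewrite /= !in_itv /= => rS xI; rewrite dE // normrM; apply: ler_pM => //.
    by rewrite ger0_norm; [exact: wW|exact: w_ge0].
  rewrite normrM -[B]mul1r; apply: ler_pM => //; first exact: sabs_derive_le1.
  by apply: HB; lra.
apply: DeriveDef.
  apply: (derivable_under_integral _ Is intf der G0 iG Gub); exact: measurable_itv.
rewrite -derive1E (differentiation_under_integral _ Is intf der G0 iG Gub); last exact: measurable_itv.
apply: eq_Rintegral => x; rewrite inE /= in_itv /= => xI.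
exact: dE.
Qed.

(** The evolution is differentiable at interior times only. The endpoints are reached because [D] is
    Lipschitz in time, uniformly in [x], and [sabs] has slope at most 1. *)
Lemma energy_continuous : {within `[0, S], continuous e}.
Proof.
have [B B0 HB] := dD_bound.
have Dlip x : 0 < x -> forall s t, 0 <= s <= S -> 0 <= t <= S ->
    `|D t x - D s x| <= B * `|t - s|.
  move=> x0; apply: (@is_derive_lip _ (fun s => D s x) (fun s => dD s x)).
  - by apply: within_continuousB; [exact: (sstep_continuous_flow fl1)|exact: (sstep_continuous_flow fl2)].
  - by move=> t tS; exact: D_s_derive.
  - by move=> t tS; apply: HB; lra.
have slip z z' : `|sabs eta z' - sabs eta z| <= 1 * `|z' - z|.
  pose A := Num.min z z' - 1; pose B' := Num.max z z' + 1.
  have m1 : Num.min z z' <= z by rewrite ge_min lexx.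
  have m2 : Num.min z z' <= z' by rewrite ge_min lexx orbT.
  have m3 : z <= Num.max z z' by rewrite le_max lexx.
  have m4 : z' <= Num.max z z' by rewrite le_max lexx orbT.
  apply: (@is_derive_lip _ (sabs eta) (fun z => z / sabs eta z) 1 A B').
  - by apply: within_continuousW; exact: sabs_continuous.
  - by move=> t _; exact: sabs_is_derive.
  - by move=> t _; exact: sabs_derive_le1.
  - by rewrite /A /B'; lra.
  - by rewrite /A /B'; lra.
have iw := within_integrable cw.
apply: (@lip_within _ _ (Rintegral mu `[al, ga] w * B)) => s t sS tS.
have i1 := within_integrable (energy_integrand_continuous tS).
have i2 := within_integrable (energy_integrand_continuous sS).
rewrite /e -RintegralB // -mulrA mulrC -RintegralZl //.
have cdiff : {within `[al, ga], continuous
    (fun x => w x * sabs eta (D t x) - w x * sabs eta (D s x))}.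
  by apply: within_continuousB; exact: energy_integrand_continuous.
apply: le_trans (le_normr_Rintegral _ (within_integrable cdiff)) _ => //.
apply: Rintegral_le.
- by apply: within_continuous_comp cdiff; exact: norm_continuous.
- by apply: within_continuousM; [exact: within_cst|exact: cw].
move=> x xI; rewrite -mulrBr normrM ger0_norm; last exact: w_ge0.
rewrite mulrC; apply: ler_wpM2r; first exact: w_ge0.
apply: le_trans (slip _ _) _; rewrite mul1r; apply: Dlip => //; exact: itv_pos xI.
Qed.


(** Minus a primitive in [x] of the moment that multiplies [|u1 - u2| * K]. It is bounded by [2 * M]
    for every [h], although the bump in that moment has size [1 / h]. *)
Let lin s x := mom (f2 s) (fun y => sstep h x y * (1 + y)).

Lemma adm1y : adm (fun y : R => 1 + y).
Proof. by apply: admD; [exact: adm_cst|exact: adm_id]. Qed.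

Lemma v_lip s x y : 0 <= s <= S -> al <= x -> x <= y <= x + h ->
  `|v u1 s y - v u1 s x| <= L * (U + 1) * h.
Proof.
move=> sS alx /andP[xy yh].
have -> : v u1 s y - v u1 s x = (a y - a x) * u1 s - (b y - b x) by rewrite /v; ring.
apply: le_trans (ler_normB _ _) _.
have h1 : y - x <= h by lra.
have -> : L * (U + 1) * h = L * h * U + L * h by ring.
apply: lerD.
  rewrite normrM; apply: ler_pM => //; last exact: (flow_u fl1).
  by apply: le_trans (lipa alx xy) _; exact: ler_wpM2l.
by apply: le_trans (lipb alx xy) _; exact: ler_wpM2l.
Qed.

Lemma commutator_bound phi s x : dens phi -> 0 <= s <= S -> al <= x ->
  `|mom phi (fun y => (v u1 s y - v u1 s x) * sbump h x y)| <=
   L * (U + 1) * h * mom phi (sbump h x).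
Proof.
move=> d sS alx.
rewrite -momZ //; last exact: adm_sbump1.
apply: mom_norm_le => //.
- have := adm_sbump x h0 (admB (adm_v u1 s) (adm_cst (v u1 s x))).
  by under eq_fun do rewrite mulrC.
- by apply: admZ; exact: adm_sbump1.
move=> y y0; rewrite normrM (ger0_norm (sbump_ge0 _ _ h0)).
have [/andP[h1 h2]|hxy] := boolP (x < y < x + h).
  by apply: ler_wpM2r; [exact: sbump_ge0|apply: v_lip => //; rewrite !ltW].
by rewrite sbump_supp ?mulr0 //; exact/negP.
Qed.

Lemma adm_a_sbump x : adm (fun y => a y * sbump h x y).
Proof. by have := adm_sbump x h0 adma; under eq_fun do rewrite mulrC. Qed.

Lemma adm_lin_sbump x : adm (fun y => sbump h x y * (1 + y)).
Proof. by apply: adm_sbump => //; exact: adm1y. Qed.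

Lemma remainder_identity s x : 0 <= s <= S ->
  dD s x = - (v u1 s x * (- mom (f1 s) (sbump h x) + mom (f2 s) (sbump h x))) +
  (mom (f1 s) (fun y => (v u1 s y - v u1 s x) * sbump h x y) -
   mom (f2 s) (fun y => (v u1 s y - v u1 s x) * sbump h x y) +
   (u1 s - u2 s) * mom (f2 s) (fun y => a y * sbump h x y)).
Proof.
move=> sS; have d1 := flow_dens fl1 sS; have d2 := flow_dens fl2 sS.
have ak1 := adm_sbump1 x.
have E phi : dens phi -> mom phi (fun y => (v u1 s y - v u1 s x) * sbump h x y) =
    mom phi (fun y => v u1 s y * sbump h x y) - v u1 s x * mom phi (sbump h x).
  move=> d; rewrite -momZ // -momB //; [|exact: adm_v_sbump|exact: admZ].
  by apply: eq_mom => y _; ring.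
have -> : (u1 s - u2 s) * mom (f2 s) (fun y => a y * sbump h x y) =
    mom (f2 s) (fun y => v u1 s y * sbump h x y) - mom (f2 s) (fun y => v u2 s y * sbump h x y).
  rewrite -momZ //; last exact: adm_a_sbump.
  rewrite -momB //; [|exact: adm_v_sbump..].
  by apply: eq_mom => y _; rewrite /v; ring.
rewrite !E // /dD /fluxm; ring.
Qed.

(* The right-hand side isolates an exact [x]-derivative; the remaining terms are
   the commutator between smoothing and the speed, and the effect of [u1 - u2]. *)
Lemma integrand_bound s x : 0 < s < S -> al <= x <= ga ->
  w x * (D s x / sabs eta (D s x) * dD s x) <=
  - ((dw x * v u1 s x + w x * (da x * u1 s - db x)) * sabs eta (D s x) +
     w x * v u1 s x * (D s x / sabs eta (D s x) *
       (- mom (f1 s) (sbump h x) + mom (f2 s) (sbump h x)))) +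
  W * (L * (U + 1) * h) * (mom (f1 s) (sbump h x) + mom (f2 s) (sbump h x)) +
  `|u1 s - u2 s| * K * mom (f2 s) (fun y => sbump h x y * (1 + y)) +
  C * (w x * sabs eta (D s x)).
Proof.
move=> sS xI; have sS' : 0 <= s <= S by lra.
have [alx xga] := andP xI.
have d1 := flow_dens fl1 sS'; have d2 := flow_dens fl2 sS'.
have L'0 : 0 <= L * (U + 1) * h.
  have U0 : 0 <= U by apply: le_trans (flow_u fl1 sS').
  by rewrite !mulr_ge0 // ?addr_ge0 // ltW.
set N1 := mom (f1 s) (sbump h x); set N2 := mom (f2 s) (sbump h x).
have N10 : 0 <= N1.
  by apply: mom_ge0 => //; [exact: adm_sbump1|move=> y _; exact: sbump_ge0].
have N20 : 0 <= N2.
  by apply: mom_ge0 => //; [exact: adm_sbump1|move=> y _; exact: sbump_ge0].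
have w0 := w_ge0 xI; have wW' := wW xI.
(* The transport term becomes an exact derivative once the derivative of [w * v] times [sabs] is
   subtracted; adding it back costs at most [C] times the energy density. *)
have hC : (dw x * v u1 s x + w x * (da x * u1 s - db x)) * sabs eta (D s x) <=
    C * (w x * sabs eta (D s x)).
  by rewrite mulrA; apply: ler_wpM2r; [rewrite ltW // sabs_gt0|exact: wC].
have b1 := commutator_bound d1 sS' alx; have b2 := commutator_bound d2 sS' alx.
have hq : w x * mom (f2 s) (fun y => a y * sbump h x y) <=
    K * mom (f2 s) (fun y => sbump h x y * (1 + y)).
  rewrite -momZ //; last exact: adm_a_sbump.
  rewrite -momZ //; last exact: adm_lin_sbump.
  apply: mom_le => //; first by apply: admZ; exact: adm_a_sbump.
    by apply: admZ; exact: adm_lin_sbump.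
  move=> y y0; rewrite (mulrA (w x)) [_ * (1 + y)]mulrC (mulrA K).
  have [/andP[h1 h2]|hxy] := boolP (x < y < x + h).
    by apply: ler_wpM2r; [exact: sbump_ge0|apply: wK => //; rewrite !ltW].
  by rewrite sbump_supp ?mulr0 //; exact/negP.
have Ma0 : 0 <= mom (f2 s) (fun y => a y * sbump h x y).
  apply: mom_ge0 => //; first exact: adm_a_sbump.
  by move=> y y0; apply: mulr_ge0; [exact: a_ge0|exact: sbump_ge0].
have sg := sabs_derive_le1 (D s x) eta0.
rewrite remainder_identity //.
move: sg hC b1 b2 hq Ma0; rewrite -/N1 -/N2.
move: (mom (f1 s) _) (mom (f2 s) (fun y => (v u1 s y - v u1 s x) * sbump h x y))
  (mom (f2 s) (fun y => a y * sbump h x y))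
  (mom (f2 s) (fun y => sbump h x y * (1 + y))) (sabs eta (D s x))
  (D s x / sabs eta (D s x)) => r1 r2 ma ml sb sg sg1 hC b1 b2 hq ma0.
set L' := L * (U + 1) * h in L'0 b1 b2 *.
set q := u1 s - u2 s.
have hr : `|r1 - r2 + q * ma| <= L' * (N1 + N2) + `|q| * ma.
  apply: le_trans (ler_normD _ _) _; apply: lerD.
    by apply: le_trans (ler_normB _ _) _; rewrite mulrDr; apply: lerD.
  by rewrite normrM (ger0_norm ma0).
have h1 : w x * (sg * (r1 - r2 + q * ma)) <= W * (L' * (N1 + N2)) + `|q| * (K * ml).
  apply: le_trans (_ : w x * (L' * (N1 + N2) + `|q| * ma) <= _).
    apply: ler_wpM2l => //; apply: le_trans (ler_norm _) _; rewrite normrM.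
    rewrite -[leRHS]mul1r; apply: ler_pM => //.
  rewrite mulrDr; apply: lerD.
    by apply: ler_wpM2r => //; rewrite mulr_ge0 // addr_ge0.
  by rewrite mulrCA; apply: ler_wpM2l.
move: h1 hC; set A1 := w x * _; set A2 := _ * sb.
have -> : w x * (sg * (- (v u1 s x * (- N1 + N2)) + (r1 - r2 + q * ma))) =
   - (w x * v u1 s x * (sg * (- N1 + N2))) + A1 by rewrite /A1; ring.
have -> : W * L' * (N1 + N2) = W * (L' * (N1 + N2)) by ring.
have -> : `|q| * K * ml = `|q| * (K * ml) by ring.
move: (w x * v u1 s x * _) (W * _) (`|q| * _) (C * _) => z1 z2 z3 z4.
lra.
Qed.

Lemma lin_derive s x : 0 <= s <= S ->
  is_derive x (1:R) (lin s) (- mom (f2 s) (fun y => sbump h x y * (1 + y))).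
Proof.
by move=> sS; apply: mom_sstep_is_derive => //; [exact: (flow_dens fl2)|exact: adm1y].
Qed.

Lemma tail_bounds f u s x : flow S U M u fin f -> 0 <= s <= S -> 0 <= tail f h s x <= M.
Proof.
move=> fl sS; have d := flow_dens fl sS; have a1 := adm_sstep1 h x.
apply/andP; split.
  by apply: mom_ge0 => // y _; case/andP: (sstep01 h x y).
apply: le_trans (flow_mass fl sS); apply: mom_le => //; first exact: adm_cst.
by move=> y _; case/andP: (sstep01 h x y).
Qed.

Lemma lin_bounds s x : 0 <= s <= S -> 0 <= lin s x <= M + M.
Proof.
move=> sS; have d := flow_dens fl2 sS; have a1 := adm_sstep h x adm1y.
apply/andP; split.
  apply: mom_ge0 => // y y0; apply: mulr_ge0; last by lra.
  by case/andP: (sstep01 h x y).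
have aid := @adm_id R; have ac := adm_cst (1 : R).
apply: le_trans (_ : mom (f2 s) (fun y => 1 + y) <= _).
  apply: mom_le => //; first exact: adm1y.
  move=> y y0; rewrite -[leRHS]mul1r; apply: ler_wpM2r; first lra.
  by case/andP: (sstep01 h x y).
by rewrite momD //; apply: lerD; [exact: (flow_mass fl2)|exact: (flow_mean fl2)].
Qed.

Lemma energy_rate s : 0 < s < S ->
  Rintegral mu `[al, ga] (fun x => w x * (D s x / sabs eta (D s x) * dD s x)) <=
  w al * v u1 s al * sabs eta (D s al) - w ga * v u1 s ga * sabs eta (D s ga) +
  C * e s + W * (L * (U + 1) * h) * (M + M) + `|u1 s - u2 s| * K * (M + M).
Proof.
move=> sS; have sS' : 0 <= s <= S by lra.
have d1 := flow_dens fl1 sS'; have d2 := flow_dens fl2 sS'.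
set L' := L * (U + 1) * h; set q := `|u1 s - u2 s|.
have alI : al <= al <= ga by rewrite lexx ltW.
have W0 : 0 <= W by apply: le_trans (w_ge0 alI) (wW alI).
have U0 : 0 <= U by apply: le_trans (flow_u fl1 sS').
have L'0 : 0 <= L' by rewrite !mulr_ge0 // ?addr_ge0 // ltW.
(* Except for the [C] term, the whole bound is the derivative of [G], since bump moments are
   derivatives of tails. Tails are at most [M] whatever [h], so the commutator contributes order [h]
   after integration; the tails at [ga] have the favourable sign and are dropped. *)
pose G x := - (w x * v u1 s x * sabs eta (D s x)) - W * L' * (tail f1 h s x + tail f2 h s x)
   - q * K * lin s x.
pose dG x := - ((dw x * v u1 s x + w x * (da x * u1 s - db x)) * sabs eta (D s x) +
     w x * v u1 s x * (D s x / sabs eta (D s x) *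
       (- mom (f1 s) (sbump h x) + mom (f2 s) (sbump h x)))) +
  W * L' * (mom (f1 s) (sbump h x) + mom (f2 s) (sbump h x)) +
  q * K * mom (f2 s) (fun y => sbump h x y * (1 + y)).
have dGP x : al <= x <= ga -> is_derive x (1:R) G (dG x).
  move=> xI.
  have dv : is_derive x (1:R) (v u1 s) (da x * u1 s - db x).
    apply: is_derive_diff; last exact: dbP.
    have := is_derive_prod (daP xI) (is_derive_cst (u1 s) x 1).
    by rewrite mulr0 addr0.
  have dS := is_derive_compose (sabs_is_derive (D s x) eta0) (D_x_derive x sS').
  have d3 := is_derive_scale (W * L') (is_derive_sum (tail_x_derive x fl1 sS') (tail_x_derive x fl2 sS')).
  have d4 := is_derive_scale (q * K) (lin_derive x sS').
  have d5 := is_derive_scale (-1) (is_derive_prod (is_derive_prod (dwP xI) dv) dS).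
  have := is_derive_diff (is_derive_diff d5 d3) d4.
  under eq_fun do rewrite mulN1r.
  move=> H; apply: (is_derive_eq H); rewrite /dG; ring.
have cD := D_x_continuous sS'.
have cv : {within `[al, ga], continuous (v u1 s)}.
  apply: within_continuousB.
    apply: within_continuousM; last exact: within_cst.
    exact: within_is_derive daP.
  exact: within_is_derive dbP.
have cN phi : dens phi -> {within `[al, ga], continuous (fun x => mom phi (sbump h x))}.
  by move=> d; apply: within_continuousW; exact: mom_sbump1_continuous.
have csD : {within `[al, ga], continuous (fun x => sabs eta (D s x))}.
  by apply: within_continuous_comp => //; exact: sabs_continuous.
have csd : {within `[al, ga], continuous (fun x => D s x / sabs eta (D s x))}.
  apply: (@within_continuous_comp _ _ (D s) (fun z => z / sabs eta z)) => //.
  exact: sabs_derive_continuous.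
have cwv : {within `[al, ga], continuous (fun x => w x * v u1 s x)}.
  by apply: within_continuousM => //; exact: cw.
have cdG : {within `[al, ga], continuous dG}.
  apply: within_continuousD; first apply: within_continuousD.
  - have : {within `[al, ga], continuous (fun x =>
      (dw x * v u1 s x + w x * (da x * u1 s - db x)) * sabs eta (D s x) +
      w x * v u1 s x * (D s x / sabs eta (D s x) *
       (- mom (f1 s) (sbump h x) + mom (f2 s) (sbump h x))))}.
      apply: within_continuousD.
        apply: within_continuousM => //; apply: within_continuousD.
          exact: within_continuousM.
        apply: within_continuousM; first exact: cw.
        apply: within_continuousB => //; apply: within_continuousM => //.
        exact: within_cst.
      apply: within_continuousM => //; apply: within_continuousM => //.
      apply: within_continuousD; last exact: cN.
      by move=> x; apply: cvgN; exact: cN.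
    by move=> H x; apply: cvgN; exact: H.
  - apply: within_continuousM; first exact: within_cst.
    by apply: within_continuousD; exact: cN.
  - apply: within_continuousM; first exact: within_cst.
    by apply: within_continuousW; apply: mom_sbump_continuous => //; exact: adm1y.
have cI := energy_integrand_continuous sS'.
have cdD : {within `[al, ga], continuous (dD s)}.
  have cf phi u : dens phi -> continuous (fun x => mom phi (fun y => v u s y * sbump h x y)).
    move=> d; have := mom_sbump_continuous d (adm_v u s) h0.
    by under eq_fun do under eq_fun do rewrite mulrC.
  by apply: within_continuousB; apply: within_continuousW; apply: cf.
have cint : {within `[al, ga], continuous
    (fun x => w x * (D s x / sabs eta (D s x) * dD s x))}.
  by apply: within_continuousM; [exact: cw|exact: within_continuousM].
have cCI : {within `[al, ga], continuous (fun x => C * (w x * sabs eta (D s x)))}.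
  by apply: within_continuousM => //; exact: within_cst.
apply: le_trans (_ : Rintegral mu `[al, ga]
   (fun x => dG x + C * (w x * sabs eta (D s x))) <= _).
  apply: Rintegral_le => //; first exact: within_continuousD.
  by move=> x xI; exact: integrand_bound.
rewrite RintegralD //; [|exact: within_integrable..].
rewrite RintegralZl //; last exact: within_integrable.
have dGP' x : al < x < ga -> is_derive x (1:R) G (dG x) by move=> xI; apply: dGP; lra.
rewrite (Rintegral_FTC alga (within_is_derive dGP) dGP' cdG) /G -/(e s).
have M0 : 0 <= M by have := tail_bounds al fl1 sS'; lra.
have WL0 : 0 <= W * L' by rewrite mulr_ge0.
have qK0 : 0 <= q * K by apply: mulr_ge0 => //; exact: normr_ge0.
have t1 := tail_bounds al fl1 sS'; have t2 := tail_bounds al fl2 sS'.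
have t3 := tail_bounds ga fl1 sS'; have t4 := tail_bounds ga fl2 sS'.
have t5 := lin_bounds al sS'; have t6 := lin_bounds ga sS'.
have b1 : W * L' * (tail f1 h s al + tail f2 h s al) <= W * L' * (M + M).
  by apply: ler_wpM2l => //; lra.
have b2 : q * K * lin s al <= q * K * (M + M) by apply: ler_wpM2l => //; lra.
have b3 : 0 <= W * L' * (tail f1 h s ga + tail f2 h s ga) by apply: mulr_ge0 => //; lra.
have b4 : 0 <= q * K * lin s ga by apply: mulr_ge0 => //; lra.
rewrite -/(D s al) -/(D s ga).
move: b1 b2 b3 b4; rewrite -/q.
move: (w ga * v u1 s ga * _) (w al * v u1 s al * _) (C * e s) (W * L' * (M + M))
 (q * K * (M + M)) (q * K * lin s al) (q * K * lin s ga)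
 (W * L' * (tail f1 h s al + tail f2 h s al)) (W * L' * (tail f1 h s ga + tail f2 h s ga)).
move=> z1 z2 z3 z4 z5 z6 z7 z8 z9; lra.
Qed.

Lemma energy_inequality :
  let en s := Rintegral mu `[al, ga] (fun x => w x * sabs eta (tail f1 h s x - tail f2 h s x)) in
  {within `[0, S], continuous en} /\
  exists en' : R -> R, forall s, 0 < s < S -> is_derive s (1:R) en (en' s) /\
    en' s <= w al * (a al * u1 s - b al) * sabs eta (tail f1 h s al - tail f2 h s al) -
      w ga * (a ga * u1 s - b ga) * sabs eta (tail f1 h s ga - tail f2 h s ga) +
      C * en s + W * (L * (U + 1) * h) * (M + M) + `|u1 s - u2 s| * K * (M + M).
Proof.
split; first exact: energy_continuous.
exists (fun s => Rintegral mu `[al, ga] (fun x => w x * (D s x / sabs eta (D s x) * dD s x))).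
by move=> s sS; split; [exact: energy_derive|exact: energy_rate].
Qed.

End Energy.

(** * Stability of the tails *)

Section Stability.
Variable R : realType.
Notation mu := (@lebesgue_measure R).
Notation HL := (@halfline R).
Implicit Types (s t x y e h eta eps X : R) (f : R -> R -> R) (u : R -> R).
Variables (a b da db : R -> R).
Hypothesis adma : adm a.
Hypothesis admb : adm b.
Hypothesis a_gt0 : forall x, 0 < x -> 0 < a x.
Hypothesis b_ge0 : forall x, 0 < x -> 0 <= b x.
Hypothesis daP : forall x, 0 < x -> is_derive x (1:R) a (da x).
Hypothesis dbP : forall x, 0 < x -> is_derive x (1:R) b (db x).
Hypothesis cda : forall x, 0 < x -> {for x, continuous da}.
Hypothesis cdb : forall x, 0 < x -> {for x, continuous db}.
Variables (A x0 Ld : R).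
Hypothesis A_gt0 : 0 < A.
Hypothesis growth : forall x, 0 < x -> a x <= A * (1 + x) /\ b x <= A * (1 + x).
Hypothesis lips : forall al : R, 0 < al -> exists2 L : R, 0 <= L & forall x y, al <= x -> x <= y ->
  `|a y - a x| <= L * (y - x) /\ `|b y - b x| <= L * (y - x).
Hypothesis x0_gt0 : 0 < x0.
Hypothesis Ld_ge0 : 0 <= Ld.
Hypothesis derbound : forall x, x0 <= x -> `|da x| <= Ld /\ `|db x| <= Ld.
Variables (S U M rho kap Ln : R) (u1 u2 fin : R -> R) (f1 f2 : R -> R -> R).
Hypothesis S0 : 0 < S.
Hypothesis fl1 : flow a b S U M u1 fin f1.
Hypothesis fl2 : flow a b S U M u2 fin f2.
Hypothesis u1E : forall s, 0 <= s <= S -> u1 s = rho - mom (f1 s) id.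
Hypothesis u2E : forall s, 0 <= s <= S -> u2 s = rho - mom (f2 s) id.
Let Phi x := b x / a x.
Let dPhi x := (db x * a x - b x * da x) / a x ^+ 2.
Hypothesis kap_ge0 : 0 <= kap.
Hypothesis sign : forall s x, 0 <= s <= S -> 0 < x <= x0 ->
  dPhi x * (kap * (u1 s - Phi x) - 1) <= 0.
Hypothesis inflow : forall s x, 0 <= s <= S -> 0 < x <= x0 -> 0 <= u1 s - Phi x.
Hypothesis Ln_ge0 : 0 <= Ln.
Hypothesis massdiff : forall s, 0 <= s <= S ->
  `|mom (f1 s) (cst 1) - mom (f2 s) (cst 1)| <=
  Ln * Rintegral mu `[0, s] (fun r => `|u1 r - u2 r|).
Hypothesis cmass1 : {within `[0, S], continuous (fun s => mom (f1 s) (cst 1))}.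
Hypothesis cmass2 : {within `[0, S], continuous (fun s => mom (f2 s) (cst 1))}.

Let w x := expR (kap * Phi x) / a x.
Let dw x := expR (kap * Phi x) * (kap * dPhi x) / a x - expR (kap * Phi x) * da x / a x ^+ 2.

Lemma itv_continuous (g : R -> R) (al ga : R) : 0 < al -> (forall x, 0 < x -> {for x, continuous g}) ->
  {within `[al, ga], continuous g}.
Proof.
move=> al0 cg; apply: continuous_in_subspaceT => x; rewrite inE /= in_itv /= => /andP[alx _].
by apply: cg; exact: lt_le_trans alx.
Qed.

Lemma Phi_derive x : 0 < x -> is_derive x (1:R) Phi (dPhi x).
Proof.
move=> x1; have a1 : a x != 0 by rewrite gt_eqF // a_gt0.
have da' := daP x1.
have H := is_derive_prod (dbP x1) (is_deriveV a1 da').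
apply: (is_derive_eq H); rewrite /dPhi /GRing.scale /=; field; exact: a1.
Qed.

Lemma expPhi_derive x : 0 < x ->
  is_derive x (1:R) (fun x => expR (kap * Phi x)) (expR (kap * Phi x) * (kap * dPhi x)).
Proof.
move=> x1; exact: (@is_derive_compose R (@expR R) (fun x => kap * Phi x) x _ _
  (is_derive_expR _) (is_derive_scale kap (Phi_derive x1))).
Qed.

Lemma w_derive x : 0 < x -> is_derive x (1:R) w (dw x).
Proof.
move=> x1; have a1 : a x != 0 by rewrite gt_eqF // a_gt0.
have da' := daP x1.
have d1 := expPhi_derive x1.
have H := is_derive_prod d1 (is_deriveV a1 da').
apply: (is_derive_eq H); rewrite /dw /GRing.scale /=; field; exact: a1.
Qed.

Lemma derive_for_continuous (g : R -> R) x dg : is_derive x (1:R) g dg -> {for x, continuous g}.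
Proof. by case=> d _; apply: differentiable_continuous; exact/derivable1_diffP. Qed.

Lemma dw_continuous x : 0 < x -> {for x, continuous dw}.
Proof.
move=> x1; have a1 : a x != 0 by rewrite gt_eqF // a_gt0.
have ca := derive_for_continuous (daP x1); have cb := derive_for_continuous (dbP x1).
have ca2 : {for x, continuous (fun x => a x ^+ 2)} by apply: cvgM.
have a2 : a x ^+ 2 != 0 by rewrite expf_neq0.
have ci : {for x, continuous (fun x => (a x)^-1)} by apply: cvgV.
have ci2 : {for x, continuous (fun x => (a x ^+ 2)^-1)} by apply: cvgV.
have cPhi := derive_for_continuous (Phi_derive x1).
have cE : {for x, continuous (fun x => expR (kap * Phi x))}.
  exact: derive_for_continuous (expPhi_derive x1).
have cdPhi : {for x, continuous dPhi}.
  apply: cvgM => //; apply: cvgB; apply: cvgM => //; [exact: cdb|exact: cda].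
apply: cvgB; apply: cvgM => //.
  by apply: cvgM => //; apply: cvgM => //; exact: cvg_cst.
by apply: cvgM => //; exact: cda.
Qed.

Lemma w_gt0 x : 0 < x -> 0 < w x.
Proof. by move=> x1; rewrite divr_gt0 ?expR_gt0 ?a_gt0. Qed.

(** This is condition [wC] with [C = 0]: the division by [a] removes [da], and the remaining factor
    is the one whose sign is assumed in [sign]. *)
Lemma near_weight s x : 0 <= s <= S -> 0 < x <= x0 ->
  dw x * (a x * u1 s - b x) + w x * (da x * u1 s - db x) <= 0 * w x.
Proof.
move=> sS xI; have x1 : 0 < x by case/andP: xI.
have a1 : a x != 0 by rewrite gt_eqF // a_gt0.
rewrite mul0r.
have -> : dw x * (a x * u1 s - b x) + w x * (da x * u1 s - db x) =
   expR (kap * Phi x) * (dPhi x * (kap * (u1 s - Phi x) - 1)).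
  rewrite /dw /w; move: (expR _) => E; rewrite /dPhi /Phi; field; exact: a1.
by rewrite pmulr_rle0 ?expR_gt0 //; exact: sign.
Qed.

Lemma U_ge0 : 0 <= U.
Proof.
have sS : 0 <= (0 : R) <= S by rewrite lexx ltW.
exact: le_trans (flow_u fl1 sS).
Qed.

Lemma M_ge0 : 0 <= M.
Proof.
have sS : 0 <= (0 : R) <= S by rewrite lexx ltW.
apply: le_trans (flow_mass fl1 sS); apply: mom_ge0 => //; first exact: (flow_dens fl1).
exact: adm_cst.
Qed.

Lemma Phi_bounds x : 0 < x <= x0 -> 0 <= Phi x <= U.
Proof.
move=> xI; have x1 : 0 < x by case/andP: xI.
have sS : 0 <= (0 : R) <= S by rewrite lexx ltW.
have P0 : 0 <= Phi x by apply: divr_ge0; [exact: b_ge0|rewrite ltW // a_gt0].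
rewrite P0 /=; have := inflow sS xI; rewrite subr_ge0 => h.
apply: le_trans h _; apply: le_trans (ler_norm _) _; exact: (flow_u fl1).
Qed.

Let E0 := expR (kap * U).

Lemma wa_bounds x : 0 < x <= x0 -> 1 <= w x * a x <= E0.
Proof.
move=> xI; have x1 : 0 < x by case/andP: xI.
have /andP[P0 PU] := Phi_bounds xI.
rewrite divfK ?gt_eqF ?a_gt0 //; apply/andP; split.
  by rewrite -expR0 ler_expR mulr_ge0.
by rewrite ler_expR; apply: ler_wpM2l.
Qed.

Lemma w_lower x : 0 < x <= x0 -> 1 <= A * (1 + x0) * w x.
Proof.
move=> xI; have [x1 xx0] := andP xI.
have /andP[h _] := wa_bounds xI; apply: (le_trans h).
rewrite mulrC; apply: ler_wpM2r; first by rewrite ltW // w_gt0.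
apply: le_trans (growth x1).1 _; apply: ler_wpM2l; first exact: ltW.
by rewrite lerD2l.
Qed.

Lemma q_continuous : {within `[0, S], continuous (fun s => `|u1 s - u2 s|)}.
Proof.
have H f u : flow a b S U M u fin f -> {within `[0, S], continuous (fun s => mom (f s) id)}.
  move=> fl; apply: (flow_continuous fl (C := 1)) => // x x1.
  by rewrite mul1r gtr0_norm.
apply: (@eq_within _ _ (fun s => `|mom (f2 s) id - mom (f1 s) id|)).
  by move=> s; rewrite /= in_itv /= => sS; rewrite u1E // u2E //; congr (`|_|); ring.
apply: within_continuous_comp; first exact: norm_continuous.
by apply: within_continuousB; [exact: H fl2|exact: H fl1].
Qed.

Lemma adm_tailmean (z : R) : adm (fun y => sstep 1 z y * y).
Proof. exact: adm_sstep (@adm_id R). Qed.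

(** The means beyond [l] decrease pointwise to 0 and are continuous in time, so Dini's theorem makes
    them uniformly small. *)
Lemma tailmean_small f u : flow a b S U M u fin f -> forall e, 0 < e ->
  exists k, forall l s, (k <= l)%N -> 0 <= s <= S ->
    mom (f s) (fun y => sstep 1 l%:R y * y) < e.
Proof.
move=> fl e e0.
have mono k l s : 0 <= s <= S -> (k <= l)%N ->
    mom (f s) (fun y => sstep 1 l%:R y * y) <= mom (f s) (fun y => sstep 1 k%:R y * y).
  move=> sS kl; apply: mom_le; [exact: (flow_dens fl)|exact: adm_tailmean..|].
  move=> y y0; apply: ler_wpM2r; first exact: ltW.
  by apply: step_le; rewrite !divr1 lerD2l lerN2 ler_nat.
have cr k : {within `[0, S], continuous (fun s => mom (f s) (fun y => sstep 1 k%:R y * y))}.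
  apply: (flow_continuous fl (C := 1)); first by case: (adm_tailmean k%:R).
  move=> y y0; rewrite normrM (gtr0_norm y0); apply: ler_wpM2r; first exact: ltW.
  by have /andP[c0 c1] := sstep01 1 k%:R y; rewrite ger0_norm.
have cv t : 0 <= t <= S -> mom (f t) (fun y => sstep 1 k%:R y * y) @[k --> \oo] --> (0 : R).
  move=> tS; have d := flow_dens fl tS.
  have <- : mom (f t) (cst 0) = 0.
    have := momZ 0 d (adm_cst (0 : R)); rewrite mul0r => H; rewrite -[RHS]H.
    by apply: eq_mom => y _; rewrite mul0r.
  apply: (@mom_cvg _ _ _ _ 1) => //.
  - by move=> k; case: (adm_tailmean k%:R).
  - move=> k y y0; have /andP[c0 c1] := sstep01 1 k%:R y.
    rewrite ger0_norm; last by rewrite mulr_ge0 // ltW.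
    by rewrite mul1r; apply: le_trans (_ : 1 * y <= _); [apply: ler_wpM2r => //; exact: ltW|lra].
  - move=> y y0; apply: cvg_near_cst; exists (Num.truncn y).+1 => // k /= Hk.
    rewrite sstep_eq0 ?mul0r //.
    by apply: ltW; apply: lt_le_trans (truncnS_gt y) _; rewrite ler_nat.
have [k Hk] := dini cr (fun k l t tS kl => mono k l t tS kl) cv e0.
exists k => l s kl sS; apply: le_lt_trans (Hk s sS); exact: mono.
Qed.

(** Again Dini's theorem. The continuity of the total mass in time is a separate assumption here,
    since the constant 1 is not bounded by a multiple of [x]. *)
Lemma mass_near0_small f u : flow a b S U M u fin f ->
  {within `[0, S], continuous (fun s => mom (f s) (cst 1))} -> forall e, 0 < e ->
  exists k, forall l s, (k <= l)%N -> 0 <= s <= S ->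
    mom (f s) (cst 1) - mom (f s) (cut l) < e.
Proof.
move=> fl cm e e0.
have mono k l s : 0 <= s <= S -> (k <= l)%N ->
    mom (f s) (cst 1) - mom (f s) (cut l) <= mom (f s) (cst 1) - mom (f s) (cut k).
  move=> sS kl; rewrite lerD2l lerN2.
  apply: mom_le; [exact: (flow_dens fl)|exact: adm_cut..|].
  by move=> y y0; exact: cut_nondecreasing.
have cr k : {within `[0, S], continuous (fun s => mom (f s) (cst 1) - mom (f s) (cut k))}.
  apply: within_continuousB => //; apply: (flow_continuous fl (C := k.+1%:R)).
    exact: measurable_cut.
  by move=> y y0; rewrite cut_norm; exact: cut_le_id.
have cv t : 0 <= t <= S -> mom (f t) (cst 1) - mom (f t) (cut k) @[k --> \oo] --> (0 : R).
  move=> tS; rewrite -(subrr (mom (f t) (cst 1))); apply: cvgB; first exact: cvg_cst.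
  exact: mom_cut_cvg (flow_dens fl tS).
have [k Hk] := dini cr (fun k l t tS kl => mono k l t tS kl) cv e0.
exists k => l s kl sS; apply: le_lt_trans (Hk s sS); exact: mono.
Qed.

Let D h s x := tail f1 h s x - tail f2 h s x.
Let V t := Rintegral mu `[0, t] (fun r => `|u1 r - u2 r|).
Let en1 eps h eta s := Rintegral mu `[eps, x0] (fun x => w x * sabs eta (D h s x)).
(** The constant is the value of the near weight at [x0], so that the fluxes of [en1] and [en2]
    through [x0] cancel in the sum. *)
Let en2 X h eta s := Rintegral mu `[x0, X] (fun x => w x0 * sabs eta (D h s x)).
(** Minus a primitive of the smoothed tail. At a small [eps] it equals the mean up to
    [(eps + h) * M], which is how [u1 - u2] is read off from the integral of [D]. *)
Let R0 f h s x := mom (f s) (sramp h x).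
Let cq := A * (1 + x0).

Lemma tail_integral f u h s (al ga : R) : flow a b S U M u fin f -> 0 <= s <= S ->
  0 < h -> al < ga ->
  Rintegral mu `[al, ga] (tail f h s) = R0 f h s al - R0 f h s ga.
Proof.
move=> fl sS h0 alga; have d := flow_dens fl sS.
have dR x : is_derive x (1:R) (fun x => - R0 f h s x) (tail f h s x).
  have := is_derive_scale (-1) (mom_sramp_is_derive x d h0).
  by rewrite mulN1r opprK; under eq_fun do rewrite mulN1r.
have cR : {within `[al, ga], continuous (fun x => - R0 f h s x)}.
  by apply: within_is_derive => x _; exact: dR.
have ct : {within `[al, ga], continuous (tail f h s)}.
  by apply: within_is_derive => x _; exact: (tail_x_derive h0 x fl sS).
by rewrite (Rintegral_FTC alga cR (fun x _ => dR x) ct) opprK addrC.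
Qed.

Lemma D_continuous h s (al ga : R) : 0 <= s <= S -> 0 < h -> {within `[al, ga], continuous (D h s)}.
Proof.
move=> sS h0; apply: within_continuousB; apply: within_is_derive => x _.
  exact: (tail_x_derive h0 x fl1 sS).
exact: (tail_x_derive h0 x fl2 sS).
Qed.

Lemma D_integral h s (al ga : R) : 0 <= s <= S -> 0 < h -> al < ga ->
  Rintegral mu `[al, ga] (D h s) =
  (R0 f1 h s al - R0 f2 h s al) - (R0 f1 h s ga - R0 f2 h s ga).
Proof.
move=> sS h0 alga; rewrite RintegralB //.
- rewrite (tail_integral fl1) // (tail_integral fl2) //; ring.
- by apply: within_integrable; apply: within_is_derive => x _; exact: (tail_x_derive h0 x fl1 sS).
- by apply: within_integrable; apply: within_is_derive => x _; exact: (tail_x_derive h0 x fl2 sS).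
Qed.

Lemma w_within (al ga : R) : 0 < al -> {within `[al, ga], continuous w}.
Proof.
move=> al0; apply: itv_continuous => // x x1.
exact: derive_for_continuous (w_derive x1).
Qed.

Lemma normD_near eps h eta s : 0 <= s <= S -> 0 < h -> 0 < eta -> 0 < eps -> eps < x0 ->
  Rintegral mu `[eps, x0] (fun x => `|D h s x|) <= cq * en1 eps h eta s.
Proof.
move=> sS h0 eta0 eps0 ex0; have cD := @D_continuous h s eps x0 sS h0.
have cs : {within `[eps, x0], continuous (fun x => w x * sabs eta (D h s x))}.
  apply: within_continuousM; first exact: w_within.
  by apply: within_continuous_comp cD; exact: sabs_continuous.
rewrite -RintegralZl //; last exact: within_integrable.
apply: Rintegral_le.
- by apply: within_continuous_comp cD; exact: norm_continuous.
- by apply: within_continuousM => //; exact: within_cst.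
move=> x /andP[ex xx0]; have xI : 0 < x <= x0 by rewrite (lt_le_trans eps0 ex).
apply: le_trans (sabs_ge eta _) _; rewrite mulrA -[leLHS]mul1r.
by apply: ler_wpM2r; [rewrite ltW // sabs_gt0|exact: w_lower].
Qed.

Lemma normD_far X h eta s : 0 <= s <= S -> 0 < h -> 0 < eta -> x0 < X ->
  Rintegral mu `[x0, X] (fun x => `|D h s x|) <= cq * en2 X h eta s.
Proof.
move=> sS h0 eta0 x0X; have cD := @D_continuous h s x0 X sS h0.
have cs : {within `[x0, X], continuous (fun x => w x0 * sabs eta (D h s x))}.
  apply: within_continuousM; first exact: within_cst.
  by apply: within_continuous_comp cD; exact: sabs_continuous.
rewrite -RintegralZl //; last exact: within_integrable.
apply: Rintegral_le.
- by apply: within_continuous_comp cD; exact: norm_continuous.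
- by apply: within_continuousM => //; exact: within_cst.
move=> x _; have xI : 0 < x0 <= x0 by rewrite x0_gt0 lexx.
apply: le_trans (sabs_ge eta _) _; rewrite mulrA -[leLHS]mul1r.
by apply: ler_wpM2r; [rewrite ltW // sabs_gt0|exact: w_lower].
Qed.

Lemma D_integral_bound h s (al ga : R) : 0 <= s <= S -> 0 < h -> al <= ga ->
  `|(R0 f1 h s al - R0 f2 h s al) - (R0 f1 h s ga - R0 f2 h s ga)| <=
  Rintegral mu `[al, ga] (fun x => `|D h s x|).
Proof.
move=> sS h0; rewrite le_eqVlt => /predU1P[<-|alga].
  by rewrite subrr normr0; apply: Rintegral_ge0.
rewrite -D_integral //.
apply: le_normr_Rintegral => //; apply: within_integrable; exact: D_continuous.
Qed.

Lemma energy_controls eps X h eta s (al ga : R) : 0 <= s <= S -> 0 < h -> 0 < eta ->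
  0 < eps -> eps < x0 -> eps <= al -> al <= x0 -> x0 <= ga -> ga <= X -> x0 < X ->
  `|(R0 f1 h s al - R0 f2 h s al) - (R0 f1 h s ga - R0 f2 h s ga)| <=
  cq * (en1 eps h eta s + en2 X h eta s).
Proof.
move=> sS h0 eta0 eps0 ex0 eal alx0 x0ga gaX x0X.
have -> : (R0 f1 h s al - R0 f2 h s al) - (R0 f1 h s ga - R0 f2 h s ga) =
  ((R0 f1 h s al - R0 f2 h s al) - (R0 f1 h s x0 - R0 f2 h s x0)) +
  ((R0 f1 h s x0 - R0 f2 h s x0) - (R0 f1 h s ga - R0 f2 h s ga)) by ring.
apply: le_trans (ler_normD _ _) _; rewrite mulrDr.
have nD (p q : R) : mu.-integrable `[p, q] (EFin \o (fun x => `|D h s x|)).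
  apply: within_integrable; apply: within_continuous_comp; first exact: norm_continuous.
  exact: D_continuous.
have ndle (p q p' q' : R) : p <= p' -> q' <= q ->
    Rintegral mu `[p', q'] (fun x => `|D h s x|) <= Rintegral mu `[p, q] (fun x => `|D h s x|).
  move=> pp qq; rewrite /Rintegral; apply: fine_le.
  - by apply: integrable_fin_num.
  - by apply: integrable_fin_num.
  apply: ge0_subset_integral => //; last by apply: subset_itv; rewrite bnd_simp.
  exact: (measurable_int _ (nD p q)).
apply: lerD.
- apply: le_trans (D_integral_bound sS h0 alx0) _.
  apply: le_trans (ndle eps x0 al x0 eal (lexx _)) _.
  exact: normD_near.
- apply: le_trans (D_integral_bound sS h0 x0ga) _.
  apply: le_trans (ndle x0 X x0 ga (lexx _) gaX) _.
  exact: normD_far.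
Qed.

Lemma R0_near f u h s eps : flow a b S U M u fin f -> 0 <= s <= S -> 0 < h -> 0 < eps ->
  0 <= mom (f s) id - R0 f h s eps <= (eps + h) * M.
Proof.
move=> fl sS h0 eps0; have d := flow_dens fl sS.
have ar := adm_sramp eps h0; have ai := @adm_id R; have ac := adm_cst (1 : R).
rewrite -momB //.
have bnd y : 0 < y -> 0 <= y - sramp h eps y <= eps + h.
  move=> y0; have /andP[] := sramp_bounds eps y h0.
  rewrite ge_max le_max => /andP[r0 r1] /orP[r2|r2].
    have r3 : sramp h eps y = 0 by apply/le_anti; rewrite r0 r2.
    rewrite r3 subr0 ltW //=; move: r1; rewrite r3; lra.
  lra.
apply/andP; split.
  by apply: mom_ge0 => //; [exact: admB|move=> y /bnd /andP[]].
apply: le_trans (_ : mom (f s) (fun y => (eps + h) * cst 1 y) <= _).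
  apply: mom_le => //; [exact: admB|exact: admZ|].
  by move=> y /bnd /andP[_]; rewrite mulr1.
rewrite momZ //; apply: ler_wpM2l; last exact: (flow_mass fl).
by rewrite addr_ge0 // ltW.
Qed.

Lemma q_bound eps X h eta s tau : 0 <= s <= S -> 0 < h -> 0 < eta ->
  0 < eps -> eps < x0 -> x0 < X ->
  R0 f1 h s X <= tau -> R0 f2 h s X <= tau ->
  `|u1 s - u2 s| <= cq * (en1 eps h eta s + en2 X h eta s) + ((eps + h) * (M + M) + (tau + tau)).
Proof.
move=> sS h0 eta0 eps0 ex0 x0X t1 t2.
have ee : eps <= eps by []. have XX : X <= X by [].
have := energy_controls sS h0 eta0 eps0 ex0 ee (ltW ex0) (ltW x0X) XX x0X.
have n1 := R0_near fl1 sS h0 eps0; have n2 := R0_near fl2 sS h0 eps0.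
have p1 : 0 <= R0 f1 h s X.
  apply: mom_ge0; [exact: (flow_dens fl1)|exact: adm_sramp|].
  by move=> y _; have /andP[h1 _] := sramp_bounds X y h0; apply: le_trans h1; rewrite le_max lexx.
have p2 : 0 <= R0 f2 h s X.
  apply: mom_ge0; [exact: (flow_dens fl2)|exact: adm_sramp|].
  by move=> y _; have /andP[h1 _] := sramp_bounds X y h0; apply: le_trans h1; rewrite le_max lexx.
rewrite u1E // u2E // !ler_norml (mulrDr (eps + h)).
move: (cq * _) (mom (f1 s) id) (mom (f2 s) id) (R0 f1 h s eps) (R0 f2 h s eps)
  ((eps + h) * M) n1 n2 p1 p2 t1 t2 => c m1 m2 r1 r2 m n1 n2 p1 p2 t1 t2 H.
apply/andP; split; lra.
Qed.


(** [K12] collects the coefficients of [|u1 - u2|] in the rates of [en1] and [en2], and the 1 added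
    to it in [Cst] accounts for the derivative of [V]. The other terms of [Cst] come from the flux
    at [eps], bounded through [V], and from the derivatives of the rates beyond [x0]. *)
Let K12 := (E0 + 1 + w x0 * A) * (M + M).
Let Cst := E0 * U * Ln + Ld * (U + 1) + (K12 + 1) * cq.
(* [err] gathers the terms that vanish with the parameters: [r] bounds the mass
   below [eps], [tau] the mass and the mean beyond [X]. *)
Let err eps X h eta r tau W1 L :=
  E0 * U * (r + eta) + w x0 * (A * (2 * (U + 1))) * (tau + tau + X * eta) +
  (W1 + w x0) * (L * (U + 1) * h) * (M + M) +
  (K12 + 1) * ((eps + h) * (M + M) + (tau + tau)).

Lemma E0_ge0 : 0 <= E0. Proof. exact: expR_ge0. Qed.
Lemma wx0_ge0 : 0 <= w x0. Proof. by rewrite ltW // w_gt0. Qed.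
Lemma cq_ge0 : 0 <= cq.
Proof. by rewrite mulr_ge0 ?(ltW A_gt0) // addr_ge0 // ltW. Qed.
Lemma K12_ge0 : 0 <= K12.
Proof.
have := E0_ge0; have := wx0_ge0; have := M_ge0 => m e1 e2.
by rewrite mulr_ge0 ?addr_ge0 // mulr_ge0 // ltW.
Qed.
Lemma Cst_ge0 : 0 <= Cst.
Proof.
have h1 := E0_ge0; have h2 := U_ge0; have h3 := cq_ge0; have h4 := K12_ge0.
rewrite /Cst; apply: addr_ge0; last by rewrite mulr_ge0 ?addr_ge0.
by apply: addr_ge0; rewrite !mulr_ge0 ?addr_ge0.
Qed.

Lemma speed_bound_flow s x : 0 <= s <= S -> 0 < x -> `|a x * u1 s - b x| <= A * (1 + x) * (U + 1).
Proof.
move=> sS x1; have [h1 h2] := growth x1.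
apply: le_trans (ler_normB _ _) _; rewrite [leRHS]mulrDr mulr1; apply: lerD.
  rewrite normrM; apply: ler_pM => //; last exact: (flow_u fl1).
  by rewrite gtr0_norm ?a_gt0.
by rewrite ger0_norm // b_ge0.
Qed.

(** The factor of [sabs] is [w * a] times [u1 - Phi], bounded by [E0 * U] uniformly in [eps]
    although [w] may blow up. At [eps] the tails differ from the total masses by at most [r], so [D]
    is essentially the difference of the masses. *)
Lemma left_flux s eps eta h r : 0 <= s <= S -> 0 < h -> 0 < eta -> 0 < eps -> eps < x0 ->
  mom (f1 s) (cst 1) - tail f1 h s eps <= r -> mom (f2 s) (cst 1) - tail f2 h s eps <= r ->
  w eps * (a eps * u1 s - b eps) * sabs eta (D h s eps) <= E0 * U * (Ln * V s + (r + eta)).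
Proof.
move=> sS h0 eta0 eps0 ex0 r1 r2.
have eI : 0 < eps <= x0 by rewrite eps0 ltW.
have ane : a eps != 0 by rewrite gt_eqF // a_gt0.
have -> : w eps * (a eps * u1 s - b eps) = w eps * a eps * (u1 s - Phi eps).
  by rewrite /Phi; field.
have /andP[wa1 wa2] := wa_bounds eI.
have u0 := inflow sS eI; have /andP[P0 _] := Phi_bounds eI.
have uU : u1 s <= U by apply: le_trans (ler_norm _) (flow_u fl1 sS).
have tl f u : flow a b S U M u fin f -> tail f h s eps <= mom (f s) (cst 1).
  move=> fl; apply: mom_le; [exact: (flow_dens fl)|exact: adm_sstep1|exact: adm_cst|].
  by move=> y _; have /andP[] := sstep01 h eps y.
have t1 := tl _ _ fl1; have t2 := tl _ _ fl2.
have md := massdiff sS.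
apply: ler_pM.
- by apply: mulr_ge0 => //; lra.
- by rewrite ltW // sabs_gt0.
- by apply: ler_pM => //; lra.
apply: le_trans (sabs_le _ eta0) _; rewrite addrA; apply: lerD => //.
have -> : D h s eps = (mom (f1 s) (cst 1) - mom (f2 s) (cst 1)) +
   ((mom (f2 s) (cst 1) - tail f2 h s eps) - (mom (f1 s) (cst 1) - tail f1 h s eps)).
  by rewrite /D; ring.
apply: le_trans (ler_normD _ _) _; apply: lerD => //.
by rewrite ler_norml; apply/andP; split; lra.
Qed.

(** The speed at [X] grows at most like [2 * A * (U + 1) * X]; the factor [X] is absorbed by the
    smallness of [X] times the tail. *)
Lemma right_flux s X eta h tau : 0 <= s <= S -> 0 < h -> 0 < eta -> 1 <= X ->
  X * tail f1 h s X <= tau -> X * tail f2 h s X <= tau ->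
  - (w x0 * (a X * u1 s - b X) * sabs eta (D h s X)) <=
  w x0 * (A * (2 * (U + 1))) * (tau + tau + X * eta).
Proof.
move=> sS h0 eta0 X1 t1 t2; have X0 : 0 < X by lra.
have /andP[p1 _] := tail_bounds h X fl1 sS.
have /andP[p2 _] := tail_bounds h X fl2 sS.
have sb := speed_bound_flow sS X0.
rewrite -[w x0 * _ * sabs _ _]mulrA -[leRHS]mulrA -mulrN; apply: ler_wpM2l; first exact: wx0_ge0.
apply: le_trans (ler_norm _) _; rewrite normrN normrM.
have U0 := U_ge0.
apply: le_trans (_ : A * (2 * X) * (U + 1) * (tail f1 h s X + tail f2 h s X + eta) <= _).
  apply: ler_pM => //.
    apply: le_trans sb _; apply: ler_wpM2r; first by rewrite addr_ge0.
    by apply: ler_wpM2l; [exact: ltW|lra].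
  rewrite (gtr0_norm (sabs_gt0 _ eta0)); apply: le_trans (sabs_le _ eta0) _.
  apply: lerD => //; apply: le_trans (ler_normB _ _) _.
  by rewrite !ger0_norm.
have -> : A * (2 * X) * (U + 1) * (tail f1 h s X + tail f2 h s X + eta) =
   A * (2 * ((U + 1) * (X * tail f1 h s X + X * tail f2 h s X + X * eta))) by ring.
have -> : A * (2 * (U + 1)) * (tau + tau + X * eta) = A * (2 * ((U + 1) * (tau + tau + X * eta))) by ring.
apply: ler_wpM2l; first exact: ltW.
apply: ler_wpM2l => //; apply: ler_wpM2l; first by rewrite addr_ge0.
by apply: lerD => //; exact: lerD.
Qed.

Lemma en1_ge0 eps h eta s : 0 < eta -> 0 < eps -> 0 <= en1 eps h eta s.
Proof.
move=> eta0 eps0; apply: Rintegral_ge0 => x /=; rewrite in_itv /= => /andP[ex _].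
by rewrite ltW // mulr_gt0 ?sabs_gt0 // w_gt0 // (lt_le_trans eps0).
Qed.

Lemma en2_ge0 X h eta s : 0 < eta -> 0 <= en2 X h eta s.
Proof.
move=> eta0; apply: Rintegral_ge0 => x _.
by rewrite ltW // mulr_gt0 ?sabs_gt0 // w_gt0.
Qed.

Lemma V_ge0 s : 0 <= V s. Proof. by apply: Rintegral_ge0. Qed.

(** Gronwall's lemma for [en1 + en2 + V]. The condition [W1 * L * h <= 1] keeps the constant in [wK]
    independent of [eps], although [W1] and [L] depend on it. *)
Lemma stability_estimate eps X h eta (r tau W1 L : R) :
  0 < eps -> eps < x0 -> x0 < X -> 1 <= X -> 0 < h -> 0 < eta -> 0 <= r -> 0 <= tau ->
  (forall s, 0 <= s <= S -> mom (f1 s) (cst 1) - tail f1 h s eps <= r) ->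
  (forall s, 0 <= s <= S -> mom (f2 s) (cst 1) - tail f2 h s eps <= r) ->
  (forall s, 0 <= s <= S -> X * tail f1 h s X <= tau) ->
  (forall s, 0 <= s <= S -> X * tail f2 h s X <= tau) ->
  (forall s, 0 <= s <= S -> R0 f1 h s X <= tau) ->
  (forall s, 0 <= s <= S -> R0 f2 h s X <= tau) ->
  (forall x, eps <= x <= x0 -> w x <= W1) -> 0 <= L ->
  (forall x y, eps <= x -> x <= y -> `|a y - a x| <= L * (y - x) /\ `|b y - b x| <= L * (y - x)) ->
  W1 * L * h <= 1 ->
  forall t, 0 <= t <= S -> en1 eps h eta t + en2 X h eta t + V t <=
   (en1 eps h eta 0 + en2 X h eta 0 + err eps X h eta r tau W1 L * t) * expR (Cst * t).
Proof.
move=> eps0 ex0 x0X X1 h0 eta0 r0 tau0 r1 r2 t1 t2 R1 R2 wW1 L0 lip W1Lh.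
have pos x : eps <= x -> 0 < x by move=> ex; exact: lt_le_trans ex.
have posx0 x : x0 <= x -> 0 < x by move=> ex; exact: lt_le_trans ex.
have a_ge0 x : 0 < x -> 0 <= a x by move=> x1; rewrite ltW // a_gt0.
have Ege := E0_ge0; have Uge := U_ge0; have Mge := M_ge0; have wge := wx0_ge0.
have lipa x y : eps <= x -> x <= y -> `|a y - a x| <= L * (y - x).
  by move=> ex xy; case: (lip x y ex xy).
have lipb x y : eps <= x -> x <= y -> `|b y - b x| <= L * (y - x).
  by move=> ex xy; case: (lip x y ex xy).
have [ce1 [e1' He1]] : {within `[0, S], continuous (en1 eps h eta)} /\
  exists en' : R -> R, forall s, 0 < s < S -> is_derive s (1:R) (en1 eps h eta) (en' s) /\
    en' s <= w eps * (a eps * u1 s - b eps) * sabs eta (D h s eps) -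
      w x0 * (a x0 * u1 s - b x0) * sabs eta (D h s x0) +
      0 * en1 eps h eta s + W1 * (L * (U + 1) * h) * (M + M) + `|u1 s - u2 s| * (E0 + 1) * (M + M).
  apply: (@energy_inequality R a b da db adma admb a_ge0 S U M u1 u2 fin f1 f2 fl1 fl2
    h eta eps x0 h0 eta0 eps0 ex0 S0 w dw L W1 (E0 + 1) 0) => //.
  - by move=> x /andP[ex _]; apply: w_derive; exact: pos.
  - by move=> x /andP[ex _]; apply: daP; exact: pos.
  - by move=> x /andP[ex _]; apply: dbP; exact: pos.
  - by apply: itv_continuous => // x x1; exact: dw_continuous.
  - by apply: itv_continuous.
  - by apply: itv_continuous.
  - by move=> x /andP[ex _]; rewrite ltW // w_gt0 // pos.
  - by rewrite addr_ge0.
  - move=> x y xI /andP[xy yh]; have [ex xx0] := andP xI.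
    have xI' : 0 < x <= x0 by rewrite pos.
    have /andP[_ wa] := wa_bounds xI'.
    have w0 : 0 <= w x by rewrite ltW // w_gt0 // pos.
    (* [E0] bounds [w * a] at [x], and replacing [a x] by [a y] within the window costs at most
       [W1 * L * h <= 1]; hence the constant [E0 + 1]. *)
    have -> : w x * a y = w x * a x + w x * (a y - a x) by ring.
    have h1 : w x * (a y - a x) <= 1.
      apply: le_trans W1Lh; rewrite -mulrA.
      apply: le_trans (_ : w x * (L * h) <= _); last first.
        by apply: ler_wpM2r; [rewrite mulr_ge0 // ltW|exact: wW1].
      apply: ler_wpM2l => //; apply: le_trans (ler_norm _) _.
      apply: le_trans (lipa _ _ ex xy) _; apply: ler_wpM2l => //; lra.
    apply: le_trans (lerD wa h1) _; rewrite ler_peMr ?addr_ge0 // lerDl.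
    by apply: le_trans xy; rewrite ltW // pos.
  - move=> s x sS /andP[ex xx0]; apply: near_weight; first lra.
    by rewrite pos.
have [ce2 [e2' He2]] : {within `[0, S], continuous (en2 X h eta)} /\
  exists en' : R -> R, forall s, 0 < s < S -> is_derive s (1:R) (en2 X h eta) (en' s) /\
    en' s <= w x0 * (a x0 * u1 s - b x0) * sabs eta (D h s x0) -
      w x0 * (a X * u1 s - b X) * sabs eta (D h s X) +
      Ld * (U + 1) * en2 X h eta s + w x0 * (L * (U + 1) * h) * (M + M) +
      `|u1 s - u2 s| * (w x0 * A) * (M + M).
  apply: (@energy_inequality R a b da db adma admb a_ge0 S U M u1 u2 fin f1 f2 fl1 fl2
    h eta x0 X h0 eta0 x0_gt0 x0X S0 (fun=> w x0) (fun=> 0) L (w x0) (w x0 * A) (Ld * (U + 1))) => //.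
  - by move=> x /andP[ex _]; apply: daP; exact: posx0.
  - by move=> x /andP[ex _]; apply: dbP; exact: posx0.
  - exact: within_cst.
  - by apply: itv_continuous.
  - by apply: itv_continuous.
  - by move=> x y ex xy; apply: lipa => //; exact: le_trans (ltW ex0) ex.
  - by move=> x y ex xy; apply: lipb => //; exact: le_trans (ltW ex0) ex.
  - by rewrite mulr_ge0 // ltW.
  - move=> x y /andP[ex _] /andP[xy _]; rewrite -mulrA; apply: ler_wpM2l => //.
    by apply: (growth _).1; apply: lt_le_trans xy; exact: posx0.
  - move=> s x sS /andP[ex _]; rewrite mul0r add0r mulrC; apply: ler_wpM2r => //.
    have [d1 d2] := derbound ex.
    apply: le_trans (ler_norm _) _; apply: le_trans (ler_normB _ _) _.
    rewrite mulrDr mulr1; apply: lerD => //; rewrite normrM; apply: ler_pM => //.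
    by apply: (flow_u fl1); lra.
have [cV dV] := primitive_derive q_continuous.
have K12g := K12_ge0; have cqg := cq_ge0.
have err0 : 0 <= err eps X h eta r tau W1 L.
  have W10 : 0 <= W1.
    have eI : eps <= eps <= x0 by rewrite lexx ltW.
    by apply: le_trans (wW1 _ eI); rewrite ltW // w_gt0.
  have h1 := ltW h0; have h2 := ltW eta0; have h3 := ltW eps0; have h4 := ltW A_gt0.
  have h5 : 0 <= X by lra.
  by rewrite /err; do ?[done|apply: addr_ge0|apply: mulr_ge0].
have cY : {within `[0, S], continuous (fun t => en1 eps h eta t + en2 X h eta t + V t)}.
  by apply: within_continuousD => //; exact: within_continuousD.
move=> t tS.
have V0E : V 0 = 0 by rewrite /V set_itv1 Rintegral_set1.
have dY s : 0 < s < S -> is_derive s (1:R) (fun t => en1 eps h eta t + en2 X h eta t + V t)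
    (e1' s + e2' s + `|u1 s - u2 s|).
  move=> sS; have [d1 _] := He1 s sS; have [d2 _] := He2 s sS.
  exact: is_derive_sum (is_derive_sum d1 d2) (dV s sS).
have hV : (en1 eps h eta 0 + en2 X h eta 0 + V 0 + err eps X h eta r tau W1 L * t) * expR (Cst * t) =
    (en1 eps h eta 0 + en2 X h eta 0 + err eps X h eta r tau W1 L * t) * expR (Cst * t).
  by congr ((_ + _) * _); rewrite V0E addr0.
rewrite -hV.
suff G s : 0 < s < S -> e1' s + e2' s + `|u1 s - u2 s| <=
    Cst * (en1 eps h eta s + en2 X h eta s + V s) + err eps X h eta r tau W1 L.
  exact: (gronwall err0 Cst_ge0 cY dY G tS).
move=> {hV V0E t tS cY dY} sS.
have sS' : 0 <= s <= S by lra.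
have [_ i1] := He1 s sS; have [_ i2] := He2 s sS.
have L1 := left_flux sS' h0 eta0 eps0 ex0 (r1 s sS') (r2 s sS').
have L2 := right_flux sS' h0 eta0 X1 (t1 s sS') (t2 s sS').
have Q := q_bound sS' h0 eta0 eps0 ex0 x0X (R1 s sS') (R2 s sS').
have g1 := @en1_ge0 eps h eta s eta0 eps0; have g2 := @en2_ge0 X h eta s eta0.
have gV := V_ge0 s.
have KQ := ler_wpM2l (_ : 0 <= K12 + 1) Q.
have {}KQ := KQ (addr_ge0 K12g ler01).
(* [c1], [c2] and [c3] are the surplus terms created by multiplying the whole sum [en1 + en2 + V] by
   the single constant [Cst]. *)
have c1 : 0 <= E0 * U * Ln * (en1 eps h eta s + en2 X h eta s).
  by apply: mulr_ge0; [rewrite !mulr_ge0|exact: addr_ge0].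
have c2 : 0 <= Ld * (U + 1) * (en1 eps h eta s + V s).
  by apply: mulr_ge0; [rewrite mulr_ge0 // addr_ge0|exact: addr_ge0].
have c3 : 0 <= (K12 + 1) * cq * V s.
  by apply: mulr_ge0 => //; apply: mulr_ge0 => //; exact: addr_ge0.
have i12 : e1' s + e2' s + `|u1 s - u2 s| <=
   E0 * U * (Ln * V s + (r + eta)) + w x0 * (A * (2 * (U + 1))) * (tau + tau + X * eta) +
   Ld * (U + 1) * en2 X h eta s + (W1 + w x0) * (L * (U + 1) * h) * (M + M) +
   (K12 + 1) * `|u1 s - u2 s|.
  have -> : (K12 + 1) * `|u1 s - u2 s| = `|u1 s - u2 s| * (E0 + 1) * (M + M) +
    `|u1 s - u2 s| * (w x0 * A) * (M + M) + `|u1 s - u2 s| by rewrite /K12; ring.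
  have -> : (W1 + w x0) * (L * (U + 1) * h) * (M + M) =
    W1 * (L * (U + 1) * h) * (M + M) + w x0 * (L * (U + 1) * h) * (M + M) by ring.
  move: i1 i2 L1 L2; rewrite mul0r addr0.
  move: (w x0 * (a x0 * u1 s - b x0) * _) (w x0 * (a X * u1 s - b X) * _)
    (w eps * _ * _) (W1 * _ * (M + M)) (w x0 * (L * (U + 1) * h) * (M + M))
    (`|u1 s - u2 s| * (E0 + 1) * _) (`|u1 s - u2 s| * (w x0 * A) * _) (Ld * (U + 1) * en2 X h eta s)
    (E0 * U * _) (w x0 * (A * (2 * (U + 1))) * _).
  move: (e1' s) (e2' s) `|u1 s - u2 s| => {c1 c2 c3 KQ Q g1 g2 gV} *; lra.
apply: (le_trans i12); apply: (le_trans (lerD (lexx _) KQ)).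
rewrite /err /Cst; move: c1 c2 c3.
set n1 := en1 eps h eta s; set n2 := en2 X h eta s; set vs := V s.
set z := E0 * U; set z2 := w x0 * (A * (2 * (U + 1))) * _; set z3 := (W1 + w x0) * _ * _.
set z4 := (eps + h) * (M + M) + (tau + tau); set z5 := Ld * (U + 1); set z6 := K12 + 1.
move=> c1 c2 c3; rewrite -subr_ge0.
rewrite (_ : _ - _ = z * Ln * (n1 + n2) + z5 * (n1 + vs) + z6 * cq * vs); last by ring.
by rewrite !addr_ge0.
Qed.

Lemma cut_le_sstep h eps k y : 0 < h -> eps + h <= k.+1%:R^-1 -> cut k y <= sstep h eps y.
Proof.
move=> h0 ehk; have [yk|ky] := leP y (k.+1%:R^-1).
  by rewrite /cut sstep_eq0 ?kinv_gt0 //; case/andP: (sstep01 h eps y).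
rewrite (@sstep_eq1 _ h eps) //; first by case/andP: (cut01 k y).
by apply: le_trans ehk _; exact: ltW.
Qed.

(** Markov's inequality: beyond [X] one has [X <= y], and the cutoff [sstep 1 k] is already 1 there
    because [k + 1 <= X]. *)
Lemma sstep_le_tailmean h X k y : 0 < h -> k.+1%:R <= X -> 0 < y ->
  X * sstep h X y <= sstep 1 k%:R y * y.
Proof.
move=> h0 kX y0; have [yX|Xy] := leP y X.
  rewrite sstep_eq0 // mulr0; apply: mulr_ge0; last exact: ltW.
  by case/andP: (sstep01 1 k%:R y).
rewrite (@sstep_eq1 _ 1) //; last by rewrite -natr1 in kX; lra.
rewrite mul1r; apply: le_trans (ltW Xy).
rewrite -[leRHS]mulr1; apply: ler_wpM2l.
  by apply: le_trans kX.
by case/andP: (sstep01 h X y).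
Qed.

Lemma sramp_le_tailmean h X k y : 0 < h -> k.+1%:R <= X -> 0 < y ->
  sramp h X y <= sstep 1 k%:R y * y.
Proof.
move=> h0 kX y0; have /andP[_ sr] := sramp_bounds X y h0; apply: le_trans sr _.
have X0 : 0 <= X by apply: le_trans kX.
have [yX|Xy] := leP y X.
  rewrite (_ : Num.max _ _ = 0); last by apply/max_idPl; rewrite subr_le0.
  by apply: mulr_ge0; [case/andP: (sstep01 1 k%:R y)|exact: ltW].
rewrite (@sstep_eq1 _ 1) //; last by rewrite -natr1 in kX; lra.
by rewrite mul1r ge_max (ltW y0) gerBl.
Qed.

Lemma D_init h x : 0 < h -> 0 < x -> D h 0 x = 0.
Proof. by move=> h0 x1; rewrite /D /tail (flow_init fl1) // (flow_init fl2) // subrr. Qed.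

(** The value of [err] divided by [e] when [r], [tau], [eps], [h], [eta], [X * eta] and the
    commutator term are all replaced by [e]. *)
Let Kerr := E0 * U * 2 + w x0 * (A * (2 * (U + 1))) * 3 + 1 + (K12 + 1) * (2 * (M + M) + 2).

(** The order of the choices matters. Dini's theorem gives [k] from [e]; then [eps] is taken small
    and [X] large in terms of [k]. Only now are the weight bound [W1] and the Lipschitz constant [L]
    on [[eps, +oo)] available, and [h] is chosen small against them; [eta] is chosen against [X] and
    the integral of the weight. *)
Lemma parameters (al ga e : R) : 0 < al -> 0 < e -> e <= 1 ->
  exists eps X h eta, [/\ [/\ 0 < h, h <= e & 0 < eta],
   [/\ 0 < eps, eps < x0, eps <= al, ga <= X & x0 < X] &
   forall t, 0 <= t <= S -> en1 eps h eta t + en2 X h eta t <=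
     (1 + Kerr * S) * expR (Cst * S) * e].
Proof.
move=> al0 e0 e1.
have Ege := E0_ge0; have Uge := U_ge0; have Mge := M_ge0; have wge := wx0_ge0.
have K12g := K12_ge0.
have [k1 Hk1] := tailmean_small fl1 e0; have [k2 Hk2] := tailmean_small fl2 e0.
have [k3 Hk3] := mass_near0_small fl1 cmass1 e0.
have [k4 Hk4] := mass_near0_small fl2 cmass2 e0.
pose k := maxn (maxn k1 k2) (maxn k3 k4).
have {}Hk1 s (sS : 0 <= s <= S) : mom (f1 s) (fun y => sstep 1 k%:R y * y) <= e.
  by apply/ltW/Hk1 => //; rewrite !leq_max leqnn.
have {}Hk2 s (sS : 0 <= s <= S) : mom (f2 s) (fun y => sstep 1 k%:R y * y) <= e.
  by apply/ltW/Hk2 => //; rewrite !leq_max leqnn orbT.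
have {}Hk3 s (sS : 0 <= s <= S) : mom (f1 s) (cst 1) - mom (f1 s) (cut k) <= e.
  by apply/ltW/Hk3 => //; rewrite !leq_max leqnn !orbT.
have {}Hk4 s (sS : 0 <= s <= S) : mom (f2 s) (cst 1) - mom (f2 s) (cut k) <= e.
  by apply/ltW/Hk4 => //; rewrite !leq_max leqnn !orbT.
pose hk : R := k.+1%:R^-1; have hk0 : 0 < hk := @kinv_gt0 R k.
pose eps := Num.min (Num.min e al) (Num.min (hk / 2) (x0 / 2)).
have eps0 : 0 < eps by rewrite !lt_min e0 al0 !divr_gt0.
have epse : eps <= e by rewrite !ge_min lexx.
have epsal : eps <= al by rewrite !ge_min lexx orbT.
have epsk : eps <= hk / 2 by rewrite !ge_min lexx !orbT.
have epsx0 : eps < x0.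
  by apply: (@le_lt_trans _ _ (x0 / 2)); [rewrite !ge_min lexx !orbT|move: x0_gt0; lra].
pose X := Num.max k.+1%:R (Num.max ga (x0 + 1)).
have Xk : k.+1%:R <= X by rewrite le_max lexx.
have Xga : ga <= X by rewrite !le_max lexx orbT.
have Xx0 : x0 < X.
  by apply: (@lt_le_trans _ _ (x0 + 1)); [rewrite ltrDl|rewrite !le_max lexx !orbT].
have X1 : 1 <= X by apply: le_trans Xk; rewrite ler1n.
have X0 : 0 < X by lra.
have [W1 [W10 HW1]] := within_continuous_bounded (@w_within eps x0 eps0).
have [L L0 HL] := lips eps0.
pose Q := (W1 + w x0) * (L * (U + 1)) * (M + M).
have Q0 : 0 <= Q by rewrite /Q; do ?[done|apply: addr_ge0|apply: mulr_ge0].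
have Q1 : 0 < Q + 1 by rewrite ltr_wpDl.
have WL1 : 0 < W1 * L + 1 by rewrite ltr_wpDl // mulr_ge0.
(* [hk / 2] gives [eps + h <= hk], so that [cut k] lies below [sstep h eps]; the last two entries
   give [W1 * L * h <= 1] and a commutator term at most [e]. *)
pose h := Num.min (Num.min e (hk / 2)) (Num.min (W1 * L + 1)^-1 (e / (Q + 1))).
have h0 : 0 < h by rewrite !lt_min e0 !divr_gt0 // invr_gt0 WL1.
have he : h <= e by rewrite !ge_min lexx.
have hhk : h <= hk / 2 by rewrite !ge_min lexx !orbT.
have hW : W1 * L * h <= 1.
  have : h <= (W1 * L + 1)^-1 by rewrite !ge_min lexx !orbT.
  move=> H; apply: le_trans (_ : (W1 * L + 1) * h <= _).
    by apply: ler_wpM2r; [exact: ltW|rewrite lerDl].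
  by rewrite -ler_pdivlMl // mulr1.
have hQ : Q * h <= e.
  have : h <= e / (Q + 1) by rewrite !ge_min lexx !orbT.
  rewrite ler_pdivlMr // => H; apply: le_trans H; rewrite mulrC.
  by apply: ler_wpM2l; [exact: ltW|rewrite lerDl].
pose I1 := Rintegral mu `[eps, x0] w; pose I2 := Rintegral mu `[x0, X] (cst (w x0)).
have I10 : 0 <= I1.
  apply: Rintegral_ge0 => x /=; rewrite in_itv /= => /andP[ex _].
  by rewrite ltW // w_gt0 // (lt_le_trans eps0).
have I20 : 0 <= I2 by apply: Rintegral_ge0.
have I1g : 0 < I1 + I2 + 1 by rewrite ltr_wpDl // addr_ge0.
(* [e / X] serves the flux at [X]; the last entry serves the initial energy, which is
   [eta * (I1 + I2)] because [D] vanishes at time 0. *)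
pose eta := Num.min e (Num.min (e / X) (e / (I1 + I2 + 1))).
have eta0 : 0 < eta by rewrite !lt_min e0 !divr_gt0.
have etae : eta <= e by rewrite !ge_min lexx.
have etaX : X * eta <= e.
  have : eta <= e / X by rewrite !ge_min lexx !orbT.
  by rewrite ler_pdivlMr // mulrC.
have etaI : eta * (I1 + I2) <= e.
  have : eta <= e / (I1 + I2 + 1) by rewrite !ge_min lexx !orbT.
  rewrite ler_pdivlMr // => H; apply: le_trans H.
  by apply: ler_wpM2l; [exact: ltW|rewrite lerDl].
have ehk : eps + h <= k.+1%:R^-1 by rewrite -/hk; lra.
exists eps, X, h, eta; split => // t tS.
have mcut f u s : flow a b S U M u fin f -> 0 <= s <= S ->
    mom (f s) (cst 1) - mom (f s) (cut k) <= e -> mom (f s) (cst 1) - tail f h s eps <= e.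
  move=> fl sS; apply: le_trans; rewrite lerD2l lerN2.
  apply: mom_le; [exact: (flow_dens fl)|exact: adm_cut|exact: adm_sstep1|].
  by move=> y _; exact: cut_le_sstep.
have mtail f u s : flow a b S U M u fin f -> 0 <= s <= S ->
    mom (f s) (fun y => sstep 1 k%:R y * y) <= e -> X * tail f h s X <= e.
  move=> fl sS; apply: le_trans; have d := flow_dens fl sS.
  have a1 := adm_sstep1 h X; rewrite /tail -momZ //.
  apply: mom_le => //; [exact: admZ|exact: adm_tailmean|].
  by move=> y y0; exact: sstep_le_tailmean.
have mramp f u s : flow a b S U M u fin f -> 0 <= s <= S ->
    mom (f s) (fun y => sstep 1 k%:R y * y) <= e -> R0 f h s X <= e.
  move=> fl sS; apply: le_trans; have d := flow_dens fl sS.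
  apply: mom_le => //; [exact: adm_sramp|exact: adm_tailmean|].
  by move=> y y0; exact: sramp_le_tailmean.
have e0' := ltW e0.
have HW1' x : eps <= x <= x0 -> w x <= W1.
  by move=> xI; apply: le_trans (HW1 _ xI); exact: ler_norm.
have E := stability_estimate eps0 epsx0 Xx0 X1 h0 eta0 e0' e0'
  (fun s sS => mcut _ _ s fl1 sS (Hk3 s sS)) (fun s sS => mcut _ _ s fl2 sS (Hk4 s sS))
  (fun s sS => mtail _ _ s fl1 sS (Hk1 s sS)) (fun s sS => mtail _ _ s fl2 sS (Hk2 s sS))
  (fun s sS => mramp _ _ s fl1 sS (Hk1 s sS)) (fun s sS => mramp _ _ s fl2 sS (Hk2 s sS))
  HW1' L0 HL hW tS.
have init1 : en1 eps h eta 0 = eta * I1.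
  rewrite /I1 -RintegralZl //; last by apply: within_integrable; exact: w_within.
  apply: eq_Rintegral => x; rewrite inE /= in_itv /= => /andP[ex _].
  rewrite (D_init h0); last exact: lt_le_trans ex.
  by rewrite sabs0 // mulrC.
have init2 : en2 X h eta 0 = eta * I2.
  rewrite /I2 -RintegralZl //; last by apply: within_integrable; exact: within_cst.
  apply: eq_Rintegral => x; rewrite inE /= in_itv /= => /andP[ex _].
  rewrite (D_init h0); last exact: lt_le_trans ex.
  by rewrite sabs0 // mulrC.
have errle : err eps X h eta e e W1 L <= Kerr * e.
  have z1 : 0 <= E0 * U by rewrite mulr_ge0.
  have z2 : 0 <= w x0 * (A * (2 * (U + 1))).
    by do ?[done|apply: addr_ge0|apply: mulr_ge0|exact: ltW].
  have z3 : 0 <= K12 + 1 by rewrite addr_ge0.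
  have MM : 0 <= M + M by rewrite addr_ge0.
  have p1 : E0 * U * (e + eta) <= E0 * U * (2 * e) by rewrite mulr_natl mulr2n; apply: ler_wpM2l => //; rewrite lerD2l.
  have p2 : w x0 * (A * (2 * (U + 1))) * (e + e + X * eta) <=
      w x0 * (A * (2 * (U + 1))) * (3 * e).
    apply: ler_wpM2l => //; rewrite (_ : 3 * e = e + e + e); first by rewrite lerD2l.
    by ring.
  have p3 : (W1 + w x0) * (L * (U + 1) * h) * (M + M) <= e.
    by apply: le_trans hQ; rewrite /Q le_eqVlt; apply/orP; left; apply/eqP; ring.
  have p4 : (K12 + 1) * ((eps + h) * (M + M) + (e + e)) <=
      (K12 + 1) * ((e + e) * (M + M) + (e + e)).
    by apply: ler_wpM2l => //; rewrite lerD2r; apply: ler_wpM2r => //; exact: lerD.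
  apply: le_trans (lerD (lerD (lerD p1 p2) p3) p4) _.
  rewrite /Kerr le_eqVlt; apply/orP; left; apply/eqP.
  by move: (E0 * U) (w x0 * _) (K12 + 1) (M + M) => *; ring.
have Kerr0 : 0 <= Kerr.
  by rewrite /Kerr; do ?[done|apply: addr_ge0|apply: mulr_ge0|exact: ltW].
have [t0 tS'] := andP tS.
apply: le_trans (_ : en1 eps h eta t + en2 X h eta t + V t <= _).
  by rewrite lerDl; exact: V_ge0.
apply: (le_trans E); rewrite init1 init2 -mulrDr mulrAC.
apply: ler_pM.
- by rewrite /err; do ?[done|apply: addr_ge0|apply: mulr_ge0|exact: ltW].
- exact: expR_ge0.
- rewrite [leRHS]mulrDl mul1r; apply: lerD => //; rewrite [leRHS]mulrAC.
  apply: le_trans (_ : Kerr * e * t <= _); first exact: ler_wpM2r.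
  by apply: ler_wpM2l => //; rewrite mulr_ge0.
- by rewrite ler_expR; apply: ler_wpM2l => //; exact: Cst_ge0.
Qed.

Lemma adm_excess (z : R) : adm (fun y => Num.max 0 (y - z)).
Proof.
split.
  apply: measurable_maxr; first exact: measurable_cst.
  by apply: continuous_measurable_HL => y; apply: cvgB; [exact: cvg_id|exact: cvg_cst].
exists (1 + `|z|) => y y0; rewrite ger0_norm ?le_max ?lexx // ge_max; apply/andP; split.
  by rewrite mulr_ge0 ?addr_ge0 // ltW.
have := ler_norm (- z); rewrite normrN => h.
have : 0 <= `|z| * y by rewrite mulr_ge0 // ltW.
rewrite mulrDl mul1r mulrDr mulr1; lra.
Qed.

Lemma R0_excess f u h s x : flow a b S U M u fin f -> 0 <= s <= S -> 0 < h ->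
  `|mom (f s) (fun y => Num.max 0 (y - x)) - R0 f h s x| <= h * M.
Proof.
move=> fl sS h0; have d := flow_dens fl sS.
have ar := adm_sramp x h0; have ae := adm_excess x.
rewrite -momB //.
apply: le_trans (_ : mom (f s) (fun y => h * cst 1 y) <= _).
  apply: mom_norm_le => //; [exact: admB|exact: admZ (adm_cst _)|].
  move=> y y0; have /andP[l1 l2] := sramp_bounds x y h0.
  rewrite mulr1 ger0_norm ?subr_ge0 // lerBlDr ge_max.
  move: l1; rewrite ge_max => /andP[l3 l4]; apply/andP; split; lra.
rewrite momZ //; last exact: adm_cst.
by apply: ler_wpM2l; [exact: ltW|exact: (flow_mass fl)].
Qed.

Let Q f t x := mom (f t) (fun y => Num.max 0 (y - x)).

(** Letting [e] tend to 0 shows that the difference of the tails has integral 0 over [[al, ga]]. It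
    is expressed through the moments of the positive part of [y - x], from which every auxiliary
    parameter has disappeared. *)
Lemma stability t (al ga : R) : 0 <= t <= S -> 0 < al -> al <= x0 -> x0 <= ga ->
  Q f1 t al - Q f2 t al = Q f1 t ga - Q f2 t ga.
Proof.
move=> tS al0 alx0 x0ga; apply/eqP; rewrite -subr_eq0; apply/eqP.
(* Here [e] is the inverse of [z]; the term [4 * M] pays for replacing [sramp] by the positive part
   at two points for two solutions. *)
apply: (@le_over_eq0 _ _ (cq * ((1 + Kerr * S) * expR (Cst * S)) + 4 * M)) => z z1.
have z0 : 0 < z by lra.
have e0 : 0 < z^-1 by rewrite invr_gt0.
have e1 : z^-1 <= 1 by rewrite invf_le1.
have [eps [X [h [eta [[h0 he eta0] [eps0 ex0 eal gaX x0X] E]]]]] := parameters ga al0 e0 e1.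
have B := energy_controls tS h0 eta0 eps0 ex0 eal alx0 x0ga gaX x0X.
have B2 := ler_wpM2l cq_ge0 (E t tS).
have hM : h * M <= z^-1 * M by apply: ler_wpM2r => //; exact: M_ge0.
have n1 := R0_excess al fl1 tS h0; have n2 := R0_excess al fl2 tS h0.
have n3 := R0_excess ga fl1 tS h0; have n4 := R0_excess ga fl2 tS h0.
have {B B2}B := le_trans B B2.
have -> : (cq * ((1 + Kerr * S) * expR (Cst * S)) + 4 * M) / z =
  cq * ((1 + Kerr * S) * expR (Cst * S) * z^-1) + 4 * (z^-1 * M) by ring.
move: B n1 n2 n3 n4; rewrite !ler_norml -/(Q f1 t al) -/(Q f2 t al) -/(Q f1 t ga) -/(Q f2 t ga).
move: (cq * _) hM => c hM => /andP[? ?] /andP[? ?] /andP[? ?] /andP[? ?] /andP[? ?].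
apply/andP; split; lra.
Qed.

End Stability.

(** * Uniqueness *)

Section Tails.
Variable R : realType.
Notation mu := (@lebesgue_measure R).
Notation HL := (@halfline R).
Implicit Types (x y z : R) (phi g : R -> R) (k : nat).

Definition above x y : R := if x < y then 1 else 0.

Lemma above01 x y : 0 <= above x y <= 1.
Proof. by rewrite /above; case: (x < y); rewrite lexx ler01. Qed.

Lemma measurable_above x : measurable_fun HL (above x).
Proof.
have -> : above x = \1_(`]x, +oo[%classic : set R).
  by apply/funext => y; rewrite indicE mem_setE in_itv /= andbT /above; case: (x < y).
exact: measurable_indic.
Qed.

Lemma adm_above x : adm (above x).
Proof.
split; first exact: measurable_above.
exists 1 => y y0; have /andP[q0 q1] := above01 x y.
by rewrite ger0_norm // mul1r; lra.
Qed.

Let hinv k : R := k.+1%:R^-1.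
(** Difference quotient in [x], up to sign, of the positive part of [y - x]. It lies between 0 and 1
    and converges to the indicator of [(x, +oo)], so that tails are recovered from excess
    moments. *)
Let quot k x y := k.+1%:R * (Num.max 0 (y - x) - Num.max 0 (y - (x + hinv k))).

Lemma hinv_gt0 k : 0 < hinv k. Proof. by rewrite invr_gt0. Qed.

Lemma quot01 k x y : 0 <= quot k x y <= 1.
Proof.
have h0 := hinv_gt0 k; have k0 : (0 : R) < k.+1%:R by [].
have hk : 1 = k.+1%:R * hinv k by rewrite /hinv mulfV ?gt_eqF.
rewrite /quot [X in _ <= _ <= X]hk; apply/andP; split.
  apply: mulr_ge0; first exact: ltW.
  by rewrite subr_ge0 ge_max le_max lexx /= le_max; apply/orP; right; lra.
apply: ler_wpM2l; first exact: ltW.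
rewrite lerBlDr ge_max; apply/andP; split; first by apply: addr_ge0; [exact: ltW|rewrite le_max lexx].
by rewrite -lerBlDl le_max; apply/orP; right; lra.
Qed.

Lemma quot_cvg x y : quot k x y @[k --> \oo] --> above x y.
Proof.
rewrite /above; have [xy|yx] := ltP x y; last first.
  apply: cvg_near_cst; apply: nearW => k; have h0 := hinv_gt0 k.
  rewrite /quot (_ : Num.max 0 (y - x) = 0); last by apply/max_idPl; lra.
  by rewrite (_ : Num.max _ _ = 0) ?subr0 ?mulr0 //; apply/max_idPl; lra.
apply: cvg_near_cst; exists (Num.truncn (y - x)^-1).+1 => // k /= Hk.
have hk : hinv k <= y - x.
  rewrite /hinv -(invrK (y - x)) lef_pV2 ?posrE ?invr_gt0 ?subr_gt0 //.
  apply: ltW; apply: lt_trans (truncnS_gt _) _; rewrite ltr_nat.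
  exact: leq_ltn_trans Hk _.
rewrite /quot (_ : Num.max 0 (y - x) = y - x); last by apply/max_idPr; lra.
rewrite (_ : Num.max _ _ = y - (x + hinv k)); last by apply/max_idPr; lra.
have -> : y - x - (y - (x + hinv k)) = hinv k by ring.
by rewrite mulfV.
Qed.

Lemma measurable_quot k x : measurable_fun HL (quot k x).
Proof.
apply: measurable_funM; first exact: measurable_cst.
by apply: measurable_funB; [case: (adm_excess x)|case: (adm_excess (x + hinv k))].
Qed.

Lemma mom_quot_cvg phi x : dens phi ->
  mom phi (quot k x) @[k --> \oo] --> mom phi (above x).
Proof.
move=> d; apply: (@mom_cvg _ _ _ _ 1) => //.
- by move=> k; exact: measurable_quot.
- move=> k y y0; have /andP[q0 q1] := quot01 k x y.
  by rewrite ger0_norm // mul1r; lra.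
- by move=> y _; exact: quot_cvg.
Qed.

Lemma mom_quotE phi k x : dens phi -> mom phi (quot k x) =
  k.+1%:R * (mom phi (fun y => Num.max 0 (y - x)) -
             mom phi (fun y => Num.max 0 (y - (x + hinv k)))).
Proof.
move=> d; have a1 := adm_excess x; have a2 := adm_excess (x + hinv k).
by rewrite -momB // -momZ //; exact: admB.
Qed.

Variables (phi1 phi2 : R -> R) (x0 : R).
Hypothesis d1 : dens phi1.
Hypothesis d2 : dens phi2.
Let G x := mom phi1 (fun y => Num.max 0 (y - x)) - mom phi2 (fun y => Num.max 0 (y - x)).
Hypothesis x0_gt0 : 0 < x0.
Hypothesis Gcst : forall al ga : R, 0 < al -> al <= x0 -> x0 <= ga -> G al = G ga.

Lemma excess_cst x : 0 < x -> G x = G x0.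
Proof.
by move=> x1; have [h|h] := leP x x0; [exact: Gcst|symmetry; apply: Gcst => //; exact: ltW].
Qed.

Lemma mom_above_eq x : 0 < x -> mom phi1 (above x) = mom phi2 (above x).
Proof.
move=> x1; have H := @mom_quot_cvg phi1 x d1.
apply: (cvg_unique (@Rhausdorff R) H).
have -> : (fun k => mom phi1 (quot k x)) = (fun k => mom phi2 (quot k x)).
  apply/funext => k; rewrite !mom_quotE //; congr (_ * _).
  have := excess_cst x1; rewrite -(excess_cst (_ : 0 < x + hinv k)).
    by rewrite /G; lra.
  by rewrite addr_gt0 // hinv_gt0.
exact: mom_quot_cvg.
Qed.

Lemma mom_above_cvg phi : dens phi ->
  mom phi (above (hinv k)) @[k --> \oo] --> mom phi (cst 1).
Proof.
move=> d; apply: (@mom_cvg _ _ _ _ 1) => //.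
- by move=> k; exact: measurable_above.
- move=> k y y0; have /andP[q0 q1] := above01 (hinv k) y.
  by rewrite ger0_norm // mul1r; lra.
- move=> y y0; apply: cvg_near_cst; exists (Num.truncn y^-1).+1 => // k /= Hk.
  rewrite /above (_ : hinv k < y) //.
  rewrite /hinv -(invrK y) ltf_pV2 ?posrE ?invr_gt0 //.
  apply: lt_trans (truncnS_gt _) _; rewrite ltr_nat.
  exact: leq_ltn_trans Hk _.
Qed.

Lemma mass_eq : mom phi1 (cst 1) = mom phi2 (cst 1).
Proof.
have H := mom_above_cvg d1; apply: (cvg_unique (@Rhausdorff R) H).
have -> : (fun k => mom phi1 (above (hinv k))) = (fun k => mom phi2 (above (hinv k))).
  by apply/funext => k; rewrite mom_above_eq // hinv_gt0.
exact: mom_above_cvg.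
Qed.

Let psi x := phi1 x - phi2 x.

Lemma integrable_psi : mu.-integrable HL (EFin \o psi).
Proof.
have [i1 _ _] := d1; have [i2 _ _] := d2.
rewrite (_ : EFin \o psi = (fun x => (EFin \o phi1) x - (EFin \o phi2) x)%E) //.
by apply: integrableB => //; exact: measurable_HL.
Qed.

Lemma integrable_psi_patch : mu.-integrable [set: R] (EFin \o (psi \_ HL)).
Proof.
have := (@integrable_mkcond _ _ _ mu HL (EFin \o psi) (@measurable_HL R)).1 integrable_psi.
by rewrite restrict_EFin.
Qed.

(** For [x > 0] this is the difference of the masses minus that of the tails at [x]; the masses
    agree as limits of tails at 0. For [x <= 0] the integrand vanishes. *)
Lemma psi_primitive x : Rintegral mu `]-oo, x] (psi \_ HL) = 0.
Proof.
have -> : Rintegral mu `]-oo, x] (psi \_ HL) = Rintegral mu HL (fun y => (1 - above x y) * psi y).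
  rewrite -Rintegral_mkcondr setIC Rintegral_mkcondr; apply: eq_Rintegral => y _.
  rewrite patchE mem_setE in_itv /= /above ltNge; case: (y <= x); rewrite ?subr0 ?mul1r //.
  by rewrite subrr mul0r.
have ma : adm (fun y => 1 - above x y) by apply: admB; [exact: adm_cst|exact: adm_above].
have -> : Rintegral mu HL (fun y => (1 - above x y) * psi y) =
   mom phi1 (fun y => 1 - above x y) - mom phi2 (fun y => 1 - above x y).
  have j1 := adm_integrable d1 ma; have j2 := adm_integrable d2 ma.
  rewrite /mom -RintegralB //; last exact: measurable_HL.
  by apply: eq_Rintegral => y _; rewrite /psi mulrBr.
have [x1|x1] := ltP 0 x.
  have a1 := adm_cst (1 : R); have a2 := adm_above x.
  rewrite !momB // mass_eq mom_above_eq //; ring.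
have E phi : dens phi -> mom phi (fun y => 1 - above x y) = 0.
  move=> d.
  rewrite (@eq_mom _ _ _ (cst 0)); last by move=> y y0; rewrite /above (le_lt_trans x1 y0) subrr.
  have := momZ 0 d (adm_cst (0 : R)); rewrite mul0r => H; rewrite -[RHS]H.
  by apply: eq_mom => y _; rewrite mul0r.
by rewrite !E // subrr.
Qed.

(** Lebesgue differentiation: almost everywhere the difference of the densities is the derivative of
    its own primitive, which is 0. A constant excess difference [G] is enough, since only increments
    of [G] enter the tails. *)
Lemma ae_eq_of_excess : {ae mu, forall x, x \in HL -> phi1 x = phi2 x}.
Proof.
have li : locally_integrable setT (psi \_ HL).
  have mp : measurable_fun setT (psi \_ HL).
    by apply/measurable_EFinP; apply: measurable_int integrable_psi_patch.
  split => //; first exact: openT.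
  move=> K _ cK; have mK : measurable K by apply: closed_measurable; exact: compact_closed cK.
  have /integrableP[_] := @integrableS _ _ _ mu _ _ _ measurableT mK (@subsetT _ K) integrable_psi_patch.
  by [].
have iy y : mu.-integrable `]-oo, y] (EFin \o (psi \_ HL)).
  apply: integrableS integrable_psi_patch => //; exact: measurable_itv.
have H := FTC1Ny iy li.
apply: filterS H; first exact: (ae_filter_ringOfSetsType mu).
move=> x [_ /= H] xHL.
have : (psi \_ HL) x = 0.
  rewrite -H (_ : (fun x0 => _) = cst 0); first by rewrite derive1_cst.
  by apply/funext => z; exact: psi_primitive.
by rewrite patchE xHL => /eqP; rewrite subr_eq0 => /eqP.
Qed.

End Tails.

(** * Growth and Lipschitz bounds for the rates, and monotonicity *)

Section Rates.
Variable R : realType.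
Implicit Types (g : R -> R) (x y al L M A : R).

Lemma derive1_is_derive g x : derivable g x 1 -> is_derive x (1:R) g (derive1 g x).
Proof. by move=> d; apply: DeriveDef => //; rewrite derive1E. Qed.

(** The derivative is bounded on [[al, 2]] by compactness and beyond 2 by assumption; the constant
    may blow up as [al] tends to 0. *)
Lemma rate_lip g M : (forall x, 0 < x -> derivable g x 1 /\ {for x, continuous (derive1 g)}) ->
  (forall x, 1 < x -> `|derive1 g x| <= M) ->
  forall al, 0 < al -> exists2 L, 0 <= L &
    (forall x, al <= x -> `|derive1 g x| <= L) /\
    forall x y, al <= x -> x <= y -> `|g y - g x| <= L * (y - x).
Proof.
move=> dg gM al al0.
have c : {within `[al, 2], continuous (derive1 g)}.
  apply: itv_continuous => // x x0; exact: (dg x x0).2.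
have [K [K0 HK]] := within_continuous_bounded c.
have B x : al <= x -> `|derive1 g x| <= K + `|M|.
  move=> ax; have [x2|x2] := leP x 2.
    by apply: le_trans (HK x _) _; [rewrite ax|rewrite lerDl].
  apply: le_trans (_ : M <= _); first by apply: gM; lra.
  by apply: le_trans (ler_norm M) _; rewrite lerDr.
exists (K + `|M|); first by rewrite addr_ge0.
split=> // x y ax xy; rewrite -[y - x]ger0_norm ?subr_ge0 //.
have dr z : x <= z <= y -> is_derive z (1:R) g (derive1 g z).
  move=> /andP[xz _]; apply: derive1_is_derive; apply: (dg z _).1.
  exact: lt_le_trans (le_trans ax xz).
apply: (@is_derive_lip _ g (derive1 g) _ x y); rewrite ?lexx ?xy //.
- exact: within_is_derive dr.
- by move=> z zI; apply: dr; lra.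
- by move=> z zI; apply: B; lra.
Qed.

Lemma rate_growth g M : {within `[0, +oo[, continuous g} ->
  (forall x, 0 < x -> derivable g x 1 /\ {for x, continuous (derive1 g)}) ->
  (forall x, 1 < x -> `|derive1 g x| <= M) ->
  exists2 A, 0 < A & forall x, 0 <= x -> `|g x| <= A * (1 + x).
Proof.
move=> cg dg gM.
have c : {within `[0, 1], continuous g}.
  apply: continuous_subspaceW cg => x /=; rewrite !in_itv /= => /andP[x0 _].
  by rewrite x0.
have [K [K0 HK]] := within_continuous_bounded c.
have [L L0 [_ HL]] := rate_lip dg gM (@ltr01 R).
exists (K + L + 1); first by rewrite ltr_wpDl // addr_ge0.
move=> x x0; have [x1|x1] := leP x 1.
  apply: le_trans (HK x _) _; first by rewrite x0.
  have : 0 <= (K + L) * x by rewrite mulr_ge0 // addr_ge0.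
  rewrite (_ : (K + L + 1) * (1 + x) = K + L + (K + L) * x + (1 + x)); last by ring.
  lra.
have h1 := HK 1 (_ : 0 <= 1 <= 1); have {}h1 : `|g 1| <= K by apply: h1; rewrite ler01 lexx.
have h2 := HL 1 x (lexx _) (ltW x1).
have -> : g x = g 1 + (g x - g 1) by ring.
apply: le_trans (ler_normD _ _) _.
have : 0 <= K * x by rewrite mulr_ge0.
move: h2; rewrite mulrBr !mulrDl !mulrDr !mulr1 mul1r; lra.
Qed.

Lemma is_derive_mono_ge0 g xs x dg : (forall y z, 0 < y -> y <= z -> z < xs -> g y <= g z) ->
  0 < x -> x < xs -> is_derive x (1:R) g dg -> 0 <= dg.
Proof.
move=> mg x0 xxs [dv <-].
have /cvg_ex[l Hl] := dv.
have -> : 'D_1 g x = l by apply: cvg_lim => //.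
have H : {near (0:R)^'+, forall h, 0 <= h^-1 *: (g (h *: 1 + x) - g x)}.
  near=> h; have h0 : 0 < h by near: h; exact: nbhs_right_gt.
  have hx : h < xs - x by near: h; apply: nbhs_right_lt; rewrite subr_gt0.
  rewrite /GRing.scale /= mulr1; apply: mulr_ge0; first by rewrite invr_ge0 ltW.
  rewrite subr_ge0; apply: mg => //; lra.
have Hr : (h^-1 *: (g (h *: 1 + x) - g x)) @[h --> (0:R)^'+] --> l.
  exact: cvg_dnbhs_at_right Hl.
rewrite -(cvg_lim (@Rhausdorff R) Hr); apply: limr_ge H.
by apply/cvg_ex; exists l.
Unshelve. all: by end_near. Qed.

End Rates.

(** * Solutions provide flows, with controlled masses *)

Section FlowOfSolution.
Variable R : realType.
Notation mu := (@lebesgue_measure R).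
Notation HL := (@halfline R).
Implicit Types (f : R -> R -> R) (s t x y S M U : R).
Variables (rho Phi0 T A : R) (a b n fin : R -> R).
Hypothesis ab0 : forall x, 0 <= x -> 0 <= a x /\ 0 <= b x.
Hypothesis ca : {within `[0, +oo[, continuous a}.
Hypothesis cb : {within `[0, +oo[, continuous b}.
Hypothesis growth : forall x, 0 <= x -> a x <= A * (1 + x) /\ b x <= A * (1 + x).
Hypothesis nlip : forall K, exists L : R, forall s r, Phi0 <= s <= K -> Phi0 <= r <= K ->
       `|n s - n r| <= L * `|s - r|.
Hypothesis dfin : dens fin.

(** Every sufficiently large [M] is allowed, so that one bound can serve both solutions. *)
Lemma solution_flow f S : LS_solution T rho Phi0 a b n fin f -> 0 < S -> S < T ->
  exists M0, forall M, M0 <= M ->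
    flow a b S (`|Phi0| + `|rho|) M (LS_u rho f) fin f.
Proof.
move=> sol S0 ST; have [M1 HM1] := mass_bound sol ST.
exists (Num.max M1 (rho - Phi0)) => M; rewrite ge_max => /andP[M1M rM].
have inT t : 0 <= t <= S -> 0 <= t < T by lra.
split.
- by move=> t /inT tT; exact: dens_sol sol _ tT.
- by move=> t /HM1 [_ h]; exact: le_trans M1M.
- by move=> t /inT tT; apply: le_trans rM; exact: mom_id_le sol _ tT.
- move=> t /inT tT; have /andP[u1 u2] := u_bounds sol tT.
  have := ler_norm rho; have := ler_norm (- Phi0); rewrite normrN => h1 h2.
  have := normr_ge0 rho; have := normr_ge0 Phi0 => h3 h4.
  by rewrite ler_norml; apply/andP; split; lra.
- by move=> g C mg gC; exact: (mom_time_continuous sol ST mg gC).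
- move=> h x t h0 x0 tS; apply: (evolution_derive ab0 ca cb growth nlip dfin sol) => //; lra.
- move=> h x h0 x0; apply: (evolution_init ab0 ca cb growth nlip dfin sol) => //; lra.
Qed.

(** Under inflow the mass is a constant plus a primitive of [n (u t)]. The identity holds strictly
    before [S], whence the smaller horizon [S1]. *)
Lemma solution_mass f S x0 : LS_solution T rho Phi0 a b n fin f -> S < T -> 0 < x0 ->
  (forall t y, 0 <= t <= S -> 0 < y <= x0 -> b y <= a y * LS_u rho f t) ->
  forall S1, S1 < S -> {within `[0, S1], continuous (fun t => mom (f t) (cst 1))}.
Proof.
move=> sol ST x0_gt0 inflow S1 S1S.
have cn : {within `[0, S1], continuous (fun t => n (LS_u rho f t))}.
  by apply: (n_continuous nlip sol); lra.
apply: (@eq_within _ _ (fun t => mom fin (cst 1) + Rintegral mu `[0, t] (fun r => n (LS_u rho f r)))).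
  move=> t; rewrite /= in_itv /= => tS; symmetry.
  by apply: (mass_identity ab0 ca cb growth nlip dfin sol ST x0_gt0 inflow); lra.
apply: within_continuousD; first exact: within_cst.
exact: (primitive_derive cn).1.
Qed.

(** Both masses start from that of [fin], so only the nucleation terms differ; [u1] and [u2] take
    values between [Phi0] and [rho], where [n] is Lipschitz. *)
Lemma mass_difference f1 f2 S x0 : LS_solution T rho Phi0 a b n fin f1 ->
  LS_solution T rho Phi0 a b n fin f2 -> S < T -> 0 < x0 ->
  (forall t y, 0 <= t <= S -> 0 < y <= x0 -> b y <= a y * LS_u rho f1 t) ->
  (forall t y, 0 <= t <= S -> 0 < y <= x0 -> b y <= a y * LS_u rho f2 t) ->
  exists2 L : R, 0 <= L & forall s, 0 <= s < S ->
   `|mom (f1 s) (cst 1) - mom (f2 s) (cst 1)| <=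
   L * Rintegral mu `[0, s] (fun r => `|LS_u rho f1 r - LS_u rho f2 r|).
Proof.
move=> sol1 sol2 ST x0_gt0 in1 in2; have [L HL] := nlip rho.
exists `|L| => // s sS; have sT : s < T by lra.
rewrite (mass_identity ab0 ca cb growth nlip dfin sol1 ST x0_gt0 in1) //.
rewrite (mass_identity ab0 ca cb growth nlip dfin sol2 ST x0_gt0 in2) //.
have c1 := n_continuous nlip sol1 sT; have c2 := n_continuous nlip sol2 sT.
have cu1 := u_continuous sol1 sT; have cu2 := u_continuous sol2 sT.
have cd : {within `[0, s], continuous (fun r => `|LS_u rho f1 r - LS_u rho f2 r|)}.
  apply: within_continuous_comp; first exact: norm_continuous.
  exact: within_continuousB.
set m := mom fin _; set i1 := Rintegral _ _ _; set i2 := Rintegral _ _ _.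
have -> : m + i1 - (m + i2) = i1 - i2 by ring.
rewrite /i1 /i2 -RintegralB //; [|exact: within_integrable..].
rewrite -RintegralZl //; last exact: within_integrable.
apply: le_trans (le_normr_Rintegral _ _) _ => //.
  by apply: within_integrable; exact: within_continuousB.
apply: Rintegral_le.
- apply: within_continuous_comp; first exact: norm_continuous.
  exact: within_continuousB.
- by apply: within_continuousM => //; exact: within_cst.
move=> r rs; have rT : 0 <= r < T by lra.
have /andP[/ltW h1 h2] := u_bounds sol1 rT; have /andP[/ltW h3 h4] := u_bounds sol2 rT.
apply: le_trans (HL _ _ _ _) _; rewrite ?h1 ?h3 //.
by apply: ler_wpM2r => //; exact: ler_norm.
Qed.

End FlowOfSolution.

Section Initial.
Variable R : realType.
Notation mu := (@lebesgue_measure R).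
Notation HL := (@halfline R).
Implicit Types (x : R) (phi : R -> R).

Lemma dens_weighted phi : {ae mu, forall x, x \in `]0, +oo[ -> 0 <= phi x} ->
  mu.-integrable `]0, +oo[ (fun x => ((1 + x) * phi x)%:E) -> dens phi.
Proof.
move=> phi0 iphi.
have mw : measurable_fun HL (fun x => (1 + x) * phi x).
  by apply/measurable_EFinP; exact: measurable_int iphi.
have mphi : measurable_fun HL phi.
  apply: (eq_measurable_fun (fun x => (1 + x)^-1 * ((1 + x) * phi x))).
    by move=> x; rewrite inE HLE => x0; rewrite mulrA mulVf ?mul1r // gt_eqF // addr_gt0.
  apply: measurable_funM => //; apply: subspace_continuous_measurable_fun.
    exact: measurable_itv.
  apply: continuous_in_subspaceT => x; rewrite inE HLE => x0.
  apply: cvgV; first by rewrite gt_eqF // addr_gt0.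
  by apply: cvgD; [exact: cvg_cst|exact: cvg_id].
split.
- apply: le_integrable iphi; [exact: measurable_itv|exact/measurable_EFinP|].
  move=> x; rewrite -/(HL x) HLE => x0 /=; rewrite lee_fin normrM.
  by rewrite ler_peMl // ger0_norm; lra.
- apply: le_integrable iphi; [exact: measurable_itv| |].
    by apply/measurable_EFinP; apply: measurable_funM => //; exact: measurable_id.
  move=> x; rewrite -/(HL x) HLE => x0 /=; rewrite lee_fin !normrM.
  by apply: ler_wpM2r => //; rewrite !ger0_norm; lra.
- apply: filterS phi0; first exact: (ae_filter_ringOfSetsType mu).
  by move=> x H; rewrite inE HLE => x0; apply: H; rewrite in_itv /= andbT.
Qed.

End Initial.

(** * Choice of the inflow region and uniqueness at each time *)

Section Conclusion.
Variable R : realType.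
Notation mu := (@lebesgue_measure R).
Notation HL := (@halfline R).
Implicit Types (s t x y S M : R) (f : R -> R -> R).

Variables (rho Phi0 T : R) (a b n fin : R -> R).
Hypothesis ab0 : forall x, 0 <= x -> 0 <= a x /\ 0 <= b x.
Hypothesis ca : {within `[0, +oo[, continuous a}.
Hypothesis cb : {within `[0, +oo[, continuous b}.
Hypothesis da : forall x, 0 < x -> derivable a x 1 /\ {for x, continuous (derive1 a)}.
Hypothesis db : forall x, 0 < x -> derivable b x 1 /\ {for x, continuous (derive1 b)}.
Variable Mab : R.
Hypothesis derM : forall x, 1 < x -> `|derive1 a x| <= Mab /\ `|derive1 b x| <= Mab.
Hypothesis a_gt0 : forall x, 0 < x -> 0 < a x.
Hypothesis cPhi : (fun x => b x / a x) x @[x --> 0^'+] --> Phi0.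
Hypothesis nlip : forall K, exists L : R, forall s r, Phi0 <= s <= K -> Phi0 <= r <= K ->
       `|n s - n r| <= L * `|s - r|.
Variable xs : R.
Hypothesis xs_gt0 : 0 < xs.
Hypothesis mono : (forall x y, 0 < x -> x <= y -> y < xs -> b x / a x <= b y / a y) \/
                  (forall x y, 0 < x -> x <= y -> y < xs -> b y / a y <= b x / a x).
Hypothesis dfin : dens fin.
Variables f1 f2 : R -> R -> R.
Hypothesis sol1 : LS_solution T rho Phi0 a b n fin f1.
Hypothesis sol2 : LS_solution T rho Phi0 a b n fin f2.

Let Phi x := b x / a x.
Let dPhi x := (derive1 b x * a x - b x * derive1 a x) / a x ^+ 2.

Lemma u_gap f S : LS_solution T rho Phi0 a b n fin f -> 0 <= S -> S < T ->
  exists2 d : R, 0 < d & forall s, 0 <= s <= S -> Phi0 + d <= LS_u rho f s.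
Proof.
move=> sol S0 ST.
have [c cI H] := EVT_min S0 (u_continuous sol ST).
have cT : 0 <= c < T by move: cI; rewrite in_itv /=; lra.
have /andP[uc _] := u_bounds sol cT.
exists (LS_u rho f c - Phi0); first by rewrite subr_gt0.
by move=> s sS; rewrite addrC subrK; apply: H; rewrite in_itv.
Qed.

Lemma Phi_near d : 0 < d -> exists2 x0 : R, 0 < x0 < xs & forall x, 0 < x <= x0 -> Phi x <= Phi0 + d.
Proof.
move=> d0; have /cvgrPdist_le /(_ _ d0) := cPhi.
rewrite near_withinE => -[e /= e0 H].
exists (Num.min (e / 2) (xs / 2)).
  rewrite lt_min !divr_gt0 //=; apply: (@le_lt_trans _ _ (xs / 2)).
    by rewrite ge_min lexx orbT.
  by move: xs_gt0; lra.
move=> x /andP[x0]; rewrite le_min => /andP[xe _].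
have : `|Phi0 - Phi x| <= d.
  by apply: H => //=; rewrite sub0r normrN gtr0_norm //; lra.
by rewrite ler_norml => /andP[h _]; lra.
Qed.

Lemma dPhi_derive x : 0 < x -> is_derive x (1:R) Phi (dPhi x).
Proof.
move=> x1; apply: Phi_derive => // y y0; apply: derive1_is_derive.
  exact: (da y0).1.
exact: (db y0).1.
Qed.

Lemma dPhi_sign x0 d : 0 < d -> x0 < xs -> (forall x, 0 < x <= x0 -> Phi x <= Phi0 + d) ->
  exists2 kap : R, 0 <= kap & forall u x, 0 < x <= x0 -> Phi0 + d + d <= u ->
    dPhi x * (kap * (u - Phi x) - 1) <= 0.
Proof.
move=> d0 x0s near; case: mono => mon.
  exists 0 => // u x /andP[x1 xx0] _.
  have h : 0 <= dPhi x.
    by apply: (is_derive_mono_ge0 mon x1 _ (dPhi_derive x1)); exact: le_lt_trans x0s.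
  by rewrite mul0r sub0r mulrN1 oppr_le0.
(* Near 0 one has [u - Phi x >= d], so with this [kap] the second factor is nonnegative while
   [dPhi x] is not positive. *)
exists d^-1; first by rewrite invr_ge0 ltW.
move=> u x xI ud; have [x1 xx0] := andP xI.
have h : 0 <= - dPhi x.
  have dN := is_derive_scale (-1) (dPhi_derive x1); rewrite mulN1r in dN.
  apply: (is_derive_mono_ge0 _ x1 _ dN); last exact: le_lt_trans x0s.
  by move=> y z y0 yz zs; rewrite !mulN1r lerN2; exact: mon.
rewrite -[_ * _]opprK -mulNr oppr_le0 mulr_ge0 // subr_ge0.
rewrite ler_pdivlMl // mulr1; have := near x xI; lra.
Qed.

Lemma solutions_agree t : 0 <= t < T ->
  {ae mu, forall x, x \in HL -> f1 t x = f2 t x}.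
Proof.
move=> /andP[t0 tT].
(* Three nested times [t < S < S' < T]: inflow holds up to [S'], the mass identity strictly before
   [S'], hence on all of [[0, S]], where the stability estimate runs. *)
pose S' := (t + T) / 2; pose S := (t + S') / 2.
have S'T : S' < T by rewrite /S'; lra.
have SS' : S < S' by rewrite /S /S'; lra.
have tS : t < S by rewrite /S /S'; lra.
have S0 : 0 < S by lra.
have S'0 : 0 <= S' by lra.
have ST : S < T by lra.
have derMa x : 1 < x -> `|derive1 a x| <= Mab by move=> x1; case: (derM x1).
have derMb x : 1 < x -> `|derive1 b x| <= Mab by move=> x1; case: (derM x1).
have [Aa Aa0 HAa] := rate_growth ca da derMa.
have [Ab Ab0 HAb] := rate_growth cb db derMb.
pose A := Aa + Ab.
have A0 : 0 < A by rewrite addr_gt0.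
have growth x : 0 <= x -> a x <= A * (1 + x) /\ b x <= A * (1 + x).
  move=> x0; have h1 := HAa x x0; have h2 := HAb x x0.
  have x1 : 0 <= 1 + x by rewrite addr_ge0.
  have z1 : 0 <= Aa * (1 + x) by rewrite mulr_ge0 // ltW.
  have z2 : 0 <= Ab * (1 + x) by rewrite mulr_ge0 // ltW.
  have := ler_norm (a x); have := ler_norm (b x) => h3 h4.
  by rewrite /A mulrDl; split; lra.
have lips al : 0 < al -> exists2 L : R, 0 <= L & forall x y, al <= x -> x <= y ->
    `|a y - a x| <= L * (y - x) /\ `|b y - b x| <= L * (y - x).
  move=> al0; have [La La0 [_ HLa]] := rate_lip da derMa al0.
  have [Lb Lb0 [_ HLb]] := rate_lip db derMb al0.
  exists (La + Lb); first exact: addr_ge0.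
  move=> x y ax xy; have xy' : 0 <= y - x by rewrite subr_ge0.
  rewrite mulrDl; split.
    by apply: le_trans (HLa x y ax xy) _; rewrite lerDl mulr_ge0.
  by apply: le_trans (HLb x y ax xy) _; rewrite lerDr mulr_ge0.
have [e1 e10 gap1] := u_gap sol1 S'0 S'T.
have [e2 e20 gap2] := u_gap sol2 S'0 S'T.
(* Half of the gap between [u] and [Phi0] is left to the variation of [Phi] near 0, the other half
   remains as a lower bound of [u - Phi] for both solutions. *)
pose d := Num.min e1 e2 / 2.
have d0 : 0 < d by rewrite divr_gt0 // lt_min e10.
have dd : d + d = Num.min e1 e2 by rewrite /d; lra.
have {}gap1 s : 0 <= s <= S' -> Phi0 + d + d <= LS_u rho f1 s.
  move=> sS; apply: le_trans (gap1 s sS); rewrite -addrA dd lerD2l.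
  by rewrite ge_min lexx.
have {}gap2 s : 0 <= s <= S' -> Phi0 + d + d <= LS_u rho f2 s.
  move=> sS; apply: le_trans (gap2 s sS); rewrite -addrA dd lerD2l.
  by rewrite ge_min lexx orbT.
have [x0 /andP[x00 x0s] near0] := Phi_near d0.
have [kap kap0 sgn] := dPhi_sign d0 x0s near0.
have inflow u x : 0 < x <= x0 -> Phi0 + d + d <= u -> b x <= a x * u.
  move=> xI ud; have x1 : 0 < x by case/andP: xI.
  rewrite mulrC -ler_pdivrMr ?a_gt0 //; have := near0 x xI; rewrite /Phi; lra.
have in1 s y : 0 <= s <= S' -> 0 < y <= x0 -> b y <= a y * LS_u rho f1 s.
  by move=> sS yI; apply: inflow => //; exact: gap1.
have in2 s y : 0 <= s <= S' -> 0 < y <= x0 -> b y <= a y * LS_u rho f2 s.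
  by move=> sS yI; apply: inflow => //; exact: gap2.
have [M1 HM1] := solution_flow ab0 ca cb growth nlip dfin sol1 S0 ST.
have [M2 HM2] := solution_flow ab0 ca cb growth nlip dfin sol2 S0 ST.
pose M := Num.max M1 M2.
have fl1 : flow a b S (`|Phi0| + `|rho|) M (LS_u rho f1) fin f1.
  by apply: HM1; rewrite le_max lexx.
have fl2 : flow a b S (`|Phi0| + `|rho|) M (LS_u rho f2) fin f2.
  by apply: HM2; rewrite le_max lexx orbT.
have [Ln Ln0 md] := mass_difference ab0 ca cb growth nlip dfin sol1 sol2 S'T x00 in1 in2.
have cm1 := solution_mass ab0 ca cb growth nlip dfin sol1 S'T x00 in1 SS'.
have cm2 := solution_mass ab0 ca cb growth nlip dfin sol2 S'T x00 in2 SS'.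
have [La La0 [HLa _]] := rate_lip da derMa x00.
have [Lb Lb0 [HLb _]] := rate_lip db derMb x00.
have derb x : x0 <= x -> `|derive1 a x| <= La + Lb /\ `|derive1 b x| <= La + Lb.
  move=> xx0; split.
    by apply: le_trans (HLa x xx0) _; rewrite lerDl.
  by apply: le_trans (HLb x xx0) _; rewrite lerDr.
have tT' : 0 <= t < T by rewrite t0.
apply: (@ae_eq_of_excess R (f1 t) (f2 t) x0) => //.
- exact: dens_sol sol1 _ tT'.
- exact: dens_sol sol2 _ tT'.
move=> al ga al0 alx0 x0ga.
have sS' s : 0 <= s <= S -> 0 <= s <= S' by lra.
have sgn1 s x : 0 <= s <= S -> 0 < x <= x0 -> dPhi x * (kap * (LS_u rho f1 s - Phi x) - 1) <= 0.
  by move=> sS xI; apply: sgn => //; apply: gap1; exact: sS'.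
have pos1 s x : 0 <= s <= S -> 0 < x <= x0 -> 0 <= LS_u rho f1 s - Phi x.
  by move=> sS xI; have := near0 x xI; have := gap1 s (sS' s sS); lra.
have md1 s : 0 <= s <= S -> `|mom (f1 s) (cst 1) - mom (f2 s) (cst 1)| <=
    Ln * Rintegral mu `[0, s] (fun r => `|LS_u rho f1 r - LS_u rho f2 r|).
  by move=> sS; apply: md; lra.
have tS1 : 0 <= t <= S by rewrite t0 ltW.
exact: (stability (adm_a ab0 ca growth) (adm_b ab0 cb growth)
  a_gt0 (fun x px => (ab0 (ltW px)).2)
  (fun x px => derive1_is_derive (da px).1) (fun x px => derive1_is_derive (db px).1)
  (fun x px => (da px).2) (fun x px => (db px).2) A0
  (fun x px => growth x (ltW px)) lips x00 (addr_ge0 La0 Lb0) derb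
  S0 fl1 fl2 (fun s _ => erefl) (fun s _ => erefl) kap0 sgn1 pos1 Ln0 md1 cm1 cm2
  tS1 al0 alx0 x0ga).
Qed.

End Conclusion.

Unset Implicit Arguments.

Theorem mainTheorem2 (R : realType) (rho Phi0 : R) (a b n fin : R -> R) :
  0 < rho ->
  (* a, b : [0,oo) -> [0,oo) *)
  (forall x, 0 <= x -> 0 <= a x /\ 0 <= b x) ->
  (* (i) continuity on [0,oo), C^1 on (0,oo) *)
  {within `[0, +oo[, continuous a} ->
  {within `[0, +oo[, continuous b} ->
  (forall x, 0 < x -> derivable a x 1 /\ {for x, continuous (derive1 a)}) ->
  (forall x, 0 < x -> derivable b x 1 /\ {for x, continuous (derive1 b)}) ->
  (* (ii) a', b' bounded on (1,oo) *)
  (exists M : R, forall x, 1 < x -> `|(derive1 a) x| <= M /\ `|(derive1 b) x| <= M) ->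
  (* (iii) a > 0 on (0,oo), 1/a in L^1(0,1) *)
  (forall x, 0 < x -> 0 < a x) ->
  (@lebesgue_measure R).-integrable `]0, 1[ (fun x => ((a x)^-1)%:E) ->
  (* (iv) Phi = b/a -> Phi0 at 0+, Phi0 < rho, Phi' in L^1(0,1) *)
  ((fun x => b x / a x) x @[x --> 0^'+] --> Phi0) ->
  Phi0 < rho ->
  (@lebesgue_measure R).-integrable `]0, 1[
     (fun x => (derive1 (fun y => b y / a y) x)%:E) ->
  (* (v) n nonnegative, locally Lipschitz on [Phi0,oo) *)
  (forall s, Phi0 <= s -> 0 <= n s) ->
  (forall K, exists L : R, forall s r, Phi0 <= s <= K -> Phi0 <= r <= K ->
       `|n s - n r| <= L * `|s - r|) ->
  (* (vi) Phi monotone on (0,x* ) *)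
  (exists xs : R, 0 < xs /\
     ((forall x y, 0 < x -> x <= y -> y < xs -> b x / a x <= b y / a y) \/
      (forall x y, 0 < x -> x <= y -> y < xs -> b y / a y <= b x / a x))) ->
  (* initial datum *)
  {ae @lebesgue_measure R, forall x, x \in `]0, +oo[ -> 0 <= fin x} ->
  (@lebesgue_measure R).-integrable `]0, +oo[ (fun x => ((1 + x) * fin x)%:E) ->
  (Phi0%:E < rho%:E - \int[@lebesgue_measure R]_(x in @halfline R) (x * fin x)%:E)%E ->
  forall T : R, 0 < T ->
  forall f1 f2 : R -> R -> R,
    LS_solution T rho Phi0 a b n fin f1 ->
    LS_solution T rho Phi0 a b n fin f2 ->
    forall t, t \in `[0, T[ ->
      {ae @lebesgue_measure R, forall x, x \in `]0, +oo[ -> f1 t x = f2 t x}.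
Proof.
move=> _ ab0 ca cb da db [M derM] a0 _ cPhi _ _ _ nlip [xs [xs0 mono]] fin0 ifin _ T _.
move=> f1 f2 sol1 sol2 t; rewrite in_itv /= => tT.
have := solutions_agree ab0 ca cb da db derM a0 cPhi nlip xs0 mono
  (dens_weighted fin0 ifin) sol1 sol2 tT.
apply: filterS; first exact: (ae_filter_ringOfSetsType (@lebesgue_measure R)).
by move=> x H; rewrite in_itv /= andbT => x0; apply: H; rewrite inE HLE.
Qed.
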